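(* For $e=7$ and $n$ large enough, the graph $G^{min}_{n,n-7}$ (a connected graph with minimal spectral radius among all connected graphs on $n$ vertices with diameter $n-7$) is unique up to graph isomorphism, and (1) if $n=3k+14$, then $G^{min}_{n,n-7}=T_{(k,k,k)}$; (2) if $n=3k+15$, then $G^{min}_{n,n-7}=T_{(k,k+1,k)}$; (3) if $n=3k+16$, then $G^{min}_{n,n-7}=T_{(k,k+2,k)}$.
   Context: All graphs are finite and simple. The spectral radius of a graph is the largest eigenvalue of its adjacency matrix; the diameter of a connected graph is the maximum distance between two of its vertices. $G^{min}_{n,D}$ denotes a graph with minimal spectral radius among all connected graphs on $n$ vertices with diameter $D$; equality of graphs means isomorphism. Let $e\ge 6$ and $r=e-4$. For non-negative integers $k_1,\ldots,k_r$, put $n=2e+\sum_{i=1}^r k_i$. The tree $T_{(k_1,\ldots,k_r)}$ is obtained from the path $0\sim 1\sim\cdots\sim (n-e)$ on $n-e+1$ vertices as follows: set $m_1=2$ and $m_{i+1}=m_i+k_i+1$ for $1\le i\le r$ (so $m_{r+1}=n-e-2$); at each of $m_1$ and $m_{r+1}$ attach a pendant path on $2$ vertices (joining one of its end vertices by an edge to $m_1$, resp. $m_{r+1}$), and at each $m_i$ with $2\le i\le r$ attach a single pendant vertex. Here $e=7$, $r=3$. *)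

(* Defs.v *)
From HB Require Import structures.
From mathcomp Require Import all_boot all_order all_algebra.
From mathcomp Require Import classical_sets reals.

Set Implicit Arguments.
Unset Strict Implicit.
Unset Printing Implicit Defensive.

Record sgraph := SGraph {
  vertex :> finType;
  adj : rel vertex;
  adj_sym : symmetric adj;
  adj_irr : irreflexive adj }.

Definition connected_graph (G : sgraph) : Prop :=
  forall x y : G, connect (@adj G) x y.

Definition has_walk (G : sgraph) (d : nat) (x y : G) : bool :=
  [exists p : d.-tuple G, path (@adj G) x p && (last x p == y)].

(* A shortest walk has length < #|G|; dist is #|G| if y is unreachable from x. *)
Definition dist (G : sgraph) (x y : G) : nat :=
  find (fun d => has_walk d x y) (iota 0 #|G|).

Definition diameter (G : sgraph) : nat :=
  \max_(x : G) \max_(y : G) dist x y.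

Definition isomorphic (G H : sgraph) : Prop :=
  exists f : G -> H, bijective f /\ forall x y, adj (f x) (f y) = adj x y.

Definition adjmx (R : realType) (G : sgraph) : 'M[R]_#|G| :=
  \matrix_(i, j) ((adj (enum_val i) (enum_val j))%:R)%R.

Definition largest_eigenvalue (R : realType) (n : nat) (A : 'M[R]_n) (a : R) :
    Prop :=
  eigenvalue A a /\ forall b : R, eigenvalue A b -> (b <= a)%R.

(* Real symmetric matrices of positive size have a largest eigenvalue, so the
   default value 0 is only used for the empty graph. *)
Definition spectral_radius (R : realType) (G : sgraph) : R :=
  xget 0%R [set a : R | largest_eigenvalue (adjmx R G) a]%classic.

Definition conn_order_diam (n D : nat) (G : sgraph) : Prop :=
  [/\ connected_graph G, #|G| = n & diameter G = D].

Definition is_Gmin (R : realType) (n D : nat) (G : sgraph) : Prop :=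
  conn_order_diam n D G /\
  forall H : sgraph, conn_order_diam n D H ->
    (spectral_radius R G <= spectral_radius R H)%R.

(* The tree T_(k_1, ..., k_r) for k = [:: k_1; ...; k_r], r >= 2.  With
   e = r + 4 and n = 2 * e + sumn k one has n - e = r + 4 + sumn k. *)

(* attach k i is m_(i+1), for 0 <= i <= r. *)
Fixpoint attach (k : seq nat) (i : nat) : nat :=
  if i is j.+1 then attach k j + nth 0 k j + 1 else 2.

(* Number of pendant vertices hanging below position p of the path
   0 ~ 1 ~ ... ~ n - e. *)
Definition depth (k : seq nat) (p : nat) : nat :=
  if (p == attach k 0) || (p == attach k (size k)) then 2
  else if p \in [seq attach k i | i <- iota 1 (size k).-1] then 1
  else 0.

(* The vertex (p, 0) is position p of the path; (p, 1) and (p, 2) are the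
   successive vertices of the pendant path attached at p. *)
Definition Tvertex (k : seq nat) : finType :=
  {v : 'I_(size k + 4 + sumn k).+1 * 'I_3 | v.2 <= depth k v.1}.

Definition Tpos (k : seq nat) (u : Tvertex k) : nat := (val u).1.
Definition Tlevel (k : seq nat) (u : Tvertex k) : nat := (val u).2.

Definition Tstep (k : seq nat) (u v : Tvertex k) : bool :=
  [&& Tpos v == (Tpos u).+1, Tlevel u == 0 & Tlevel v == 0] ||
  (Tpos u == Tpos v) && (Tlevel v == (Tlevel u).+1).

Definition Tadj (k : seq nat) : rel (Tvertex k) :=
  fun u v => Tstep u v || Tstep v u.

Lemma Tadj_sym (k : seq nat) : symmetric (@Tadj k).
Proof. by move=> u v; rewrite /Tadj orbC. Qed.

Lemma Tadj_irr (k : seq nat) : irreflexive (@Tadj k).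
Proof. by move=> u; rewrite /Tadj orbb /Tstep !(ltn_eqF (ltnSn _)) andbF. Qed.

Definition T (k : seq nat) : sgraph := SGraph (@Tadj_sym k) (@Tadj_irr k).

(* Main.v *)
(* If rho(H) <= lambda = t + 1/t, the Perron vector of H is superharmonic for lambda.  Along a diametral
   path measure the ratio of consecutive values by its excess over the decay rate 1/t, and put s = t^2,
   eps = s^2 - s - 1.  Across g edges the two excesses h, h' satisfy h h' >= s^-g (1 - h)(1 - h'); at a
   pendant vertex, or at an end carrying two paths of length 2, the excess is O(eps), while any other end
   only gives a bound away from 1.  So a gap between pendant vertices has weight s^-g = O(eps^2), a first
   or last gap O(eps), or O(eps^2) next to an end of the first kind.  Let lambda be the spectral radius of
   the candidate tree: there all relations are equalities and s^-(n-7) is of order eps^6, so another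
   distribution of the six vertices off the path, which has weight O(eps^7), is impossible.  That these
   vertices only form pendant paths of length 1 or 2 follows from crude numerical bounds on the ratios,
   together with the diameter.  Among the trees T_(k1,k2,k3) the exact feasibility condition is
   w2 MM(w1) MM(w3) <= NN(w1) NN(w3) with w_i = s^-(k_i+1) and affine MM, NN; dividing by the equality for
   the candidate leaves a quadratic in X = s^(k_1-k), whose roots 1 and r satisfy 1/s < r < s, so that it
   is positive at every power X <> 1 of s. *)
Require Import Defs.
From HB Require Import structures.
From mathcomp Require Import all_boot all_order all_algebra.
From mathcomp Require Import classical_sets reals.
From mathcomp Require boolp topology normedtype derive.
From mathcomp Require Import ring lra zify.

Set Implicit Arguments.
Unset Strict Implicit.
Unset Printing Implicit Defensive.

(** * Perron vectors *)

Section Perron.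
Import boolp topology normedtype derive.
Import Order.TTheory GRing.Theory Num.Theory.
Import numFieldNormedType.Exports.
Local Open Scope ring_scope.
Local Open Scope classical_set_scope.
Variable R : realType.

(** Nothing is solved for lambda. The candidate enters through one equation, called [res] below and
    satisfied by its own eigenvector; it both bounds [w] from below and places the second root r. A
    competitor enters spectrally only through a positive vector whose neighbour sums are at most
    lambda times its values. Dropping neighbours preserves such inequalities, so a competitor may
    contain cycles until it is shown to be a tree. The constants come from the limit: [s] tends to
    the golden ratio and lambda to sqrt (2 + sqrt 5), about 2.058, whence 103/50 in the local
    bounds. Comparing powers of [eps] against numerical factors demands a far smaller [eps], and
    this is what makes [k] large. The weak spots are positions 1 and D - 1: the arm beyond them is
    so short that the ratios do not exclude longer pendant paths there, and the diameter has to do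
    it. *)

Definition bform n (A : 'M[R]_n) (x z : 'rV[R]_n) : R :=
  \sum_i \sum_j A i j * x 0 i * z 0 j.

Definition sqn n (x : 'rV[R]_n) : R := \sum_i x 0 i ^+ 2.

Lemma sqn_ge0 n (x : 'rV[R]_n) : 0 <= sqn x.
Proof. by apply: sumr_ge0 => i _; apply: sqr_ge0. Qed.

Lemma sqn_eq0 n (x : 'rV[R]_n) : sqn x = 0 -> x = 0.
Proof.
move=> /eqP; rewrite psumr_eq0 => [/allP h|i _]; last exact: sqr_ge0.
apply/rowP => i; rewrite mxE; apply/eqP; rewrite -sqrf_eq0.
exact: h (mem_index_enum i).
Qed.

Lemma cvg_sumr (I : finType) (T : topologicalType) (f : I -> T -> R) x :
  (forall i, f i z @[z --> x] --> f i x) ->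
  \sum_i f i z @[z --> x] --> \sum_i f i x.
Proof. by move=> fi; apply: cvg_big => //; apply: add_continuous. Qed.

Lemma continuous_bform n (A : 'M[R]_n) :
  continuous (fun x : 'rV[R]_n => bform A x x).
Proof.
move=> x; apply: cvg_sumr => i; apply: cvg_sumr => j.
have hc k : (fun z : 'rV[R]_n => z 0 k) z @[z --> x] --> x 0 k.
  exact: coord_continuous.
have F := nbhs_filter x.
exact: (@cvgM _ _ _ F _ _ _ _ (@cvgMl_tmp _ _ _ F _ (A i j) _ (hc i)) (hc j)).
Qed.

Lemma continuous_sqn n : continuous (@sqn n).
Proof.
move=> x; apply: cvg_sumr => i.
have F := nbhs_filter x.
have hc : (fun z : 'rV[R]_n => z 0 i) z @[z --> x] --> x 0 i.
  exact: coord_continuous.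
exact: (@cvgM _ _ _ F _ _ _ _ hc hc).
Qed.

Lemma sphere_max n (A : 'M[R]_n) : (0 < n)%N ->
  exists2 c : 'rV[R]_n, sqn c = 1 & forall z, sqn z = 1 -> bform A z z <= bform A c c.
Proof.
case: n A => // n A _.
pose K := [set x : 'rV[R]_n.+1 | sqn x = 1]%classic.
have K0 : (K !=set0)%classic.
  exists (delta_mx 0 0); rewrite /K /= /sqn (bigD1 ord0) //= big1 => [|i i0].
    by rewrite mxE !eqxx expr1n addr0.
  by rewrite mxE (negbTE i0) andbF expr0n.
have cK : compact K.
  apply: (@subclosed_compact _ _ [set v : 'rV[R]_n.+1 |
     forall i, `[(-1 : R), 1]%classic (v ord0 i)]%classic).
  - rewrite (_ : K = (@sqn n.+1) @^-1` [set 1 : R])%classic //.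
    apply: closed_comp; last exact: closed_eq.
    by move=> x _; apply: continuous_sqn.
  - by apply: (@rV_compact R _ (fun=> `[(-1 : R), 1]%classic)) => i; apply: segment_compact.
  - move=> v; rewrite /K /= => v1 i; rewrite /= in_itv /= -ler_norml.
    rewrite -(@ler_pXn2r _ 2) ?nnegrE // expr1n real_normK ?num_real //.
    rewrite -v1 /sqn (bigD1 i) //= lerDl; apply: sumr_ge0 => j _; exact: sqr_ge0.
have [|c cK' cmax] := @compact_EVT_max _ R (fun x => bform A x x) K K0 cK.
  by apply: continuous_subspaceT; apply: continuous_bform.
exists c; first by move: cK'; rewrite inE.
by move=> z z1; apply: cmax; rewrite inE.
Qed.

Lemma bformZ n (A : 'M[R]_n) a x : bform A (a *: x) (a *: x) = a ^+ 2 * bform A x x.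
Proof.
rewrite /bform mulr_sumr; apply: eq_bigr => i _; rewrite mulr_sumr.
by apply: eq_bigr => j _; rewrite !mxE; ring.
Qed.

Lemma sqnZ n a (x : 'rV[R]_n) : sqn (a *: x) = a ^+ 2 * sqn x.
Proof.
by rewrite /sqn mulr_sumr; apply: eq_bigr => i _; rewrite !mxE exprMn.
Qed.

Lemma rayleigh n (A : 'M[R]_n) : (0 < n)%N ->
  exists2 c : 'rV[R]_n, sqn c = 1 &
    forall z, bform A z z <= bform A c c * sqn z.
Proof.
move=> n0; have [c c1 cm] := sphere_max A n0; exists c => // z.
have [z0|z0] := eqVneq (sqn z) 0.
  rewrite z0 mulr0 (sqn_eq0 z0) /bform big1 // => i _.
  by rewrite big1 // => j _; rewrite !mxE mulr0.
have zp : 0 < sqn z by rewrite lt_def z0 sqn_ge0.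
set a := Num.sqrt (sqn z).
have a2 : a ^+ 2 = sqn z by rewrite sqr_sqrtr // ltW.
have ap : 0 < a by rewrite sqrtr_gt0.
have := cm (a^-1 *: z); rewrite sqnZ bformZ exprVn a2 mulVf // => /(_ erefl).
by rewrite mulrC ler_pdivrMr.
Qed.

Lemma bformDZ n (A : 'M[R]_n) (x z : 'rV[R]_n) e : A^T = A ->
  bform A (x + e *: z) (x + e *: z) =
  bform A x x + e *+ 2 * bform A x z + e ^+ 2 * bform A z z.
Proof.
move=> As.
have sw : bform A z x = bform A x z.
  rewrite /bform exchange_big; apply: eq_bigr => i _; apply: eq_bigr => j _.
  by rewrite -{1}As mxE; ring.
rewrite mulr2n mulrDl -{2}sw /bform !mulr_sumr -!big_split /=.
apply: eq_bigr => i _; rewrite !mulr_sumr -!big_split /=.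
by apply: eq_bigr => j _; rewrite !mxE; ring.
Qed.

Lemma sqnDZ n (x z : 'rV[R]_n) e :
  sqn (x + e *: z) = sqn x + e *+ 2 * (\sum_i x 0 i * z 0 i) + e ^+ 2 * sqn z.
Proof.
rewrite /sqn !mulr_sumr -!big_split /=.
by apply: eq_bigr => i _; rewrite !mxE; ring.
Qed.

(** First variation: moving from the maximiser [c] along the residual [z] would raise the form, to
    first order, by twice [sqn z], so the residual vanishes. *)
Lemma rayleigh_eigen n (A : 'M[R]_n) (c : 'rV[R]_n) m : A^T = A ->
  bform A c c = m * sqn c -> (forall z, bform A z z <= m * sqn z) ->
  c *m A = m *: c.
Proof.
move=> As cm zm; pose z := c *m A - m *: c.
have zz : bform A c z = m * (\sum_i c 0 i * z 0 i) + sqn z.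
  rewrite /bform exchange_big /= mulr_sumr -big_split /=; apply: eq_bigr => j _.
  rewrite -mulr_suml (_ : \sum_i _ = (c *m A) 0 j); last first.
    by rewrite mxE; apply: eq_bigr => i _; rewrite mulrC.
  by rewrite {2 3}/z !mxE; ring.
set C := bform A z z - m * sqn z.
have key e : 0 < e -> sqn z *+ 2 + e * C <= 0.
  move=> e0; have := zm (c + e *: z).
  rewrite bformDZ // sqnDZ cm zz => h; rewrite -(pmulr_rle0 _ e0) /C.
  have -> : sqn z *+ 2 = 2 * sqn z by rewrite mulr2n mulrDl !mul1r.
  by move: h; rewrite !mulr2n !expr2 => h; lra.
have C0 : C <= 0 by rewrite subr_le0 zm.
suff /sqn_eq0 /eqP : sqn z = 0 by rewrite subr_eq0 => /eqP.
apply/eqP; case: (eqVneq (sqn z) 0) => // z0.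
have zp : 0 < sqn z by rewrite lt_def z0 sqn_ge0.
have C1 : 0 < 1 - C by lra.
(* This step length keeps the second-order term above [- sqn z], against a first-order term of twice
   [sqn z]. *)
have := key (sqn z / (1 - C)) (divr_gt0 zp C1).
have : sqn z / (1 - C) * C >= - sqn z.
  rewrite mulrAC ler_pdivlMr //; nra.
rewrite mulr2n; lra.
Qed.

Lemma eigen_le_rayleigh n (A : 'M[R]_n) m b :
  (forall z, bform A z z <= m * sqn z) -> eigenvalue A b -> b <= m.
Proof.
move=> zm /eigenvalueP[v vA v0].
have vp : 0 < sqn v.
  by rewrite lt_def sqn_ge0 andbT; apply: contra_neq v0; apply: sqn_eq0.
rewrite -(ler_pM2r vp); apply: le_trans (zm v).
rewrite /bform exchange_big /sqn mulr_sumr; apply: ler_sum => j _ /=.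
rewrite -mulr_suml (_ : \sum_i _ = (v *m A) 0 j); last first.
  by rewrite mxE; apply: eq_bigr => i _; rewrite mulrC.
by rewrite vA mxE expr2 mulrA.
Qed.

Lemma spectral_radiusP (G : sgraph) : (0 < #|G|)%N ->
  exists y : G -> R, [/\ forall v, 0 <= y v, exists v, y v != 0 &
    forall v, \sum_(u | adj v u) y u = spectral_radius R G * y v].
Proof.
move=> G0; set A := adjmx R G; have [c c1 cm] := rayleigh A G0.
have As : A^T = A by apply/matrixP => i j; rewrite !mxE adj_sym.
set m := bform A c c in cm *.
have cE : c *m A = m *: c by apply: rayleigh_eigen => //; rewrite c1 mulr1.
have c0 : c != 0.
  by apply/eqP => c0; move: c1; rewrite /sqn big1 => [/eqP|i _];
    rewrite ?(eq_sym 0) ?oner_eq0 // c0 mxE expr0n.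
have mL : largest_eigenvalue A m.
  by split; [apply/eigenvalueP; exists c | move=> b; apply: eigen_le_rayleigh].
have mrho : spectral_radius R G = m.
  rewrite /spectral_radius; case: xgetP => [x -> [xe xm]|/(_ m)//].
  by apply/eqP; rewrite eq_le xm ?andbT; [apply: mL.2|apply: mL.1].
(* The entries of [A] are nonnegative, so absolute values cannot decrease the form: [d] is again a
   maximiser, hence an eigenvector. *)
pose d : 'rV[R]_#|G| := map_mx Num.norm c.
have dm : bform A d d = m * sqn d.
  have dc : sqn d = sqn c.
    by apply: eq_bigr => i _; rewrite mxE real_normK ?num_real.
  apply/eqP; rewrite eq_le cm dc c1 mulr1.
  apply: ler_sum => i _; apply: ler_sum => j _.
  rewrite !mxE -mulrA -mulrA -normrM ler_wpM2l ?ler0n //; exact: ler_norm.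
have dE := rayleigh_eigen As dm cm.
exists (fun v => d 0 (enum_rank v)); split.
- by move=> v; rewrite mxE normr_ge0.
- have /rV0Pn[i ci] := c0; exists (enum_val i).
  by rewrite enum_valK mxE normr_eq0.
- move=> v; rewrite mrho.
  have /rowP/(_ (enum_rank v)) := dE; rewrite [in RHS]mxE => <-.
  rewrite [in RHS]mxE (reindex _ (onW_bij _ (enum_val_bij _))) /=.
  rewrite [RHS](bigID (fun i => adj v (enum_val i))) /= [X in _ + X]big1 ?addr0.
    apply: eq_bigr => i vi.
    by rewrite enum_valK [A _ _]mxE enum_rankK adj_sym vi mulr1.
  by move=> i vi; rewrite [A _ _]mxE enum_rankK adj_sym (negbTE vi) mulr0.
Qed.

(** Where a nonnegative eigenvector vanishes, so do all neighbours; by connectedness one zero would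
    kill the whole vector. *)
Lemma perron (G : sgraph) : connected_graph G -> (0 < #|G|)%N ->
  exists y : G -> R, (forall v, 0 < y v) /\
    forall v, \sum_(u | adj v u) y u = spectral_radius R G * y v.
Proof.
move=> Gc G0; have [y [y0 [x yx] yE]] := spectral_radiusP G0.
exists y; split=> // v; rewrite lt_def y0 andbT; apply: contra_neq yx => yv.
have /connectP[p + ->] := Gc v x.
elim: p v yv => //= a p IH v yv /andP[va]; apply: IH.
move/eqP: (yE v); rewrite yv mulr0 psumr_eq0 => [/allP h|u _]; last exact: y0.
by apply/eqP; move: (h a (mem_index_enum a)); rewrite va.
Qed.

(** Pairing the two vectors through the symmetric adjacency relation evaluates one double sum as [a]
    and as [b] times the same positive number. This transports spectral radii along isomorphisms. *)
Lemma positive_eigen_unique (G : sgraph) (y z : G -> R) (a b : R) :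
  (0 < #|G|)%N -> (forall v, 0 < y v) -> (forall v, 0 < z v) ->
  (forall v, \sum_(u | adj v u) y u = a * y v) ->
  (forall v, \sum_(u | adj v u) z u = b * z v) -> a = b.
Proof.
move=> G0 y0 z0 yE zE.
have p0 : 0 < \sum_v y v * z v.
  have /card_gt0P[x _] := G0.
  rewrite (bigD1 x) //= ltr_pwDl ?mulr_gt0 //.
  by apply: sumr_ge0 => i _; rewrite ltW // mulr_gt0.
apply: (mulIf (lt0r_neq0 p0)); rewrite !mulr_sumr.
transitivity (\sum_v \sum_(u | adj v u) y u * z v).
  by apply: eq_bigr => v _; rewrite mulrA -yE mulr_suml.
rewrite (exchange_big_dep predT) //=; apply: eq_bigr => u _.
rewrite mulrCA -zE mulr_sumr; apply: eq_big => [v|v _]; first by rewrite adj_sym.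
by rewrite mulrC.
Qed.

End Perron.

(** * Distances and geodesics *)

Section Distance.
Variable G : sgraph.
Implicit Types x y z : G.

Lemma has_walkP d x y :
  reflect (exists p, [/\ size p = d, path (@adj G) x p & last x p = y])
          (has_walk d x y).
Proof.
apply: (iffP existsP) => [[p /andP[pp /eqP py]]|[p [/eqP pd pp py]]].
  by exists p; rewrite size_tuple.
by exists (Tuple pd); rewrite pp py eqxx.
Qed.

Lemma has_walk0 x : has_walk 0 x x.
Proof. by apply/has_walkP; exists [::]. Qed.

Lemma has_walk_cat a b x z y :
  has_walk a x z -> has_walk b z y -> has_walk (a + b) x y.
Proof.
move=> /has_walkP[p [<- pp pz]] /has_walkP[q [<- qq qy]].
by apply/has_walkP; exists (p ++ q); rewrite size_cat cat_path last_cat pp pz.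
Qed.

Lemma has_walk1 x y : adj x y -> has_walk 1 x y.
Proof. by move=> xy; apply/has_walkP; exists [:: y]; rewrite /= xy. Qed.

Lemma has_walkS d x y : has_walk d.+1 x y -> exists2 z, adj x z & has_walk d z y.
Proof.
move=> /has_walkP[[|z p] [//= [sp] /andP[xz pp] py]].
by exists z => //; apply/has_walkP; exists p.
Qed.

Lemma has_walk_sym d x y : has_walk d x y -> has_walk d y x.
Proof.
elim: d x y => [|d IH] x y.
  by move=> /has_walkP[[|a p] [//= _ _ <-]]; apply: has_walk0.
move=> /has_walkS[z xz /IH zy]; rewrite -addn1.
by apply: has_walk_cat zy _; apply: has_walk1; rewrite adj_sym.
Qed.

Lemma dist_le d x y : has_walk d x y -> dist x y <= d.
Proof.
move=> w; rewrite leqNgt; apply/negP => /[dup] lt /(before_find 0).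
rewrite nth_iota ?add0n ?w //; apply: leq_trans lt _.
by rewrite /dist -{2}(size_iota 0 #|G|) find_size.
Qed.

Hypothesis Gc : connected_graph G.

Lemma walk_dist x y : has_walk (dist x y) x y.
Proof.
have hs : has (fun d => has_walk d x y) (iota 0 #|G|).
  (* A repetition-free path has fewer than [#|G|] edges, so the search defining [dist] succeeds. *)
  have /connectP[p pp py] := Gc x y.
  move: py; have [p' pp' up _] := shortenP pp => yE.
  apply/hasP; exists (size p'); last by apply/has_walkP; exists p'.
  rewrite mem_iota add0n /=; have := max_card (mem (x :: p')).
  by move/card_uniqP: up => ->.
move: (hs); rewrite has_find size_iota => lt.
by have := nth_find 0 hs; rewrite nth_iota.
Qed.

Lemma distxx x : dist x x = 0.
Proof. by apply/eqP; rewrite -leqn0 dist_le ?has_walk0. Qed.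

Lemma dist_eq0 x y : dist x y = 0 -> x = y.
Proof.
move=> d0; have := walk_dist x y; rewrite d0.
by move=> /has_walkP[[|a p] [//= _ _ <-]].
Qed.

Lemma dist_sym x y : dist x y = dist y x.
Proof.
by apply/eqP; rewrite eqn_leq !dist_le //; apply: has_walk_sym; apply: walk_dist.
Qed.

Lemma dist_triangle z x y : dist x y <= dist x z + dist z y.
Proof. by apply: dist_le; apply: has_walk_cat (walk_dist _ _) (walk_dist _ _). Qed.

Lemma dist_adj x z y : adj x z -> dist x y <= (dist z y).+1.
Proof.
move=> xz; rewrite -add1n; apply: dist_le.
exact: has_walk_cat (has_walk1 xz) (walk_dist _ _).
Qed.

Lemma dist_pred x y m : dist x y = m.+1 -> exists2 z, adj x z & dist z y = m.
Proof.
move=> dm; have := walk_dist x y; rewrite dm => /has_walkS[z xz zy].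
exists z => //; have := dist_le zy; have := dist_adj y xz; lia.
Qed.

Lemma dist_le_diameter x y : dist x y <= diameter G.
Proof.
apply: leq_trans (leq_bigmax x); exact: (leq_bigmax y).
Qed.

Lemma diameter_attained : 0 < #|G| -> exists x y, dist x y = diameter G.
Proof.
move=> G0; rewrite /diameter.
have [x ->] := eq_bigmax (fun x => \max_(y : G) dist x y) G0.
by have [y ->] := eq_bigmax (fun y => dist x y) G0; exists x, y.
Qed.

(** Distances to the last vertex determine the others ([geodesic_dist]). Indexing by [nat] avoids
    bounded indices; values beyond [D] are unconstrained. *)
Definition geodesic (D : nat) (v : nat -> G) : Prop :=
  (forall i, i < D -> adj (v i) (v i.+1)) /\
  (forall i, i <= D -> dist (v i) (v D) = D - i).

Lemma geodesic_exists x y : exists v, [/\ geodesic (dist x y) v, v 0 = x & v (dist x y) = y].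
Proof.
have [D] := ubnP (dist x y); elim: D x => // D IH x.
case dE : (dist x y) => [|m] lt.
  exists (fun=> x); split=> //; last exact: dist_eq0.
  by split=> // i; rewrite leqn0 => /eqP ->; rewrite distxx.
have [z xz zm] := dist_pred dE.
have [|v [[v1 v2] v0 vm]] := IH z; first by rewrite zm.
rewrite zm in v1 v2 vm.
exists (fun i => if i is j.+1 then v j else x); split=> //; split=> //.
  by case=> [|i] im; [rewrite v0|apply: v1].
by case=> [_|i im]; [rewrite vm dE|rewrite subSS v2].
Qed.

Lemma geodesic_inj D v i j : geodesic D v -> i <= D -> j <= D -> v i = v j -> i = j.
Proof. by move=> [_ g] iD jD vv; have := g i iD; rewrite vv g //; lia. Qed.

Lemma geodesic_adj_pred D v i : geodesic D v -> 0 < i <= D -> adj (v i) (v i.-1).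
Proof. by case: i => // i g iD; rewrite adj_sym g.1. Qed.

Lemma geodesic_neq D v i : geodesic D v -> 0 < i < D -> v i.-1 != v i.+1.
Proof. by move=> g iD; apply/eqP => /(geodesic_inj g); lia. Qed.

Lemma geodesic_walk D v i j : geodesic D v -> i <= j <= D -> has_walk (j - i) (v i) (v j).
Proof.
move=> [g _] /andP[ij jD]; elim: j ij jD => [|j IH] ij jD.
  by rewrite leqn0 in ij; rewrite (eqP ij) subnn has_walk0.
have [->|ne] := eqVneq i j.+1; first by rewrite subnn has_walk0.
have -> : j.+1 - i = (j - i) + 1 by lia.
by apply: has_walk_cat (has_walk1 (g _ jD)); apply: IH; lia.
Qed.

Lemma geodesic_dist D v i j : geodesic D v -> i <= j <= D -> dist (v i) (v j) = j - i.
Proof.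
move=> g /[dup] ij /andP[ij1 jD]; apply/eqP; rewrite eqn_leq dist_le ?(geodesic_walk g) //=.
have := dist_triangle (v j) (v i) (v D); rewrite !(g.2) //; lia.
Qed.

Lemma geodesic_adj D v i j : geodesic D v -> i <= D -> j <= D ->
  adj (v i) (v j) -> i = j.+1 \/ j = i.+1.
Proof.
move=> g iD jD a.
have := dist_adj (v D) a; rewrite adj_sym in a; have := dist_adj (v D) a.
rewrite !(g.2) //; have [ij|] := eqVneq i j; last by lia.
by rewrite ij adj_irr in a.
Qed.

Lemma geodesic_rev D v : geodesic D v -> geodesic D (fun i => v (D - i)).
Proof.
move=> g; split=> i iD.
  have -> : D - i = (D - i.+1).+1 by lia.
  by rewrite adj_sym; apply: g.1; lia.
by rewrite dist_sym (geodesic_dist g) //; lia.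
Qed.

End Distance.

(** * Invariance of order, connectedness and diameter under isomorphism *)

Section Isomorphism.

Lemma isomorphic_refl G : isomorphic G G.
Proof. by exists id; split=> //; exists id. Qed.

Lemma isomorphic_sym G H : isomorphic G H -> isomorphic H G.
Proof.
move=> [f [[g fg gf] fa]]; exists g; split; first by exists f.
by move=> x y; rewrite -fa !gf.
Qed.

Lemma isomorphic_trans G H K : isomorphic G H -> isomorphic H K -> isomorphic G K.
Proof.
move=> [f [fb fa]] [g [gb ga]]; exists (g \o f); split; first exact: bij_comp.
by move=> x y; rewrite /= ga fa.
Qed.

Lemma isomorphic_has_walk (G H : sgraph) (f : G -> H) d x y :
  (forall x y, adj (f x) (f y) = adj x y) ->
  has_walk d x y -> has_walk d (f x) (f y).
Proof.
move=> fa; elim: d x => [|d IH] x.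
  by move=> /has_walkP[[|a p] [//= _ _ <-]]; apply: has_walk0.
move=> /has_walkS[z xz /IH]; rewrite -add1n.
by apply: has_walk_cat; apply: has_walk1; rewrite fa.
Qed.

Lemma isomorphic_conn_order_diam (G H : sgraph) n D :
  isomorphic G H -> conn_order_diam n D G -> conn_order_diam n D H.
Proof.
move=> [f [[g fg gf] fa]] [Gc Gn GD].
have ga x y : adj (g x) (g y) = adj x y by rewrite -fa !gf.
have Hc : connected_graph H.
  move=> x y; have := walk_dist Gc (g x) (g y).
  move=> /(isomorphic_has_walk fa); rewrite !gf => /has_walkP[p [_ pp py]].
  by apply/connectP; exists p.
have fd x y : dist (f x) (f y) = dist x y.
  apply/eqP; rewrite eqn_leq !dist_le //.
    by have /(isomorphic_has_walk ga) := walk_dist Hc (f x) (f y); rewrite !fg.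
  exact: isomorphic_has_walk (walk_dist Gc x y).
split=> //; first by rewrite -Gn; apply/esym/bij_eq_card; exists g; [exact: fg|].
rewrite -GD /diameter (reindex f) /=; last by exists g => x _.
apply: eq_bigr => x _; rewrite (reindex f) /=; last by exists g => z _.
by apply: eq_bigr => y _.
Qed.

End Isomorphism.

(** * Superharmonic sequences *)

Section Chain.
Import Order.TTheory GRing.Theory Num.Theory.
Local Open Scope ring_scope.
Variables (R : realFieldType) (t : R).
Hypothesis t1 : 1 < t.

Let t0 : 0 < t. Proof. exact: lt_trans t1. Qed.
Let tN0 : t != 0. Proof. by rewrite gt_eqF. Qed.
Let S := t - t^-1.
Let ti1 : t^-1 < 1. Proof. by rewrite invf_lt1. Qed.
Let ti0 : 0 < t^-1. Proof. by rewrite invr_gt0. Qed.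
Let S0 : 0 < S. Proof. by rewrite subr_gt0 (lt_trans ti1). Qed.

(** The recurrence factors: [t * Z i - Z i.+1] loses at most a factor [t] per edge, and the
    right-hand side is [t^-1] times its value at [g]. *)
Lemma decay (Z : nat -> R) g :
  (forall i, (i < g)%N -> Z i + Z i.+2 <= (t + t^-1) * Z i.+1) ->
  t^-1 ^+ g.+1 * (t * Z 0 - Z 1) <= Z g - t^-1 * Z g.+1.
Proof.
elim: g => [_|g IH h].
  by rewrite expr1 mulrBr mulrA mulVf // mul1r.
have := IH (fun i ig => h i (ltnW ig)); rewrite -(ler_pM2l ti0) mulrA -exprS.
move=> /le_trans; apply.
have : t^-1 * (Z g + Z g.+2) <= Z g.+1 + t^-1 * (t^-1 * Z g.+1).
  apply: le_trans (_ : _ <= t^-1 * ((t + t^-1) * Z g.+1)) _.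
    by rewrite ler_pM2l // h.
  by rewrite (mulrA _ (t + _)) mulrDr mulVf // mulrDl mul1r -mulrA.
by rewrite mulrDr mulrBr; lra.
Qed.

(* Excess of the ratio to the next (previous) value over the decay rate [t^-1], normalised so that
   the growth rate [t] has excess 1; if [Y (p + i) = a * t^-i + b * t^i] then [hR Y p = b / (a + b)]. *)
Definition hR (Y : nat -> R) p := (Y p.+1 - t^-1 * Y p) / ((t - t^-1) * Y p).
Definition hL (Y : nat -> R) p := (Y p.-1 - t^-1 * Y p) / ((t - t^-1) * Y p).

(** This is [decay] in terms of excesses: [(1 - hR Y p) * Y p] is [t * Y p - Y p.+1] divided by
    [t - t^-1]. Asking for nonzero rather than positive values admits [- Y] as well, which yields
    the reverse inequality in [gap_prod_eq]. *)
Lemma decay_right (Y : nat -> R) p p' : (p < p')%N -> Y p != 0 -> Y p' != 0 ->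
  (forall i, (p <= i)%N -> (i.+2 <= p')%N -> Y i + Y i.+2 <= (t + t^-1) * Y i.+1) ->
  t^-1 ^+ (p' - p) * ((1 - hR Y p) * Y p) <= hL Y p' * Y p'.
Proof.
move=> lt YN YN' h.
have [e1 e2] : (p + (p' - p).-1 = p'.-1)%N /\ ((p' - p).-1.+1 = p' - p)%N.
  by clear -lt; lia.
have e3 i : (i < (p' - p).-1)%N -> ((p + i).+2 <= p')%N by clear -lt; lia.
have SN : t - t^-1 != 0 by rewrite gt_eqF.
have -> : (1 - hR Y p) * Y p = (t * Y p - Y p.+1) / S.
  have hE : hR Y p * S * Y p = Y p.+1 - t^-1 * Y p.
    by rewrite /hR -mulrA divfK ?mulf_neq0.
  by apply: (mulIf SN); rewrite divfK // mulrAC mulrBl mul1r mulrBl hE /S; ring.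
have -> : hL Y p' * Y p' = (Y p'.-1 - t^-1 * Y p') / S.
  by rewrite /hL invfM mulrA divfK.
rewrite mulrA ler_pM2r ?invr_gt0 //.
have := @decay (fun i => Y (p + i)%N) (p' - p).-1.
rewrite e2 addn0 addn1 (subnKC (ltnW lt)) e1.
by apply=> i ip; rewrite !addnS; apply: h; rewrite ?leq_addr ?e3.
Qed.

Lemma decay_left (Y : nat -> R) p p' : (0 < p < p')%N -> Y p != 0 -> Y p' != 0 ->
  (forall i, (p <= i)%N -> (i.+2 <= p')%N -> Y i + Y i.+2 <= (t + t^-1) * Y i.+1) ->
  t^-1 ^+ (p' - p) * ((1 - hL Y p') * Y p') <= hR Y p * Y p.
Proof.
(* Reflecting the gap exchanges the roles of [hL] and [hR]. *)
move=> /andP[p0 lt] YN YN' h; pose Z i := Y (p + p' - i)%N.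
have [e1 e2] : (p + p' - p.+1 = p'.-1)%N /\ (p + p' - p'.-1 = p.+1)%N.
  by clear -lt p0; lia.
have e3 i : (p <= i)%N -> (i.+2 <= p')%N ->
  [/\ (p <= p + p' - i.+2)%N, (p + p' - i.+2).+2 <= p',
   (p + p' - i = (p + p' - i.+2).+2)%N & (p + p' - i.+1 = (p + p' - i.+2).+1)%N]%N.
  by clear -lt p0; split; lia.
have := @decay_right Z p p' lt.
rewrite /hR /hL /Z e1 e2 addnK addKn; apply=> // i pi ip.
have [f1 f2 -> ->] := e3 i pi ip; rewrite addrC; exact: h.
Qed.

Section Gap.
Variables (Y : nat -> R) (p p' : nat).
Hypotheses (p0 : (0 < p)%N) (pp' : (p < p')%N) (Yp : 0 < Y p) (Yp' : 0 < Y p').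

Lemma gap_pos_right :
  (forall i, (p <= i)%N -> (i.+2 <= p')%N -> Y i + Y i.+2 <= (t + t^-1) * Y i.+1) ->
  hR Y p < 1 -> 0 < hL Y p'.
Proof.
move=> h lt; rewrite -(pmulr_lgt0 _ Yp').
apply: lt_le_trans (decay_right pp' _ _ h); rewrite ?gt_eqF //.
by rewrite mulr_gt0 ?exprn_gt0 // mulr_gt0 // subr_gt0.
Qed.

Lemma gap_pos_left :
  (forall i, (p <= i)%N -> (i.+2 <= p')%N -> Y i + Y i.+2 <= (t + t^-1) * Y i.+1) ->
  hL Y p' < 1 -> 0 < hR Y p.
Proof.
move=> h lt; rewrite -(pmulr_lgt0 _ Yp).
apply: lt_le_trans (decay_left _ _ _ h); rewrite ?gt_eqF ?p0 //.
by rewrite mulr_gt0 ?exprn_gt0 // mulr_gt0 // subr_gt0.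
Qed.

(** Multiply the two one-sided estimates: [Y p * Y p'] cancels and the two powers of [t^-1] merge
    into one of [(t ^+ 2)^-1]. *)
Lemma gap_prod :
  (forall i, (p <= i)%N -> (i.+2 <= p')%N -> Y i + Y i.+2 <= (t + t^-1) * Y i.+1) ->
  hR Y p < 1 -> hL Y p' < 1 ->
  (t ^+ 2)^-1 ^+ (p' - p) * ((1 - hR Y p) * (1 - hL Y p')) <= hR Y p * hL Y p'.
Proof.
move=> h lt lt'; have pY := mulr_gt0 Yp Yp'; rewrite -(ler_pM2r pY).
have YN : Y p != 0 by rewrite gt_eqF.
have YN' : Y p' != 0 by rewrite gt_eqF.
have p0p : (0 < p < p')%N by rewrite p0.
have h1 := decay_right pp' YN YN' h.
have h2 := decay_left p0p YN YN' h.
have a1 : 0 <= t^-1 ^+ (p' - p) * ((1 - hR Y p) * Y p).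
  by rewrite mulr_ge0 ?exprn_ge0 ?ltW // mulr_gt0 // subr_gt0.
have a2 : 0 <= t^-1 ^+ (p' - p) * ((1 - hL Y p') * Y p').
  by rewrite mulr_ge0 ?exprn_ge0 ?ltW // mulr_gt0 // subr_gt0.
have := ler_pM a1 a2 h1 h2; rewrite -exprVn -exprM mulnC exprM.
set T := t^-1 ^+ _; rewrite expr2; lra.
Qed.

Lemma gap_prod_eq :
  (forall i, (p <= i)%N -> (i.+2 <= p')%N -> Y i + Y i.+2 = (t + t^-1) * Y i.+1) ->
  (t ^+ 2)^-1 ^+ (p' - p) * ((1 - hR Y p) * (1 - hL Y p')) = hR Y p * hL Y p'.
Proof.
move=> h; have pY := mulr_gt0 Yp Yp'; apply: (mulIf (lt0r_neq0 pY)).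
have YN : Y p != 0 by rewrite gt_eqF.
have YN' : Y p' != 0 by rewrite gt_eqF.
have p0p : (0 < p < p')%N by rewrite p0.
pose Z i := - Y i.
have ZN : Z p != 0 by rewrite oppr_eq0.
have ZN' : Z p' != 0 by rewrite oppr_eq0.
have h' i : (p <= i)%N -> (i.+2 <= p')%N -> Y i + Y i.+2 <= (t + t^-1) * Y i.+1.
  by move=> pi ip; rewrite h.
have hZ i : (p <= i)%N -> (i.+2 <= p')%N -> Z i + Z i.+2 <= (t + t^-1) * Z i.+1.
  by move=> pi ip; rewrite /Z mulrN -h // opprD.
have zR : hR Z p = hR Y p by rewrite /hR /Z !mulrN -opprD invrN mulrNN.
have zL : hL Z p' = hL Y p' by rewrite /hL /Z !mulrN -opprD invrN mulrNN.
have h1 := decay_right pp' YN YN' h'.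
have h2 := decay_left p0p YN YN' h'.
have := decay_right pp' ZN ZN' hZ; have := decay_left p0p ZN ZN' hZ.
rewrite zR zL /Z !mulrN !lerN2 => g2 g1.
have e1 : _ = _ := le_anti (introT andP (conj h1 g1)).
have e2 : _ = _ := le_anti (introT andP (conj h2 g2)).
transitivity (hR Y p * Y p * (hL Y p' * Y p')); last by ring.
rewrite -e1 -e2 -exprVn -exprM mulnC exprM expr2; ring.
Qed.

End Gap.

Lemma hLR (Y : nat -> R) p c : 0 < Y p -> Y p.-1 + Y p.+1 <= c * Y p ->
  hL Y p + hR Y p <= (c - 2 * t^-1) / (t - t^-1).
Proof.
move=> Y0 h; rewrite /hL /hR invfM (mulrC (_ - _)^-1) 2!mulrA -mulrDl ler_pM2r ?invr_gt0 //.
by rewrite -mulrDl ler_pdivrMr //; lra.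
Qed.

Lemma hLR_eq (Y : nat -> R) p c : 0 < Y p -> Y p.-1 + Y p.+1 = c * Y p ->
  hL Y p + hR Y p = (c - 2 * t^-1) / (t - t^-1).
Proof.
move=> Y0 h; have YN : Y p != 0 by rewrite gt_eqF.
apply: (mulIf YN); rewrite /hL /hR invfM (mulrC (_ - _)^-1) 2!mulrA -mulrDl mulrAC.
rewrite -mulrDl divfK // [RHS]mulrAC; congr (_ / _); lra.
Qed.

Lemma hR_le (Y : nat -> R) p c : 0 < Y p -> Y p.+1 <= c * Y p ->
  hR Y p <= (c - t^-1) / (t - t^-1).
Proof.
move=> Y0 h; rewrite /hR invfM (mulrC (_ - _)^-1) mulrA ler_pM2r ?invr_gt0 //.
by rewrite ler_pdivrMr //; lra.
Qed.

Lemma hL_le (Y : nat -> R) p c : 0 < Y p -> Y p.-1 <= c * Y p ->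
  hL Y p <= (c - t^-1) / (t - t^-1).
Proof.
move=> Y0 h; rewrite /hL invfM (mulrC (_ - _)^-1) mulrA ler_pM2r ?invr_gt0 //.
by rewrite ler_pdivrMr //; lra.
Qed.

Lemma hR_eq (Y : nat -> R) p c : 0 < Y p -> Y p.+1 = c * Y p ->
  hR Y p = (c - t^-1) / (t - t^-1).
Proof.
move=> Y0 h; have YN : Y p != 0 by rewrite gt_eqF.
by rewrite /hR h -mulrBl invfM (mulrC (_ - _)^-1) mulrA mulfK.
Qed.

Lemma hL_eq (Y : nat -> R) p c : 0 < Y p -> Y p.-1 = c * Y p ->
  hL Y p = (c - t^-1) / (t - t^-1).
Proof.
move=> Y0 h; have YN : Y p != 0 by rewrite gt_eqF.
by rewrite /hL h -mulrBl invfM (mulrC (_ - _)^-1) mulrA mulfK.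
Qed.

End Chain.

(** * The algebra of gaps *)

Section Algebra.
Import Order.TTheory GRing.Theory Num.Theory.
Local Open Scope ring_scope.
Variables (R : realFieldType).

(* With [lambda = t + t^-1] and [s = t ^+ 2], [eps s] vanishes exactly at [lambda = sqrt (2 + sqrt 5)].
   [dd s] bounds the total excess at a pendant vertex and [de s] the excess at an end carrying two
   paths of length 2 (see [site_const] and [end_const]). *)
Definition eps (s : R) := s ^+ 2 - s - 1.
Definition qq (s : R) := s ^+ 2 + s - 1.
Definition dd (s : R) := eps s / (s ^+ 2 - 1).
Definition de (s : R) := s * eps s / (s ^+ 3 - 1).
Definition NN (s w : R) := s * (eps s ^+ 2 - qq s * w).
Definition MM (s w : R) := s ^+ 2 * eps s + qq s ^+ 2 * w.
Definition KK (s w : R) := (s ^+ 2 - 1) * (s * eps s + qq s * w).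

(** For an end gap of weight [w], [NN / KK] bounds the excess left on the inner side of the adjacent
    pendant vertex ([end_gap_le]); by this identity [MM / KK] is its complement to 1. *)
Lemma NM_KK s w : NN s w + MM s w = KK s w.
Proof. rewrite /NN /MM /KK /qq /eps; ring. Qed.

Section S.
Variable s : R.
Hypothesis s1 : 1 < s.

Let s0 : 0 < s. Proof. exact: lt_trans s1. Qed.
Lemma s2_gt1 : 0 < s ^+ 2 - 1.
Proof. by rewrite subr_gt0 exprn_egt1. Qed.
Lemma s3_gt1 : 0 < s ^+ 3 - 1.
Proof. by rewrite subr_gt0 exprn_egt1. Qed.
Lemma qq_gt0 : 0 < qq s.
Proof. by rewrite /qq addrAC addr_gt0 ?s2_gt1. Qed.

Lemma dd_lt1 : dd s < 1.
Proof. rewrite ltr_pdivrMr ?s2_gt1 // mul1r /eps; have := s0; lra. Qed.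

Lemma de_lt1 : de s < 1.
Proof.
rewrite ltr_pdivrMr ?s3_gt1 // mul1r -subr_gt0.
have -> : s ^+ 3 - 1 - s * eps s = qq s by rewrite /eps /qq; ring.
exact: qq_gt0.
Qed.

(** The odds of [de] are [s * eps s / qq s]; gap relations use an excess only through its odds. *)
Lemma de_frac : (1 - de s) * (s * eps s) = de s * qq s.
Proof.
have N3 : s ^+ 3 - 1 != 0 by rewrite gt_eqF ?s3_gt1.
by rewrite /de /qq /eps; field.
Qed.

Section Pos.
Hypothesis e0 : 0 < eps s.

(** On [s > 1], [eps] changes sign at the golden ratio; 8/5 is a rational just below it. *)
Lemma s_gt : 8 / 5 < s.
Proof.
rewrite ltNge; apply/negP => h; have := e0; rewrite /eps => e.
have := s1; nra.
Qed.

Lemma de_gt0 : 0 < de s.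
Proof. by rewrite divr_gt0 ?s3_gt1 // mulr_gt0. Qed.

Lemma dd_le_eps : dd s <= eps s.
Proof.
rewrite ler_pdivrMr ?s2_gt1 // ler_peMr ?ltW //.
have := s_gt; nra.
Qed.
Lemma de_le_eps : de s <= eps s.
Proof.
rewrite ler_pdivrMr ?s3_gt1 // mulrC ler_wpM2l ?ltW //.
have := s_gt; rewrite !exprS expr0; nra.
Qed.

Lemma KK_gt0 w : 0 < w -> 0 < KK s w.
Proof.
move=> w0; rewrite mulr_gt0 ?s2_gt1 // addr_gt0 // mulr_gt0 ?qq_gt0 //.
Qed.
Lemma MM_gt0 w : 0 < w -> 0 < MM s w.
Proof.
by move=> w0; rewrite addr_gt0 // mulr_gt0 ?exprn_gt0 ?qq_gt0.
Qed.

(* [x] is the excess of the first pendant vertex towards the end, [a] towards the other side. *)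
Lemma end_gap_le w h x a : 0 < w -> h <= de s -> 0 < x -> x < 1 ->
  w * ((1 - h) * (1 - x)) <= h * x -> x + a <= dd s -> a * KK s w <= NN s w.
Proof.
move=> w0 hd x0 x1 hx xa.
have N2 : s ^+ 2 - 1 != 0 by rewrite gt_eqF ?s2_gt1.
have d0 := de_gt0.
have h1 : w * ((1 - de s) * (1 - x)) <= de s * x.
  have : 0 <= (de s - h) * (w * (1 - x) + x).
    by rewrite mulr_ge0 ?subr_ge0 // addr_ge0 ?ltW // mulr_gt0 // subr_gt0.
  move: hx; lra.
(* Inserting the odds of [de] turns the gap relation into a lower bound on [x] that depends on [w]
   and [s] alone. *)
have h2 : w * qq s * (1 - x) <= s * eps s * x.
  rewrite -(ler_pM2l d0) [leLHS](_ : _ = w * (de s * qq s) * (1 - x)); last by ring.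
  rewrite -de_frac; have se0 : 0 < s * eps s by rewrite mulr_gt0.
  have := ler_wpM2l (ltW se0) h1; lra.
have h3 : qq s * w <= x * (s * eps s + qq s * w) by lra.
have k0 : 0 < s * eps s + qq s * w.
  by rewrite addr_gt0 // mulr_gt0 ?qq_gt0.
apply: le_trans (_ : (dd s - x) * KK s w <= _).
  by rewrite ler_pM2r ?KK_gt0 //; lra.
have ddK : dd s * KK s w = eps s * (s * eps s + qq s * w).
  by rewrite /dd /KK mulrA divfK.
rewrite mulrBl ddK.
have := ler_wpM2l (ltW s2_gt1) h3; rewrite /KK /NN.
set Z := s * eps s + _; rewrite (_ : Z = s * eps s + qq s * w) // => h4.
have e1 : s ^+ 2 - 1 = s + eps s by rewrite /eps; ring.
have : eps s * (s * eps s + qq s * w) - (s ^+ 2 - 1) * (qq s * w) =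
  s * (eps s ^+ 2 - qq s * w) by rewrite e1; ring.
by move: h4; rewrite mulrCA mulrA; lra.
Qed.

Lemma end_gap_eq w x a : 0 < w -> 
  w * ((1 - de s) * (1 - x)) = de s * x -> x + a = dd s -> a * KK s w = NN s w.
Proof.
move=> w0 hx xa.
have N2 : s ^+ 2 - 1 != 0 by rewrite gt_eqF ?s2_gt1.
have dN : de s != 0 by rewrite gt_eqF ?de_gt0.
have h2 : w * qq s * (1 - x) = s * eps s * x.
  apply: (mulfI dN); rewrite [LHS](_ : _ = w * (de s * qq s) * (1 - x)); last by ring.
  rewrite -de_frac; move/(congr1 (fun z => s * eps s * z)): hx.
  set e := s * eps s; lra.
have h3 : qq s * w = x * (s * eps s + qq s * w) by move: h2; lra.
have -> : a = dd s - x by rewrite -xa addrC addKr.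
have ddK : dd s * KK s w = eps s * (s * eps s + qq s * w).
  by rewrite /dd /KK mulrA divfK.
rewrite mulrBl ddK /KK mulrCA -h3.
have -> : s ^+ 2 - 1 = s + eps s by rewrite /eps; ring.
by rewrite /NN; ring.
Qed.

(* [NN / MM] is the odds ratio of [NN / KK]. *)
Lemma feasible_NM w1 w2 w3 a a' : 0 < w1 -> 0 < w2 -> 0 < w3 ->
  0 < a -> 0 < a' -> a < 1 -> a' < 1 ->
  a * KK s w1 <= NN s w1 -> a' * KK s w3 <= NN s w3 ->
  w2 * ((1 - a) * (1 - a')) <= a * a' ->
  w2 * (MM s w1 * MM s w3) <= NN s w1 * NN s w3.
Proof.
move=> w10 w20 w30 a0 a0' a1 a1' h1 h3 h2.
have K1 := KK_gt0 w10; have K3 := KK_gt0 w30.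
have M1 : MM s w1 <= (1 - a) * KK s w1 by rewrite -NM_KK in h1 *; lra.
have M3 : MM s w3 <= (1 - a') * KK s w3 by rewrite -NM_KK in h3 *; lra.
have m1 := MM_gt0 w10; have m3 := MM_gt0 w30.
apply: le_trans (_ : _ <= w2 * ((1 - a) * KK s w1 * ((1 - a') * KK s w3))) _.
  by rewrite ler_pM2l // ler_pM // ltW.
apply: le_trans (_ : _ <= a * KK s w1 * (a' * KK s w3)) _; last first.
  by rewrite ler_pM // ltW // mulr_gt0.
have := ler_wpM2r (ltW (mulr_gt0 K1 K3)) h2.
by set k1 := KK _ _; set k3 := KK _ _; lra.
Qed.

Lemma resonance_NM w1 w2 a a' : 0 < w1 -> 0 < w2 ->
  a * KK s w1 = NN s w1 -> a' * KK s w1 = NN s w1 -> 0 < a ->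
  w2 * ((1 - a) * (1 - a')) = a * a' ->
  w2 * MM s w1 ^+ 2 = NN s w1 ^+ 2 /\ 0 < NN s w1.
Proof.
move=> w10 w20 h1 h3 a0 h2.
have K1 := KK_gt0 w10; have n0 : 0 < NN s w1 by rewrite -h1 mulr_gt0.
split=> //.
have M1 : MM s w1 = (1 - a) * KK s w1 by rewrite -NM_KK in h1 *; lra.
have M3 : MM s w1 = (1 - a') * KK s w1 by rewrite -NM_KK in h3 *; lra.
rewrite !expr2 {1}M1 M3 -{1}h1 -h3.
move/(congr1 (fun z => KK s w1 * KK s w1 * z)): h2.
by set k1 := KK _ _; lra.
Qed.

(* In terms of [u = qq s * w / eps s ^+ 2] and [v = u * qq s * eps s / s ^+ 2], a change of gap by the
   factor [X] is governed by [(X - 1) * ((1 - u) * X - u * (1 + v))]; [P = qq s * u], and the second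
   root [r = u * (1 + v) / (1 - u)] satisfies [r ^+ 2 = P * s ^+ j / s ^+ 2]. *)
Section Resonant.
Variables (w : R) (j : nat).
Hypotheses (w0 : 0 < w) (j2 : (j <= 2)%N) (n0 : 0 < NN s w).
Hypothesis res : w * s^-1 ^+ j * MM s w ^+ 2 = NN s w ^+ 2.
Let P := qq s ^+ 2 * w / eps s ^+ 2.

(** The resonance with [w] eliminated in favour of [P]; [P < qq s] expresses the positivity of
    [NN]. *)
Lemma resP : [/\ 0 < P, P < qq s, w * qq s ^+ 2 = P * eps s ^+ 2 &
  P * s^-1 ^+ j * (s ^+ 2 + P * eps s) ^+ 2 = s ^+ 2 * (qq s - P) ^+ 2].
Proof.
have eN : eps s != 0 by rewrite gt_eqF.
have e2 : 0 < eps s ^+ 2 by rewrite exprn_gt0.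
have q0 := qq_gt0; have qN : qq s != 0 by rewrite gt_eqF.
have P0 : 0 < P by rewrite divr_gt0 // mulr_gt0 // exprn_gt0.
have wE : w * qq s ^+ 2 = P * eps s ^+ 2.
  by rewrite mulrC /P divfK // expf_neq0.
split=> //.
  rewrite /P ltr_pdivrMr // expr2 -mulrA ltr_pM2l //.
  by move: n0; rewrite /NN pmulr_rgt0 // subr_gt0.
have wE' : w = P * eps s ^+ 2 / qq s ^+ 2.
  by rewrite -wE mulfK // expf_neq0.
move: res; rewrite /MM /NN wE'; set A := s^-1 ^+ j => h.
have hN : eps s ^+ 4 / qq s ^+ 2 != 0.
  by rewrite mulf_neq0 ?invr_eq0 ?expf_neq0.
apply: (mulfI hN).
transitivity (P * eps s ^+ 2 / qq s ^+ 2 * A *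
    (s ^+ 2 * eps s + qq s ^+ 2 * (P * eps s ^+ 2 / qq s ^+ 2)) ^+ 2).
  by field.
by rewrite h; field.
Qed.

(** Equivalent to 1/s < r < s. For [P] below [qq s], one side of the equation in [resP] increases in
    [P] and the other decreases, so testing thresholds is enough. If [P * s ^+ j <= 1] then [P <= 1]
    and the equation gives [s * (qq s - 1) <= s ^+ 2 + eps s], which is false. If
    [P * s ^+ j >= s ^+ 4] then [P >= s ^+ 2], because [j <= 2], and it gives
    [s <= qq s - P <= s - 1]. *)
Lemma resP_bounds : s^-1 ^+ j < P /\ P * s ^+ j < s ^+ 4.
Proof.
have [P0 Pq _ PE] := resP; have q0 := qq_gt0.
have sN : s != 0 by rewrite gt_eqF.
have sj : 0 < s ^+ j by rewrite exprn_gt0.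
have sj1 : 1 <= s ^+ j by rewrite exprn_ege1 // ltW.
have sj2 : s ^+ j <= s ^+ 2 by rewrite ler_weXn2l // ltW.
have PE' : P * (s ^+ 2 + P * eps s) ^+ 2 = s ^+ j * (s ^+ 2 * (qq s - P) ^+ 2).
  by rewrite -PE exprVn; field; rewrite gt_eqF.
split.
- rewrite ltNge; apply/negP => Pj.
  have P1 : P * s ^+ j <= 1.
    by rewrite -(mulVf (_ : s ^+ j != 0)) ?gt_eqF // ler_pM2r // -exprVn.
  have P2 : P <= 1 by nra.
  have : (s * (qq s - P)) ^+ 2 <= (s ^+ 2 + P * eps s) ^+ 2.
    rewrite exprMn -PE exprVn -(ler_pM2l sj).
    have -> : s ^+ j * (P / s ^+ j * (s ^+ 2 + P * eps s) ^+ 2) =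
      P * (s ^+ 2 + P * eps s) ^+ 2 by field; rewrite gt_eqF.
    by rewrite ler_wpM2r ?sqr_ge0 //; lra.
  rewrite ler_pXn2r ?nnegrE //; [|by rewrite mulr_ge0 // ?ltW // subr_gt0|
    by rewrite addr_ge0 ?sqr_ge0 // mulr_ge0 // ltW].
  have : P * eps s <= eps s by rewrite ler_piMl // ltW.
  have : s * (qq s - 1) <= s * (qq s - P) by rewrite ler_pM2l //; lra.
  have -> : s * (qq s - 1) = s * (s ^+ 2 - 1) + s * (s - 1) by rewrite /qq; ring.
  have s21 := s2_gt1; have s3 : 0 < s * (s - 1) by rewrite mulr_gt0 // subr_gt0.
  have : s ^+ 2 - 1 = s + eps s by rewrite /eps; ring.
  have : 0 < (s - 1) * (s ^+ 2 - 1) by rewrite mulr_gt0 // subr_gt0.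
  rewrite /eps; have := s1; nra.
- rewrite ltNge; apply/negP => Pj.
  have P2 : s ^+ 2 <= P.
    rewrite -(ler_pM2r sj); apply: le_trans Pj.
    rewrite (_ : 4 = 2 + 2)%N // exprD ler_pM2l ?exprn_gt0 //.
  have : (s ^+ 2) ^+ 2 <= (s * (qq s - P)) ^+ 2.
    rewrite [X in _ <= X]exprMn -PE exprVn.
    have : s ^+ 2 * s^-1 ^+ 2 <= P * (s ^+ j)^-1.
      rewrite -exprMn divff // expr1n ler_pdivlMr // mul1r.
      exact: le_trans sj2 P2.
    rewrite -exprMn divff // expr1n => h.
    apply: le_trans (_ : (s ^+ 2 + P * eps s) ^+ 2 <= _); last first.
      by rewrite ler_peMl ?sqr_ge0.
    have : 0 < P * eps s by rewrite mulr_gt0.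
    have : 0 < s ^+ 2 by rewrite exprn_gt0.
    by move: (s ^+ 2) (P * eps s) => x y; nra.
  rewrite ler_pXn2r ?nnegrE //; [|by rewrite sqr_ge0|by rewrite mulr_ge0 // ?ltW // subr_gt0].
  rewrite expr2 ler_pM2l // /qq; have := s1; lra.
Qed.

(** Since [P * s ^+ j] exceeds 1, unfolding [P] bounds [w] below by a multiple of [eps ^+ 2]. *)
Lemma resonant_w : eps s ^+ 2 <= w * (qq s ^+ 2 * s ^+ 2).
Proof.
have [P0 Pq wE _] := resP; have [lo _] := resP_bounds.
rewrite mulrA wE mulrAC; rewrite ler_peMl ?sqr_ge0 //.
have sj2 : s ^+ j <= s ^+ 2 by rewrite ler_weXn2l // ltW.
have sj : 0 < s ^+ j by rewrite exprn_gt0.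
apply: le_trans (_ : P * s ^+ j <= _); last by rewrite ler_pM2l.
by rewrite -(ltr_pM2r sj) -exprMn mulVf ?gt_eqF // expr1n in lo; apply: ltW.
Qed.

Lemma compare_quadratic X : 0 < X -> X = 1 \/ X <= s^-1 \/ s <= X ->
  MM s w * NN s (w / X) <= X * MM s (w / X) * NN s w /\
  (MM s w * NN s (w / X) = X * MM s (w / X) * NN s w -> X = 1).
Proof.
move=> X0 XX; have [P0 Pq wE _] := resP; have [lo hi] := resP_bounds.
have XN : X != 0 by rewrite gt_eqF.
have M0 := MM_gt0 w0; have q0 := qq_gt0.
pose A := s * eps s * NN s w; pose B := qq s * w * MM s w.
have A0 : 0 < A by rewrite mulr_gt0 // mulr_gt0.
have B0 : 0 < B by rewrite mulr_gt0 // mulr_gt0.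
(* Both sides agree at [X = 1], so [X - 1] splits off; the cofactor is linear with root [B / A]. *)
have key : X * (X * MM s (w / X) * NN s w - MM s w * NN s (w / X)) = s * ((X - 1) * (A * X - B)).
  by rewrite /A /B /MM /NN /qq /eps; field.
have sN : s != 0 by rewrite gt_eqF.
have sj : 0 < s ^+ j by rewrite exprn_gt0.
have B2 : B ^+ 2 = P * s ^+ j * (eps s * NN s w) ^+ 2.
  have -> : B ^+ 2 = (w * qq s ^+ 2) * s ^+ j * (w * s^-1 ^+ j * MM s w ^+ 2).
    by rewrite /B exprVn; field; rewrite gt_eqF.
  by rewrite res wE; ring.
have en0 : 0 < eps s * NN s w by rewrite mulr_gt0.
(* [AB] and [BA] place the root [B / A] strictly between 1/s and s; [B2] reduces their squares to
   [resP_bounds]. *)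
have AB : A < s * B.
  rewrite /A -mulrA ltr_pM2l // -(ltr_pXn2r (_ : 0 < 2)%N) ?nnegrE ?(ltW en0) ?(ltW B0) //.
  rewrite B2 ltr_pMl ?exprn_gt0 //.
  by rewrite -(ltr_pM2r sj) -exprMn mulVf // expr1n in lo.
have BA : B < s * A.
  have -> : s * A = s ^+ 2 * (eps s * NN s w) by rewrite /A; ring.
  rewrite -(ltr_pXn2r (_ : 0 < 2)%N) ?nnegrE ?ltW //; last first.
    by rewrite mulr_gt0 // exprn_gt0.
  by rewrite B2 [X in _ < X]exprMn -exprM ltr_pM2r // exprn_gt0.
clearbody A B.
have pos : X != 1 -> 0 < (X - 1) * (A * X - B).
  move=> X1; case: XX => [E|[Xs|Xs]]; first by rewrite E eqxx in X1.
    have Xs1 : X * s <= 1 by rewrite -(mulVf sN) ler_pM2r.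
    have : 0 < s * (B - A * X).
      have : A * (X * s) <= A by rewrite ler_piMr // ltW.
      by lra.
    rewrite pmulr_rgt0 // => BX.
    have Xl : X < 1 by have := s1; nra.
    by rewrite -mulrNN mulr_gt0 //; lra.
  have : A * s <= A * X by rewrite ler_pM2l.
  have := s1; move=> s1' AX; rewrite mulr_gt0 //; lra.
have [X1|X1] := eqVneq X 1.
  by split=> //; rewrite X1 divr1 mul1r mulrC.
have := pos X1; rewrite -(pmulr_rgt0 _ s0) -key pmulr_rgt0 // subr_gt0 => lt.
by split; [apply: ltW|move=> E; rewrite E ltxx in lt].
Qed.

(** The factor [X1 * X3] appears because the total length is fixed: what the outer gaps gain, the
    middle one loses. By the resonance the hypothesis says [y1 * y3 <= x1 * x3], while
    [compare_quadratic] bounds each [x] by its [y]; so both are equalities. *)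
Lemma feasible_resonant X1 X3 : 0 < X1 -> 0 < X3 ->
  X1 = 1 \/ X1 <= s^-1 \/ s <= X1 -> X3 = 1 \/ X3 <= s^-1 \/ s <= X3 ->
  0 < NN s (w / X1) -> 0 < NN s (w / X3) ->
  w * s^-1 ^+ j * (X1 * X3) * (MM s (w / X1) * MM s (w / X3))
    <= NN s (w / X1) * NN s (w / X3) -> X1 = 1 /\ X3 = 1.
Proof.
move=> X10 X30 XX1 XX3 n1 n3 h.
have [c1 e1] := compare_quadratic X10 XX1; have [c3 e3] := compare_quadratic X30 XX3.
have M0 := MM_gt0 w0.
set x1 := MM s w * _ in c1 e1; set y1 := X1 * _ * _ in c1 e1.
set x3 := MM s w * _ in c3 e3; set y3 := X3 * _ * _ in c3 e3.
have x10 : 0 < x1 by rewrite mulr_gt0.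
have x30 : 0 < x3 by rewrite mulr_gt0.
have c0 : 0 < w * s^-1 ^+ j by rewrite mulr_gt0 // exprn_gt0 // invr_gt0.
have le : y1 * y3 <= x1 * x3.
  rewrite -(ler_pM2l c0).
  have -> : w * s^-1 ^+ j * (x1 * x3) = NN s w ^+ 2 * (NN s (w / X1) * NN s (w / X3)).
    by rewrite -res /x1 /x3; ring.
  have -> : w * s^-1 ^+ j * (y1 * y3) = NN s w ^+ 2 *
     (w * s^-1 ^+ j * (X1 * X3) * (MM s (w / X1) * MM s (w / X3))).
    by rewrite /y1 /y3; ring.
  by rewrite ler_pM2l // exprn_gt0.
have [E1 E3] : x1 = y1 /\ x3 = y3.
  have h1 : x1 * x3 <= y1 * x3 by rewrite ler_pM2r.
  have h3 : y1 * x3 <= y1 * y3 by rewrite ler_wpM2l // (le_trans (ltW x10)).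
  have y10 := lt_le_trans x10 c1.
  have E : y1 * x3 = y1 * y3 by apply: le_anti; rewrite h3 (le_trans le).
  have E' : x1 * x3 = y1 * x3 by apply: le_anti; rewrite h1 (le_trans h3).
  by split; [apply: (mulIf (lt0r_neq0 x30))|apply: (mulfI (lt0r_neq0 y10))].
by split; [apply: e1|apply: e3].
Qed.

End Resonant.

(* Since [s^2 = s + 1 + eps s], both [dd s] and the first gap are bounded below when [eps s] is. *)
Lemma eps_small e w w2 x a : 0 < e <= 1 / 2 -> 0 < w -> w <= e ^+ 2 / 100 ->
  0 < w2 -> w2 <= w -> 0 < a -> a < 1 -> 0 < x -> x < 1 ->
  w * ((1 - de s) * (1 - x)) = de s * x -> x + a = dd s ->
  w2 * ((1 - a) * (1 - a)) = a * a -> eps s <= e.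
Proof.
move=> /andP[ep e12] w0 we w20 w2w a0 a1 x0 x1 hx xa ha.
rewrite leNgt; apply/negP => lt; set E := eps s in lt.
have E0 : 0 < E by [].
have sE : s ^+ 2 = s + 1 + E by rewrite /E /eps; ring.
have s2 : s <= 2 + E by have := s1; nra.
have d3 : e / 3 <= dd s.
  rewrite ler_pdivlMr ?s2_gt1 // sE -/E.
  have : e * (s + 1 + E - 1) <= e * (2 + E + E) by rewrite ler_pM2l //; lra.
  nra.
have a6 : a < e / 6.
  rewrite ltNge; apply/negP => h.
  have : a * a <= w2.
    rewrite -ha ler_piMr ?(ltW w20) // mulr_ile1 ?subr_ge0 ?(ltW a1) //; lra.
  have : (e / 6) * (e / 6) <= a * a by rewrite ler_pM // ltW // divr_gt0.
  have : 0 < e * e by rewrite mulr_gt0.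
  by rewrite expr2 in we; lra.
have x6 : e / 6 <= x by lra.
have h2 : w * qq s * (1 - x) = s * E * x.
  have dN : de s != 0 by rewrite gt_eqF ?de_gt0.
  apply: (mulfI dN); rewrite [LHS](_ : _ = w * (de s * qq s) * (1 - x)); last by ring.
  rewrite -de_frac; move/(congr1 (fun z => s * eps s * z)): hx.
  rewrite -/E; set e' := s * E; lra.
have q1 : qq s = 2 * s + E by rewrite /qq sE; ring.
have : s * E * x <= w * qq s.
  rewrite -h2 ler_piMr //; first by rewrite mulr_ge0 // ltW // qq_gt0.
  lra.
have : s * e * (2 + E) <= s * E * 3.
  have : e * E <= 1 / 2 * E by rewrite ler_pM2r.
  by rewrite -!mulrA ler_pM2l //; lra.
have : 2 * s + E <= s * (2 + E).
  by rewrite mulrDr (mulrC 2) lerD2l ler_peMl ?(ltW E0) ?(ltW s1).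
rewrite q1 => h3 h4 h5.
have h6 : s * E * (e / 6) <= w * (s * (2 + E)).
  apply: le_trans (_ : s * E * x <= _); first by rewrite ler_pM2l // mulr_gt0.
  by apply: le_trans h5 _; rewrite ler_pM2l.
have h7 : s * e * (2 + E) * (e / 6) <= 3 * (w * (s * (2 + E))).
  have : s * e * (2 + E) * (e / 6) <= s * E * 3 * (e / 6) by rewrite ler_pM2r //; lra.
  lra.
have se0 : 0 < s * (2 + E) by rewrite mulr_gt0 //; lra.
have : s * (2 + E) * (e ^+ 2 / 6) <= s * (2 + E) * (3 * w) by move: h7; rewrite expr2; lra.
rewrite ler_pM2l // => h8; have : 0 < e ^+ 2 by rewrite exprn_gt0.
lra.
Qed.

End Pos.
End S.
End Algebra.

(** * Configurations of pendant vertices *)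

Section Sites.
Import Order.TTheory GRing.Theory Num.Theory.
Local Open Scope ring_scope.
Variables (R : realFieldType) (t : R).
Hypothesis t1 : 1 < t.
Let t0 : 0 < t. Proof. exact: lt_trans t1. Qed.
Let tN : t != 0. Proof. by rewrite gt_eqF. Qed.
Let s1 : 1 < t ^+ 2. Proof. by rewrite exprn_egt1. Qed.
Local Notation lam := (t + t^-1).
Local Notation s := (t ^+ 2).

Let s0 : 0 < s. Proof. exact: lt_trans s1. Qed.
Let N1 : s + 1 != 0. Proof. by rewrite gt_eqF // addr_gt0. Qed.
Let N2 : s ^+ 2 - 1 != 0. Proof. by rewrite gt_eqF // subr_gt0 exprn_egt1. Qed.
Let N3 : s ^+ 3 - 1 != 0. Proof. by rewrite gt_eqF // subr_gt0 exprn_egt1. Qed.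
Let N4 : t * t - 1 != 0. Proof. by rewrite -expr2 gt_eqF // subr_gt0. Qed.
Let N5 : (t * t + 1) ^+ 2 + -1 * s != 0.
Proof.
have -> : (t * t + 1) ^+ 2 + -1 * s = s ^+ 2 + s + 1 by ring.
by rewrite gt_eqF // !addr_gt0 ?exprn_gt0.
Qed.

Lemma site_const : (lam - lam^-1 - 2 * t^-1) / (t - t^-1) = dd s.
Proof. by rewrite /dd /eps; field; rewrite N2 tN N4 -expr2 N1. Qed.

(** [lam / (lam ^+ 2 - 1)] is the ratio forced by a pendant path of 2 vertices. It is subtracted
    twice: for the hanging path and for the end of the main path itself. *)
Definition end_ratio : R := lam - 2 * (lam / (lam ^+ 2 - 1)).

Lemma end_const : (end_ratio - t^-1) / (t - t^-1) = de s.
Proof. by rewrite /end_ratio /de /eps; field; rewrite N3 tN N4 N5. Qed.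

(** The bound at an outermost site: its pendant vertex and the bare end of the path each take at
    least [lam^-1]. *)
Lemma first_const : (lam - 2 * lam^-1 - t^-1) / (t - t^-1) = s / (s + 1).
Proof. by field; rewrite N1 tN N4. Qed.

Lemma first_lt1 : s / (s + 1) < 1.
Proof. by rewrite ltr_pdivrMr ?addr_gt0 // mul1r ltrDl. Qed.

Section Chain.
Variables (Y : nat -> R) (D : nat).
Hypothesis Y0 : forall i, (i <= D)%N -> 0 < Y i.
Hypothesis Ysup : forall i, (i.+2 <= D)%N -> Y i + Y i.+2 <= lam * Y i.+1.

(** The bounds below 1 at the two extremes propagate inward. An excess below 1 makes the facing
    excess across the gap positive, and since the excesses at an inner site total at most
    [dd s < 1], the one on its other side is again below 1. Hence an induction from the left for
    [hR] and from the right for [hL]. *)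
Lemma chain_gaps (P : nat -> nat) m :
  (0 < P 0)%N -> (P m <= D)%N -> (forall i, (i < m)%N -> (P i < P i.+1)%N) ->
  hR t Y (P 0) < 1 -> hL t Y (P m) < 1 ->
  (forall i, (0 < i < m)%N -> hL t Y (P i) + hR t Y (P i) <= dd s) ->
  forall i, (i < m)%N ->
  [/\ 0 < hR t Y (P i) < 1, 0 < hL t Y (P i.+1) < 1,
      (0 < i)%N -> hR t Y (P i) <= dd s,
      (i.+1 < m)%N -> hL t Y (P i.+1) <= dd s &
      s^-1 ^+ (P i.+1 - P i) * ((1 - hR t Y (P i)) * (1 - hL t Y (P i.+1)))
        <= hR t Y (P i) * hL t Y (P i.+1)].
Proof.
move=> P0 PD Pm h0 hm hi.
have P1 i : (i <= m)%N -> (0 < P i)%N.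
  by elim: i => // i IH im; apply: leq_trans (Pm i im).
have P2 i : (i <= m)%N -> (P i <= D)%N.
  move=> im; apply: leq_trans PD; rewrite -(subnKC im).
  have : (i + (m - i) <= m)%N by rewrite subnKC.
  elim: (m - i)%N => [|k IH]; first by rewrite addn0.
  by rewrite addnS => /[dup] /ltnW/IH h /Pm /ltnW; apply: leq_trans.
have sup i : (i < m)%N -> forall l, (P i <= l)%N -> (l.+2 <= P i.+1)%N ->
    Y l + Y l.+2 <= lam * Y l.+1.
  by move=> im l _ ll; apply: Ysup; apply: leq_trans ll (P2 _ im).
have d1 := dd_lt1 s1.
have R1 i : (i < m)%N -> hR t Y (P i) < 1.
  elim: i => // i IH im.
  have i1 : (0 < i.+1 < m)%N by rewrite im.
  have i2 := ltnW im.
  have := gap_pos_right t1 (Pm i i2) (Y0 (P2 _ (ltnW i2))) (Y0 (P2 _ i2)) (sup i i2) (IH i2).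
  have := hi _ i1; lra.
have L1' k : (k < m)%N -> hL t Y (P (m - k)%N) < 1.
  elim: k => [|k IH] km; first by rewrite subn0.
  have [e1 e2] : (0 < m - k.+1 < m)%N /\ ((m - k.+1).+1 = m - k)%N.
    by clear -km; lia.
  have := IH (ltnW km); rewrite -e2 => h.
  case/andP: (e1) => _ im.
  have := gap_pos_left t1 (P1 _ (ltnW im)) (Pm _ im) (Y0 (P2 _ (ltnW im))) (Y0 (P2 _ im))
    (sup _ im) h.
  have := hi _ e1; lra.
have L1 i : (i < m)%N -> hL t Y (P i.+1) < 1.
  move=> im; have := @L1' (m - i.+1)%N; rewrite subKn //; apply.
  by clear -im; lia.
have R0 i : (i < m)%N -> 0 < hR t Y (P i).
  move=> im; have im' := ltnW im.
  exact: (gap_pos_left t1 (P1 _ im') (Pm _ im) (Y0 (P2 _ im')) (Y0 (P2 _ im)) (sup _ im) (L1 _ im)).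
have L0 i : (i < m)%N -> 0 < hL t Y (P i.+1).
  move=> im; have im' := ltnW im.
  exact: (gap_pos_right t1 (Pm _ im) (Y0 (P2 _ im')) (Y0 (P2 _ im)) (sup _ im) (R1 _ im)).
move=> i im; split; rewrite ?R0 ?R1 ?L0 ?L1 //.
- case: i im => // i im _; have := L0 i (ltnW im).
  have := hi i.+1; rewrite im => /(_ erefl); lra.
- move=> im'; have := R0 _ im'; have := hi i.+1; rewrite im' => /(_ erefl); lra.
- have im' := ltnW im.
  exact: (gap_prod t1 (P1 _ im') (Pm _ im) (Y0 (P2 _ im')) (Y0 (P2 _ im)) (sup _ im) (R1 _ im) (L1 _ im)).
Qed.

Lemma site_hLR p : (p <= D)%N ->
  Y p.-1 + Y p.+1 + lam^-1 * Y p <= lam * Y p -> hL t Y p + hR t Y p <= dd s.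
Proof.
move=> pD h; rewrite -site_const; apply: (hLR t1); first exact: Y0.
by rewrite mulrBl; lra.
Qed.

Lemma site_hR p : (p <= D)%N -> lam^-1 * Y p <= Y p.-1 ->
  Y p.-1 + Y p.+1 + lam^-1 * Y p <= lam * Y p -> hR t Y p <= s / (s + 1).
Proof.
move=> pD h1 h; rewrite -first_const; apply: (hR_le t1); first exact: Y0.
by rewrite mulrBl -mulrA; lra.
Qed.

Lemma site_hL p : (p <= D)%N -> lam^-1 * Y p <= Y p.+1 ->
  Y p.-1 + Y p.+1 + lam^-1 * Y p <= lam * Y p -> hL t Y p <= s / (s + 1).
Proof.
move=> pD h1 h; rewrite -first_const; apply: (hL_le t1); first exact: Y0.
by rewrite mulrBl -mulrA; lra.
Qed.

End Chain.

(** The odds of [s / (s + 1)] are [s], so the weight is at most [s * b / (1 - b)], and 9/5 divided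
    by 99/100 is below 2. *)
Lemma gap_weight_first w a b e : 0 < w -> 0 < a -> a <= s / (s + 1) ->
  0 < b -> b <= e -> e <= 1 / 100 -> s <= 9 / 5 ->
  w * ((1 - a) * (1 - b)) <= a * b -> w <= 2 * e.
Proof.
move=> w0 a0 ha b0 be e1 s2 h.
have h1 : (s + 1) * a <= s by rewrite mulrC -ler_pdivlMr ?addr_gt0.
have h2 : w * (1 - b) * ((s + 1) * (1 - a)) <= (s + 1) * a * b.
  have : (s + 1) * (w * ((1 - a) * (1 - b))) <= (s + 1) * (a * b).
    by rewrite ler_pM2l // addr_gt0.
  by move: s0 => _; lra.
have h3 : 1 <= (s + 1) * (1 - a) by lra.
have h4 : w * (1 - b) <= s * b.
  apply: le_trans (_ : w * (1 - b) * ((s + 1) * (1 - a)) <= _).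
    by rewrite ler_peMr // mulr_ge0 ?(ltW w0) //; lra.
  by apply: le_trans h2 _; rewrite ler_pM2r.
have h5 : s * b <= 9 / 5 * e.
  by apply: le_trans (_ : 9 / 5 * b <= _); [rewrite ler_pM2r|lra].
have : w * (99 / 100) <= w * (1 - b) by rewrite ler_pM2l //; lra.
lra.
Qed.

Lemma gap_weight_inner w a b (e : R) : 0 < w -> 0 < a -> a <= e ->
  0 < b -> b <= e -> e <= 1 / 100 ->
  w * ((1 - a) * (1 - b)) <= a * b -> w <= 2 * e ^+ 2.
Proof.
move=> w0 a0 ha b0 be e1 h.
have h1 : a * b <= e ^+ 2 by rewrite expr2 ler_pM // ltW.
have : w * ((99 / 100) * (99 / 100)) <= w * ((1 - a) * (1 - b)).
  by rewrite ler_pM2l // ler_pM //; lra.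
have : 0 <= e ^+ 2 by rewrite sqr_ge0.
lra.
Qed.

Lemma expr_gaps (x : R) (P : nat -> nat) m :
  (forall i, (i < m)%N -> (P i < P i.+1)%N) ->
  x ^+ (P m - P 0)%N = \prod_(i < m) x ^+ (P i.+1 - P i)%N.
Proof.
elim: m => [_|m IH h]; first by rewrite big_ord0 subnn.
rewrite big_ord_recr /= -IH => [|i im]; last by apply: h; apply: ltnW.
have {}IH : (P 0 <= P m)%N.
  elim: m h {IH} => // m IH h; apply: leq_trans (ltnW (h m _)) => //.
  by apply: IH => i im; apply: h; apply: ltnW.
by rewrite -exprD; congr (_ ^+ _); have := h m (ltnSn m); clear -IH; lia.
Qed.

End Sites.

(** * Counting sites along the path *)

Section Count.
Variables (D : nat) (dep : nat -> nat).
Hypothesis D4 : 4 < D.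
Hypothesis dep_le : forall p, p <= D -> dep p <= 2.
Hypothesis dep2 : forall p, p <= D -> dep p = 2 -> p = 2 \/ p = D - 2.

Definition site_seq := [seq p <- iota 0 D.+1 | 0 < dep p].

Lemma mem_site_seq p : (p \in site_seq) = (p <= D) && (0 < dep p).
Proof. by rewrite mem_filter mem_iota add0n ltnS andbC. Qed.

Lemma site_seq_lt i : i.+1 < size site_seq ->
  nth 0 site_seq i < nth 0 site_seq i.+1.
Proof.
have : sorted ltn site_seq by apply: sorted_filter (iota_ltn_sorted _ _); apply: ltn_trans.
by move/(sortedP 0); apply.
Qed.

Lemma site_seq_nth i : i < size site_seq ->
  nth 0 site_seq i <= D /\ 0 < dep (nth 0 site_seq i).
Proof. by move/(mem_nth 0); rewrite mem_site_seq => /andP. Qed.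

(** Only positions 2 and [D - 2] can have depth 2 and count once more; [D4] keeps them distinct. *)
Lemma size_site_seq :
  size site_seq + (dep 2 == 2) + (dep (D - 2) == 2) = \sum_(p < D.+1) dep p.
Proof.
have -> : \sum_(p < D.+1) dep p = \sum_(p < D.+1) ((0 < dep p) + (dep p == 2)).
  apply: eq_bigr => p _; have := dep_le (ltn_ord p : p <= D).
  by case: (dep p) => [|[|[|?]]].
rewrite big_split /= -addnA; congr (_ + _).
  rewrite -(big_mkord xpredT (fun p => 0 < dep p : nat)) /index_iota subn0.
  by rewrite -sum1_size big_filter big_mkcond.
have h2 : 2 < D.+1 by lia.
have hD : D - 2 < D.+1 by lia.
rewrite (bigD1 (Ordinal h2)) //= (bigD1 (Ordinal hD)) /=; last first.
  by rewrite -val_eqE /=; lia.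
rewrite [X in _ + (_ + X)]big1 ?addn0 // => p /andP[]; rewrite -!val_eqE /= => p2 pD.
have := dep2 (ltn_ord p : p <= D); case: eqP => // -> /(_ erefl); lia.
Qed.

End Count.

(** * Excess inequalities determine the configuration *)

Section Config.
Import Order.TTheory GRing.Theory Num.Theory.
Local Open Scope ring_scope.
Variables (R : realFieldType) (t : R).
Hypothesis t1 : 1 < t.
Local Notation lam := (t + t^-1).
Local Notation s := (t ^+ 2).
Local Notation e := (eps s).
Variables (Y : nat -> R) (D : nat) (dep : nat -> nat) (k j : nat).
Hypothesis Y0 : forall i, (i <= D)%N -> 0 < Y i.
Hypothesis Ysup : forall i, (i.+2 <= D)%N -> Y i + Y i.+2 <= lam * Y i.+1.
Hypothesis Yl : Y 1 <= lam * Y 0.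
Hypothesis Yr : Y D.-1 <= lam * Y D.
Hypothesis dep_le : forall p, (p <= D)%N -> (dep p <= 2)%N.
Hypothesis dep_site : forall p, (p <= D)%N -> (0 < dep p)%N ->
  (0 < p < D)%N /\ Y p.-1 + Y p.+1 + lam^-1 * Y p <= lam * Y p.
Hypothesis dep2 : forall p, (p <= D)%N -> dep p = 2%N ->
  (p = 2%N /\ Y 3 <= end_ratio t * Y 2) \/
  (p = (D - 2)%N /\ Y (D - 2).-1 <= end_ratio t * Y (D - 2)).
Hypothesis dep_sum : (\sum_(p < D.+1) dep p = 6)%N.
Hypothesis e0 : 0 < e.
Hypothesis e_small : e <= (1 / 200) ^+ 4.
Hypothesis j2 : (j <= 2)%N.
Hypothesis DE : D = (3 * k + 7 + j)%N.
Local Notation w := (s^-1 ^+ k.+1).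
Hypothesis n0 : 0 < NN s w.
Hypothesis res : w * s^-1 ^+ j * MM s w ^+ 2 = NN s w ^+ 2.

Let t0 : 0 < t. Proof. exact: lt_trans t1. Qed.
Let s1 : 1 < s. Proof. by rewrite exprn_egt1. Qed.
Let s0 : 0 < s. Proof. exact: lt_trans s1. Qed.
Let lam0 : 0 < lam. Proof. by rewrite addr_gt0 ?invr_gt0. Qed.
Let e1 : e <= 1 / 200.
Proof.
apply: le_trans e_small _; rewrite exprS ler_piMr ?exprn_ile1 //; lra.
Qed.
Let sE : s ^+ 2 = s + 1 + e. Proof. rewrite /eps; ring. Qed.
Let s_le : s <= 163 / 100.
Proof. rewrite leNgt; apply/negP => h; have := e1; have := sE; nra. Qed.
Let si0 : 0 < s^-1. Proof. by rewrite invr_gt0. Qed.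
Let si1 : s^-1 < 1. Proof. by rewrite invf_lt1. Qed.
Let w0 : 0 < w. Proof. by rewrite exprn_gt0. Qed.
Let D4 : (4 < D)%N. Proof. by rewrite DE addnAC ltn_addl. Qed.

(* For the extremal tree [w] is of order [eps ^+ 2], so three gaps amount to [eps ^+ 6]. *)
Lemma eps6_le : e ^+ 6 <= 120 ^+ 3 * s^-1 ^+ D.
Proof.
(* With [s <= 163 / 100], the factor [qq s ^+ 2 * s ^+ 2] in [resonant_w] is below 40. The 120 is 40
   * 3, where [s ^+ 2 <= 3] pays for the up to six edges by which [D] falls short of or exceeds
   three gaps. *)
have h1 : e ^+ 2 <= w * 40.
  apply: le_trans (resonant_w s1 e0 w0 j2 n0 res) _; rewrite ler_pM2l //.
  have -> : qq s = 2 * s + e by rewrite /qq sE; ring.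
  have : (2 * s + e) ^+ 2 <= (327 / 100) ^+ 2.
    rewrite ler_pXn2r ?nnegrE //; [by have := e1; have := s_le; lra| |lra].
    by rewrite addr_ge0 ?(ltW e0) // mulr_ge0 ?(ltW s0).
  have : s ^+ 2 <= (163 / 100) ^+ 2.
    rewrite ler_pXn2r ?nnegrE ?(ltW s0) //; lra.
  move=> h2 h3; apply: le_trans (ler_pM _ _ h3 h2) _; rewrite ?sqr_ge0 //.
  by rewrite !expr2; lra.
have h2 : 1 / 27 <= s^-1 ^+ 6.
  rewrite (exprM _ 2 3) (_ : 1 / 27 = (1 / 3) ^+ 3 :> R); last by field.
  rewrite ler_pXn2r ?nnegrE ?exprn_ge0 ?divr_ge0 ?(ltW si0) //.
  rewrite exprVn div1r lef_pV2 ?posrE ?exprn_gt0 //; have := sE; have := s_le; have := e1; lra.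
have h3 : s^-1 ^+ (3 * k + 9) <= s^-1 ^+ D.
  rewrite DE -addnA; apply: ler_wiXn2l; rewrite ?(ltW si0) ?(ltW si1) //.
  by rewrite leq_add2l (leq_add2l 7 j 2).
have h4 : s^-1 ^+ (3 * k + 9) = w ^+ 3 * s^-1 ^+ 6.
  by rewrite -exprM -exprD; congr (_ ^+ _); clear; lia.
apply: le_trans (_ : _ <= 120 ^+ 3 * s^-1 ^+ (3 * k + 9)) _; last first.
  by rewrite ler_pM2l // exprn_gt0.
rewrite h4 (exprM _ 2 3).
have : (e ^+ 2) ^+ 3 <= (w * 40) ^+ 3 by rewrite ler_pXn2r ?nnegrE ?sqr_ge0 // mulr_ge0 // ltW.
have : w ^+ 3 * (1 / 27) <= w ^+ 3 * s^-1 ^+ 6 by rewrite ler_pM2l // exprn_gt0.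
rewrite [(w * _) ^+ 3]exprMn; move: (w ^+ 3) ((e ^+ 2) ^+ 3) (s^-1 ^+ 6) => x y z.
by rewrite !exprS !expr0; lra.
Qed.

Lemma bareL p : (0 < p <= D)%N -> lam^-1 * Y p <= Y p.-1.
Proof.
move=> /andP[p0 pD]; rewrite mulrC ler_pdivrMr // mulrC.
case: p p0 pD => [//|[|p]] _ pD; first exact: Yl.
apply: le_trans (Ysup pD); rewrite lerDr ltW // Y0 //.
by apply: leq_trans pD; rewrite -addn2 leq_addr.
Qed.

Lemma bareR p : (p < D)%N -> lam^-1 * Y p <= Y p.+1.
Proof.
move=> pD; rewrite mulrC ler_pdivrMr // mulrC.
have [E|ne] := eqVneq p.+1 D; first by have := Yr; rewrite -E.
have pD2 : (p.+2 <= D)%N by rewrite ltn_neqAle ne.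
by apply: le_trans (Ysup pD2); rewrite lerDl ltW // Y0.
Qed.

Let l := site_seq D dep.
Let P i := nth 0%N l i.
Let W i := s^-1 ^+ (P i.+1 - P i).
Let m := (size l).-1.

Let dep2' p : (p <= D)%N -> dep p = 2%N -> p = 2%N \/ p = (D - 2)%N.
Proof. by move=> pD /(dep2 pD)[[]|[]]; [left|right]. Qed.

Let sizeE : (size l + (dep 2 == 2) + (dep (D - 2) == 2) = 6)%N.
Proof. by rewrite (size_site_seq D4 dep_le dep2') dep_sum. Qed.

Let mE : size l = m.+1.
Proof.
rewrite /m prednK //; have := sizeE.
by case: (size l) => //; case: (_ == _); case: (_ == _).
Qed.

Let m3 : (3 <= m)%N.
Proof. by have := sizeE; rewrite mE; case: (_ == _); case: (_ == _); clear; lia. Qed.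

Let P_in i : (i <= m)%N -> (0 < P i < D)%N /\
  Y (P i).-1 + Y (P i).+1 + lam^-1 * Y (P i) <= lam * Y (P i).
Proof.
move=> im; have /site_seq_nth[h1 h2] : (i < size l)%N by rewrite mE.
exact: dep_site.
Qed.

Let PD i : (i <= m)%N -> (P i <= D)%N.
Proof. by move=> /P_in[/andP[_ /ltnW]]. Qed.

Let Plt i : (i < m)%N -> (P i < P i.+1)%N.
Proof. by move=> im; apply: site_seq_lt; rewrite -/l mE. Qed.

Let R0 : hR t Y (P 0) <= s / (s + 1).
Proof.
have [/andP[p0 pD] h] := P_in (leq0n m).
by apply: (site_hR t1 Y0 (ltnW pD)) h; rewrite bareL // p0 ltnW.
Qed.

Let Lm : hL t Y (P m) <= s / (s + 1).
Proof.
have [/andP[p0 pD] h] := P_in (leqnn m).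
by apply: (site_hL t1 Y0 (ltnW pD)) h; rewrite bareR.
Qed.

Let gaps i : (i < m)%N ->
  [/\ 0 < hR t Y (P i) < 1, 0 < hL t Y (P i.+1) < 1,
      (0 < i)%N -> hR t Y (P i) <= dd s,
      (i.+1 < m)%N -> hL t Y (P i.+1) <= dd s &
      W i * ((1 - hR t Y (P i)) * (1 - hL t Y (P i.+1)))
        <= hR t Y (P i) * hL t Y (P i.+1)].
Proof.
apply: (chain_gaps t1 Y0 Ysup).
- by have [/andP[]] := P_in (leq0n m).
- exact: PD.
- exact: Plt.
- exact: le_lt_trans R0 (first_lt1 t1).
- exact: le_lt_trans Lm (first_lt1 t1).
move=> n /andP[_ nm]; have [/andP[_ pD] h] := P_in (ltnW nm).
exact: (site_hLR t1 Y0 (ltnW pD)) h.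
Qed.

Let W0 i : 0 < W i. Proof. by rewrite exprn_gt0. Qed.

Let dd_le : dd s <= e. Proof. exact: dd_le_eps. Qed.
Let de_le : de s <= e. Proof. exact: de_le_eps. Qed.

Let e100 : e <= 1 / 100. Proof. by apply: le_trans e1 _; lra. Qed.
Let s95 : s <= 9 / 5. Proof. by apply: le_trans s_le _; lra. Qed.

Let W_first : W 0 <= 2 * e.
Proof.
have m1 : (1 < m)%N by apply: leq_trans m3.
have [/andP[r0 r1] /andP[l0 l1] _ /(_ m1) ld h] := gaps (ltnW m1).
exact: (gap_weight_first t1 (W0 0) r0 R0 l0 (le_trans ld dd_le) e100 s95 h).
Qed.

Let W_last : W m.-1 <= 2 * e.
Proof.
have m1 : (m.-1.+1 = m)%N by rewrite prednK //; apply: leq_trans m3.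
have m2 : (0 < m.-1)%N by have := m3; case: (m) => [|[|]].
have mm : (m.-1 < m)%N by rewrite m1.
have [/andP[r0 r1] /andP[l0 l1] /(_ m2) rd _ h] := gaps mm.
rewrite m1 in l0 l1 h.
apply: (gap_weight_first t1 (W0 m.-1) l0 Lm r0 (le_trans rd dd_le) e100 s95).
by rewrite (mulrC (1 - _)) (mulrC (hL _ _ _)) -[m in hL _ _ (P m)]m1 m1.
Qed.

Let W_inner i : (0 < i)%N -> (i.+1 < m)%N -> W i <= 2 * e ^+ 2.
Proof.
move=> i0 im; have [/andP[r0 r1] /andP[l0 l1] /(_ i0) rd /(_ im) ld h] := gaps (ltnW im).
exact: (gap_weight_inner (W0 i) r0 (le_trans rd dd_le) l0 (le_trans ld dd_le) e100 h).
Qed.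

(** So neither the first nor the last gap can be a single edge. *)
Let W1_gt : 2 * e < s^-1.
Proof.
apply: le_lt_trans (_ : 1 / 100 < _); first by have := e1; lra.
by rewrite div1r ltf_pV2 ?posrE //; apply: le_lt_trans s_le _; lra.
Qed.

Let D7 : (7 <= D)%N. Proof. by rewrite DE addnAC leq_addl. Qed.

Let P_mem p : (p <= D)%N -> (0 < dep p)%N -> exists2 i, (i <= m)%N & P i = p.
Proof.
move=> pD dp; have pl : p \in l by rewrite mem_site_seq pD.
by exists (index p l); [rewrite -ltnS -mE index_mem|apply: nth_index].
Qed.

(** A site before position 2 could only be at position 1, leaving a first gap of one edge against
    [W1_gt]. At depth 2 the outer excess is at most [de s], which improves the bound on the first
    gap to second order. *)
Let end_first : dep 2 = 2%N ->
  [/\ P 0 = 2%N, hR t Y (P 0) <= de s & W 0 <= 2 * e ^+ 2].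
Proof.
move=> d2; have D2 : (2 <= D)%N by apply: leq_trans D7.
have h3 : Y 3 <= end_ratio t * Y 2.
  by case: (dep2 D2 d2) => [[]//|[E _]]; have := D7; clear -E; lia.
have P0E : P 0 = 2%N.
  have [|[|i] im Pi] := P_mem D2; rewrite ?d2 //.
  have lt := Plt im; rewrite Pi in lt.
  have [/andP[Pi0 _] _] := P_in (ltnW im).
  case: i im Pi lt Pi0 => [|i] im Pi lt Pi0; last first.
    have [/andP[Pi1 _] _] := P_in (ltnW (ltnW im)).
    by have := Plt (ltnW im); clear -lt Pi0 Pi1; lia.
  have P1 : P 0 = 1%N by clear -lt Pi0; lia.
  have := W_first; rewrite /W Pi P1 subSnn expr1 => h.
  by have := lt_le_trans W1_gt h; rewrite ltxx.
have hd : hR t Y (P 0) <= de s.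
  by rewrite P0E -(end_const t1); apply: (hR_le t1); rewrite ?Y0.
split=> //; have m1 : (1 < m)%N by apply: leq_trans m3.
have [/andP[r0 r1] /andP[l0 l1] _ /(_ m1) ld h] := gaps (ltnW m1).
exact: (gap_weight_inner (W0 0) r0 (le_trans hd de_le) l0 (le_trans ld dd_le) e100 h).
Qed.

Let end_last : dep (D - 2) = 2%N ->
  [/\ P m = (D - 2)%N, hL t Y (P m) <= de s & W m.-1 <= 2 * e ^+ 2].
Proof.
move=> d2; have D2 : (D - 2 <= D)%N by apply: leq_subr.
have h3 : Y (D - 2).-1 <= end_ratio t * Y (D - 2).
  by case: (dep2 D2 d2) => [[E _]|[]//]; have := D7; clear -E; lia.
have m1 : (m.-1.+1 = m)%N by rewrite prednK //; apply: leq_trans m3.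
have P0E : P m = (D - 2)%N.
  have [|i im Pi] := P_mem D2; rewrite ?d2 //.
  have [<- //|ne] := eqVneq i m.
  have {ne} im : (i < m)%N by rewrite ltn_neqAle ne.
  have lt := Plt im; rewrite Pi in lt.
  have [/andP[_ Pi0] _] := P_in im.
  have P1 : (P i.+1 = (D - 2).+1)%N by clear -lt Pi0; lia.
  have [E|ne] := eqVneq i.+1 m; last first.
    have im' : (i.+1 < m)%N by rewrite ltn_neqAle ne.
    have [/andP[_ Pi2] _] := P_in im'.
    by have := Plt im'; clear -P1 Pi2; lia.
  have := W_last; rewrite -E /= /W Pi P1 subSnn expr1 => h.
  by have := lt_le_trans W1_gt h; rewrite ltxx.
have hd : hL t Y (P m) <= de s.
  by rewrite P0E -(end_const t1); apply: (hL_le t1); rewrite ?Y0.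
split=> //.
have m2 : (0 < m.-1)%N by have := m3; case: (m) => [|[|]].
have mm : (m.-1 < m)%N by rewrite m1.
have [/andP[r0 r1] /andP[l0 l1] /(_ m2) rd _ h] := gaps mm.
rewrite m1 in l0 l1 h.
apply: (gap_weight_inner (W0 m.-1) r0 (le_trans rd dd_le) l0 (le_trans hd de_le) e100 h).
Qed.

Let e_gt0 : 0 < e ^+ 6. Proof. exact: exprn_gt0. Qed.

(* More than three gaps would have total weight at most [32 * e ^+ 7]. *)
Let prod_W_bound : 32 * e ^+ 7 < s^-1 ^+ (P m - P 0).
Proof.
apply: lt_le_trans (_ : s^-1 ^+ D <= _); last first.
  apply: ler_wiXn2l; rewrite ?(ltW si0) ?(ltW si1) //.
  by apply: leq_trans (leq_subr _ _) (PD (leqnn m)).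
have h0 : (0 : R) < 120 ^+ 3 by rewrite exprn_gt0.
rewrite -(ltr_pM2l h0); apply: lt_le_trans eps6_le.
rewrite [ltLHS](_ : _ = e ^+ 6 * (120 ^+ 3 * 32 * e)); last by ring.
(* What remains is [120 ^+ 3 * 32 * e < 1]; this demand sets the size of [e_small]. *)
rewrite gtr_pMr // -ltr_pdivlMl ?mulr_gt0 //.
apply: le_lt_trans e_small _; rewrite mulr1 div1r exprVn ltf_pV2 ?posrE ?mulr_gt0 ?exprn_gt0 //.
by rewrite !exprS expr0; lra.
Qed.

(** By [sizeE] there are 3, 4 or 5 gaps, with two, one or no ends of depth 2. Four gaps weigh at
    most [16 * e ^+ 7] and five at most [32 * e ^+ 8], both excluded by [prod_W_bound]. *)
Let ends_deep : dep 2 = 2%N /\ dep (D - 2) = 2%N.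
Proof.
suff : m = 3%N.
  have := sizeE; rewrite mE => + m3'; rewrite m3'.
  by have := dep2'; case: eqP => //; case: eqP.
apply/eqP; rewrite eqn_leq m3 andbT leqNgt; apply/negP => m4.
have := prod_W_bound; rewrite (expr_gaps _ Plt) => /lt_le_trans H.
have ep : 0 <= 2 * e by rewrite mulr_ge0 ?(ltW e0).
have ep2 : 0 <= 2 * e ^+ 2 by rewrite mulr_ge0 ?sqr_ge0.
have W0' i : 0 <= W i by apply: ltW.
pose bound (c0 c1 : R) (i : nat) := if i == 0%N then c0 else if i == m.-1 then c1 else 2 * e ^+ 2.
have B c0 c1 : W 0 <= c0 -> W m.-1 <= c1 ->
    32 * e ^+ 7 < \prod_(i < m) bound c0 c1 i.
  move=> h0 h1; apply: H; apply: ler_prod => i _; rewrite W0' /= /bound.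
  case: eqP => [->//|/eqP i0]; case: eqP => [->//|/eqP i1].
  apply: W_inner; first by rewrite lt0n.
  by have := ltn_ord i; clear -i0 i1; lia.
have e1' : e <= 1 by apply: le_trans e1 _; lra.
have e8 : 32 * e ^+ 8 <= 32 * e ^+ 7.
  by rewrite ler_pM2l // exprS ler_piMl // exprn_ge0 // ltW.
have e7 : 16 * e ^+ 7 <= 32 * e ^+ 7.
  by rewrite ler_pM2r ?exprn_gt0 //; lra.
have [E|ne] := eqVneq m 4%N.
  have : (dep 2 == 2) || (dep (D - 2) == 2)%N.
    by have := sizeE; rewrite mE E; case: (_ == _); case: (_ == _).
  rewrite E in B; case/orP => /eqP d2.
    have [_ _ h] := end_first d2.
    have h' := W_last; rewrite E in h'.
    have := B _ _ h h'; rewrite /bound E !big_ord_recl big_ord0 /=.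
    by apply/negP; rewrite -leNgt; apply: le_trans e7; rewrite le_eqVlt; apply/orP; left; apply/eqP; ring.
  have [_ _ h] := end_last d2; rewrite E in h.
  have := B _ _ W_first h; rewrite /bound E !big_ord_recl big_ord0 /=.
  by apply/negP; rewrite -leNgt; apply: le_trans e7; rewrite le_eqVlt; apply/orP; left; apply/eqP; ring.
have E : m = 5%N.
  have : (m <= 5)%N by have := sizeE; rewrite mE; clear; lia.
  by move: ne m4; clear; lia.
have h' := W_last; rewrite E in h' B.
have := B _ _ W_first h'; rewrite /bound E !big_ord_recl big_ord0 /=.
by apply/negP; rewrite -leNgt; apply: le_trans e8; rewrite le_eqVlt; apply/orP; left; apply/eqP; ring.
Qed.

Let mE3 : m = 3%N.
Proof.
by have [d2 d3] := ends_deep; have := sizeE; rewrite mE d2 d3 /=; clear; lia.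
Qed.

(** Gap lengths are integers, so the ratios are integral powers of [s]: none but 1 lies strictly
    between 1/s and s, as [compare_quadratic] requires. *)
Let ratio_cases a b : (s ^+ a / s ^+ b = 1 -> a = b) /\
  (s ^+ a / s ^+ b = 1 \/ s ^+ a / s ^+ b <= s^-1 \/ s <= s ^+ a / s ^+ b).
Proof.
have sb : 0 < s ^+ b by rewrite exprn_gt0.
have sN : s != 0 by rewrite gt_eqF.
split.
  move/(congr1 ( *%R^~ (s ^+ b))); rewrite divfK ?gt_eqF // mul1r.
  by apply: ieexprIn; rewrite // gt_eqF.
have [lt|lt|->] := ltngtP a b; last by left; rewrite divff // gt_eqF.
- right; left; rewrite ler_pdivrMr // mulrC -(ler_pM2r s0) mulfVK // -exprSr.
  by rewrite ler_weXn2l // ltW.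
- right; right; rewrite ler_pdivlMr // -exprS.
  by rewrite ler_weXn2l // ltW.
Qed.

Lemma dep_optimal p : (p <= D)%N -> dep p = depth [:: k; (k + j)%N; k] p.
Proof.
have [d2 d3] := ends_deep.
have [P0E h0 _] := end_first d2; have [P3E h3 _] := end_last d3.
rewrite mE3 in P3E h3.
have i1 : (1 < m)%N by rewrite mE3.
have i2 : (2 < m)%N by rewrite mE3.
have [_ /andP[l10 l11] _ _ g0] := gaps (ltnW i1).
have [/andP[r10 r11] /andP[l20 l21] _ _ g1] := gaps i1.
have [/andP[r20 r21] _ _ _ g2] := gaps i2.
have [/andP[_ b1] q1] := P_in (ltnW i1); have [/andP[_ b2] q2] := P_in (ltnW i2).
have s_1 := site_hLR t1 Y0 (ltnW b1) q1.
have := site_hLR t1 Y0 (ltnW b2) q2; rewrite addrC => s_2.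
have c1 := end_gap_le s1 e0 (W0 0) h0 l10 l11 g0 s_1.
(* Commuting the factors presents the last gap as a first gap seen from the right. *)
rewrite mulrC (mulrC (1 - _)) [_ * hL _ _ _]mulrC mulrC in g2.
have c3 := end_gap_le s1 e0 (W0 2) h3 r20 r21 g2 s_2.
have F := feasible_NM s1 e0 (W0 0) (W0 1) (W0 2) r10 l20 r11 l21 c1 c3 g1.
have N_1 : 0 < NN s (W 0) by apply: lt_le_trans c1; rewrite mulr_gt0 // KK_gt0.
have N_3 : 0 < NN s (W 2) by apply: lt_le_trans c3; rewrite mulr_gt0 // KK_gt0.
pose a1 := (P 1 - P 0)%N; pose a3 := (P 3 - P 2)%N; pose a2 := (P 2 - P 1)%N.
have p01 := Plt (ltnW i1); have p12 := Plt i1; have p23 := Plt i2.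
have [aE a1E a3E] : [/\ (a1 + a2 + a3 = 3 * k.+1 + j)%N,
   P 1 = (a1 + 2)%N & P 2 = (D - 2 - a3)%N].
  move: P0E P3E p01 p12 p23 D7; rewrite /a1 /a2 /a3 DE => -> ->.
  by clear; split; lia.
have sN : s != 0 by rewrite gt_eqF.
have sX n : s ^+ n != 0 by rewrite expf_neq0.
have W_div a : s^-1 ^+ a = w / (s ^+ a / s ^+ k.+1).
  by rewrite !exprVn invfM invrK mulrA mulrAC mulVf ?mul1r.
(* The three gap lengths have a fixed sum, so the outer weights determine the middle one. *)
have W1E : W 1 = w * s^-1 ^+ j * (s ^+ a1 / s ^+ k.+1 * (s ^+ a3 / s ^+ k.+1)).
  have : s^-1 ^+ (a1 + a2 + a3) = s^-1 ^+ (3 * k.+1 + j) by rewrite aE.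
  rewrite /W -/a2 !exprD (mulnC 3) exprM !exprVn => h.
  transitivity (s ^+ a1 * s ^+ a3 * ((s ^+ a1)^-1 * (s ^+ a2)^-1 * (s ^+ a3)^-1)).
    by field; rewrite !sX.
  by rewrite h; field; rewrite !sX.
rewrite [W 0]W_div [W 2]W_div W1E -/a1 -/a3 in F N_1 N_3.
have X0 a : 0 < s ^+ a / s ^+ k.+1 by rewrite divr_gt0 // exprn_gt0.
have [u1 v1] := ratio_cases a1 k.+1; have [u3 v3] := ratio_cases a3 k.+1.
have [/u1 A1 /u3 A3] := feasible_resonant s1 e0 w0 j2 n0 res (X0 a1) (X0 a3) v1 v3 N_1 N_3 F.
move=> pD; have att1 : attach [:: k; (k + j)%N; k] 1 = P 1 by rewrite a1E A1 /=; clear; lia.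
have att2 : attach [:: k; (k + j)%N; k] 2 = P 2 by rewrite a3E A3 /= DE; clear; lia.
have att3 : attach [:: k; (k + j)%N; k] 3 = P 3 by rewrite P3E /= DE; clear; lia.
rewrite /depth [size _]/= att3 [attach _ 0]/= !inE att1 att2 P3E.
have [p2|/eqP p2] := eqVneq p 2%N; first by rewrite p2 d2.
have [pd|/eqP pd] := eqVneq p (D - 2)%N; first by rewrite pd d3.
have dP i : (i <= m)%N -> (0 < dep (P i))%N.
  by move=> im; have /site_seq_nth[] : (i < size l)%N by rewrite mE.
have d1 : (dep p <= 1)%N.
  have := dep_le pD; rewrite leq_eqVlt => /orP[/eqP /(dep2' pD)|//].
  by case.
rewrite /= ; case: ifP => [/orP[]/eqP E|/norP[/eqP n1 /eqP n2]].
- by apply/eqP; rewrite eqn_leq d1 E dP // ltnW.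
- by apply/eqP; rewrite eqn_leq d1 E dP // ltnW.
apply/eqP; rewrite -leqn0 leqNgt; apply/negP => /(P_mem pD)[i im Pi].
move: i im Pi; rewrite mE3; case=> [|[|[|[|//]]]] _ Pi.
- by apply: p2; rewrite -Pi.
- by apply: n1; rewrite Pi.
- by apply: n2; rewrite Pi.
- by apply: pd; rewrite -Pi.
Qed.
End Config.

(** * The resonance equation of the candidate tree *)

Section StarChain.
Import Order.TTheory GRing.Theory Num.Theory.
Local Open Scope ring_scope.
Variables (R : rcfType) (lam : R).
Variables (Y : nat -> R) (D k j : nat).
Hypothesis k2 : (2 <= k)%N.
Hypothesis DE : D = (3 * k + 7 + j)%N.
Hypothesis lam0 : 0 < lam.
Hypothesis Y0 : forall i, (i <= D)%N -> 0 < Y i.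
Hypothesis Yl : Y 1 = lam * Y 0.
Hypothesis Yr : Y D.-1 = lam * Y D.
Hypothesis Yplain : forall i, (0 < i < D)%N ->
  i != 2%N -> i != (k + 3)%N -> i != (2 * k + j + 4)%N -> i != (D - 2)%N ->
  Y i.-1 + Y i.+1 = lam * Y i.
Hypothesis Ysite : forall i, i = (k + 3)%N \/ i = (2 * k + j + 4)%N ->
  Y i.-1 + Y i.+1 + lam^-1 * Y i = lam * Y i.
Hypothesis Yend : forall i, i = 2%N \/ i = (D - 2)%N ->
  Y i.-1 + Y i.+1 + lam / (lam ^+ 2 - 1) * Y i = lam * Y i.

Let plain i : (0 < i < D)%N ->
  [&& i != 2%N, i != (k + 3)%N, i != (2 * k + j + 4)%N & i != (D - 2)%N] ->
  Y i.-1 + Y i.+1 = lam * Y i.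
Proof. by move=> iD /and4P[]; apply: Yplain. Qed.

Let Y1E : Y 1 = lam / (lam ^+ 2 - 1) * Y 2 /\ lam ^+ 2 - 1 != 0.
Proof.
have h1 : Y 0 + Y 2 = lam * Y 1 by apply: (plain (i := 1)); rewrite DE; clear -k2; lia.
have h2 : Y 2 = (lam ^+ 2 - 1) * Y 0 by rewrite Yl in h1; rewrite expr2; lra.
have l1 : lam ^+ 2 - 1 != 0.
  apply/eqP => l; have : 0 < Y 2 by apply: Y0; rewrite DE; clear; lia.
  by rewrite h2 l mul0r ltxx.
by split=> //; rewrite h2 mulrA divfK // Yl.
Qed.

Let YrE : Y D.-1 = lam / (lam ^+ 2 - 1) * Y (D - 2).
Proof.
have h1 : Y D.-1.-1 + Y D.-1.+1 = lam * Y D.-1.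
  by apply: plain; rewrite DE; clear -k2; lia.
have [e1 e2] : (D.-1.-1 = D - 2)%N /\ (D.-1.+1 = D)%N by rewrite DE; clear; lia.
rewrite e1 e2 in h1; have [_ l1] := Y1E.
have h2 : Y (D - 2) = (lam ^+ 2 - 1) * Y D by rewrite Yr in h1; rewrite expr2; lra.
by rewrite h2 mulrA divfK // Yr.
Qed.

(** Positions 0 to 4 and the pendant path at 2 form the affine diagram of type E6, of spectral
    radius exactly 2; the positive value at position 5 makes the inequality strict. [k2] keeps
    positions 3 and 4 free of pendant vertices. *)
Lemma star_lam_gt2 : 2 < lam.
Proof.
rewrite ltNge; apply/negP => l2.
have h1 : Y 0 + Y 2 = lam * Y 1 by apply: (plain (i := 1)); rewrite DE; clear -k2; lia.
have h3 : Y 2 + Y 4 = lam * Y 3 by apply: (plain (i := 3)); rewrite DE; clear -k2; lia.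
have h4 : Y 3 + Y 5 = lam * Y 4 by apply: (plain (i := 4)); rewrite DE; clear -k2; lia.
have h2 : Y 1 + Y 3 + lam / (lam ^+ 2 - 1) * Y 2 = lam * Y 2 by apply: (Yend (i := 2)); left.
have [e _] := Y1E; rewrite -e in h2.
have P i : (i <= 5)%N -> 0 < Y i.
  by move=> i5; apply: Y0; apply: leq_trans i5 _; rewrite DE; clear; lia.
have L i : (i <= 5)%N -> lam * Y i <= 2 * Y i by move=> i5; rewrite ler_pM2r ?P.
have := L 0%N isT; have := L 1%N isT; have := L 2%N isT; have := L 3%N isT.
have := L 4%N isT; have := P 5%N isT; have := Yl; lra.
Qed.

Lemma tplus_exists : exists2 t, 1 < t & lam = t + t^-1.
Proof.
have l2 := star_lam_gt2; set r := Num.sqrt (lam ^+ 2 - 4).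
have d0 : 0 < lam ^+ 2 - 4.
  by rewrite subr_gt0 (_ : 4 = 2 ^+ 2) ?ltr_pXn2r ?nnegrE // ?(ltW lam0) // expr2; ring.
have r2 : r ^+ 2 = lam ^+ 2 - 4 by rewrite sqr_sqrtr // ltW.
have r0 : 0 < r by rewrite sqrtr_gt0.
exists ((lam + r) / 2); first by lra.
have tN : (lam + r) / 2 != 0 by rewrite gt_eqF //; lra.
apply: (mulfI tN); rewrite mulrDr divff //.
by rewrite -[X in _ = X + _]expr2; move: r2; rewrite !expr2; lra.
Qed.

(** The outer gaps have equal lengths and equal ends, so the inner excesses at both pendant vertices
    agree and the middle relation involves squares. The last clause makes [eps] small for large [k]:
    [w] is at most [(5 / 8) ^+ k.+1] because [s > 8 / 5]. *)
Lemma star_resonance : exists t,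
  [/\ 1 < t, lam = t + t^-1, 0 < eps (t ^+ 2),
      0 < NN (t ^+ 2) ((t ^+ 2)^-1 ^+ k.+1)
    & (t ^+ 2)^-1 ^+ k.+1 * (t ^+ 2)^-1 ^+ j * MM (t ^+ 2) ((t ^+ 2)^-1 ^+ k.+1) ^+ 2
        = NN (t ^+ 2) ((t ^+ 2)^-1 ^+ k.+1) ^+ 2] /\
    forall e, 0 < e <= 1 / 2 -> (5 / 8) ^+ k.+1 <= e ^+ 2 / 100 -> eps (t ^+ 2) <= e.
Proof.
have [t t1 lE] := tplus_exists; exists t.
have t0 : 0 < t by apply: lt_trans t1.
have s1 : 1 < t ^+ 2 by rewrite exprn_egt1.
set s := t ^+ 2 in s1 *; have s0 : 0 < s by apply: lt_trans s1.
pose p2 := (k + 3)%N; pose p3 := (2 * k + j + 4)%N; pose p4 := (D - 2)%N.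
have [b1 b2 b3] : [/\ (2 < p2 <= D)%N, (p2 < p3 <= D)%N & (p3 < p4 <= D)%N].
  by rewrite /p2 /p3 /p4 DE; split; clear; lia.
have [g1 g2 g3] : [/\ (p2 - 2 = k.+1)%N, (p3 - p2 = k.+1 + j)%N & (p4 - p3 = k.+1)%N].
  by rewrite /p2 /p3 /p4 DE; split; clear; lia.
move: b1 b2 b3 => /andP[b1 c1] /andP[b2 c2] /andP[b3 c3].
have c0 : (2 <= D)%N by apply: ltnW (leq_trans b1 c1).
have sup a b : (2 <= a)%N -> (b <= p4)%N ->
   ~~ ((a < p2 < b) || (a < p3 < b))%N ->
   forall i, (a <= i)%N -> (i.+2 <= b)%N -> Y i + Y i.+2 = (t + t^-1) * Y i.+1.
  move=> a2 b4 ab i ai ib; rewrite -lE; apply: (plain (i := i.+1)).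
    by move: b4 ib; rewrite /p4 DE; clear; lia.
  by move: a2 b4 ab ai ib; rewrite /p2 /p3 /p4; clear; lia.
have [n1 n2 n3] : [/\ ~~ ((2 < p2 < p2) || (2 < p3 < p2))%N,
   ~~ ((p2 < p2 < p3) || (p2 < p3 < p3))%N & ~~ ((p3 < p2 < p4) || (p3 < p3 < p4))%N].
  by move: b2; clear; split; lia.
have [a2 a3 a4] : [/\ (2 <= p2)%N, (2 <= p3)%N & (0 < p3)%N].
  by move: b1 b2; clear; split; lia.
have u1 := sup _ _ (leqnn 2) (ltnW (leq_trans b2 (ltnW b3))) n1.
have u2 := sup _ _ a2 (ltnW b3) n2.
have u3 := sup _ _ a3 (leqnn p4) n3.
have wk a b : (forall i, (a <= i)%N -> (i.+2 <= b)%N -> Y i + Y i.+2 = (t + t^-1) * Y i.+1) ->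
  (forall i, (a <= i)%N -> (i.+2 <= b)%N -> Y i + Y i.+2 <= (t + t^-1) * Y i.+1).
  by move=> h i ai ib; rewrite h.
have v1 := wk _ _ u1; have v2 := wk _ _ u2; have v3 := wk _ _ u3.
have hE1 : hR t Y 2 = de s.
  rewrite -(end_const t1); apply: hR_eq; rewrite ?Y0 //.
  have := Yend (or_introl erefl); rewrite /= {1}(Y1E.1) /end_ratio -lE => h.
  by rewrite mulrBl -h; ring.
have hE4 : hL t Y p4 = de s.
  rewrite -(end_const t1); apply: hL_eq; rewrite ?Y0 //.
  have := Yend (or_intror erefl); rewrite (_ : (D - 2).+1 = D.-1)%N; last by rewrite DE; clear; lia.
  rewrite YrE -/p4 /end_ratio -lE => h.
  by rewrite mulrBl -h; ring.
have hs p : (p <= D)%N -> p = p2 \/ p = p3 -> hL t Y p + hR t Y p = dd s.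
  move=> pD pp; rewrite -(site_const t1); apply: hLR_eq; first exact: Y0.
  by rewrite -lE mulrBl -(Ysite pp) addrK.
have hs2 := hs p2 c1 (or_introl erefl); have hs3 := hs p3 c2 (or_intror erefl).
have de1 := de_lt1 s1; have dd1 := dd_lt1 s1.
have y2 := Y0 c0; have yp2 := Y0 c1; have yp3 := Y0 c2; have yp4 := Y0 c3.
have p20 : (0 < p2)%N by apply: leq_trans a2.
have x1 : 0 < hL t Y p2 by apply: (gap_pos_right t1 b1 y2 yp2 v1); rewrite hE1.
have x3 : 0 < hR t Y p3 by apply: (gap_pos_left t1 a4 b3 yp3 yp4 v3); rewrite hE4.
have r1 : hR t Y p2 < 1 by lra.
have l1 : hL t Y p3 < 1 by lra.
have y1 : 0 < hR t Y p2 by apply: (gap_pos_left t1 p20 b2 yp2 yp3 v2).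
have y3 : 0 < hL t Y p3 by apply: (gap_pos_right t1 b2 yp2 yp3 v2).
have e0 : 0 < eps s.
  have : 0 < dd s by lra.
  by rewrite /dd pmulr_lgt0 // invr_gt0 s2_gt1.
have q1 := gap_prod_eq t1 (isT : (0 < 2)%N) b1 y2 yp2 u1.
have q2 := gap_prod_eq t1 p20 b2 yp2 yp3 u2.
have q3 := gap_prod_eq t1 a4 b3 yp3 yp4 u3.
rewrite g1 hE1 in q1; rewrite g2 in q2; rewrite g3 hE4 in q3.
rewrite -/s in q1 q2 q3; set w := s^-1 ^+ k.+1 in q1 q3 *.
have w0 : 0 < w by rewrite exprn_gt0 // invr_gt0.
have w20 : 0 < s^-1 ^+ (k.+1 + j) by rewrite exprn_gt0 // invr_gt0.
have q3' : w * ((1 - de s) * (1 - hR t Y p3)) = de s * hR t Y p3.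
  by rewrite mulrC [RHS]mulrC -q3; ring.
have k1 := end_gap_eq s1 e0 w0 q1 hs2.
have k3 : hL t Y p3 * KK s w = NN s w.
  by apply: (end_gap_eq s1 e0 w0 q3'); rewrite addrC.
have aE : hL t Y p3 = hR t Y p2.
  by apply: (mulIf (lt0r_neq0 (KK_gt0 s1 e0 w0))); rewrite k1.
have [Q n0] := resonance_NM s1 e0 w0 w20 k1 k3 y1 q2.
split; first by split=> //; rewrite -exprD.
move=> e ee we; rewrite aE in q2.
have xlt : hL t Y p2 < 1 by lra.
apply: (eps_small s1 e0 ee w0 _ w20 _ y1 r1 x1 xlt q1 hs2 q2).
  apply: le_trans we; rewrite /w ler_pXn2r ?nnegrE ?divr_ge0 ?invr_ge0 ?(ltW s0) //.
  rewrite (_ : 5 / 8 = (8 / 5)^-1); last by field.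
  by rewrite lef_pV2 ?posrE ?divr_gt0 // ltW // s_gt.
by rewrite exprD ler_piMr ?(ltW w0) // exprn_ile1 ?invr_ge0 ?(ltW s0) // invf_le1 ?ltW.
Qed.
End StarChain.

(** * Paths with pendant paths *)

(* The encoding of [T], with an arbitrary depth function. *)
Section Comb.
Variables (D : nat) (dep : nat -> nat).

Definition comb_vertex : finType := {v : 'I_D.+1 * 'I_3 | v.2 <= dep v.1}.

Definition cpos (u : comb_vertex) : nat := (val u).1.
Definition clev (u : comb_vertex) : nat := (val u).2.

Definition cstep (p l p' l' : nat) : bool :=
  [&& p' == p.+1, l == 0 & l' == 0] || (p == p') && (l' == l.+1).

Definition cadj : rel comb_vertex := fun u v =>
  cstep (cpos u) (clev u) (cpos v) (clev v) || cstep (cpos v) (clev v) (cpos u) (clev u).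

Lemma cadj_sym : symmetric cadj.
Proof. by move=> u v; rewrite /cadj orbC. Qed.

Lemma cadj_irr : irreflexive cadj.
Proof. by move=> u; rewrite /cadj orbb /cstep !(ltn_eqF (ltnSn _)) andbF. Qed.

Definition comb : sgraph := SGraph cadj_sym cadj_irr.

Lemma cpos_le (u : comb) : cpos u <= D.
Proof. by rewrite -ltnS ltn_ord. Qed.

Lemma clev_le (u : comb) : clev u <= dep (cpos u).
Proof. exact: (valP u). Qed.

Lemma comb_inj (u v : comb) : cpos u = cpos v -> clev u = clev v -> u = v.
Proof.
move=> pE lE; apply: val_inj; move: pE lE; rewrite /cpos /clev.
by case: (val u) (val v) => [p l] [p' l'] /= /val_inj -> /val_inj ->.
Qed.

Definition corigin : comb := exist _ (ord0, ord0) (leq0n (dep 0)).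

(** A total function on pairs of naturals, so that values read [y (cvx D dep p l)]; its result is
    meaningful in the range given by [cvxP]. *)
Definition cvx (p l : nat) : comb := insubd corigin (inord p, inord l).

Hypothesis dep_le : forall p, p <= D -> dep p <= 2.

Lemma cvxP p l : p <= D -> l <= dep p -> cpos (cvx p l) = p /\ clev (cvx p l) = l.
Proof.
move=> pD ld; have l3 : l < 3 by apply: leq_ltn_trans ld _; rewrite ltnS dep_le.
rewrite /cpos /clev /cvx val_insubd /= !inordK // ld /=.
by rewrite !inordK.
Qed.

Lemma cvxK (u : comb) : cvx (cpos u) (clev u) = u.
Proof.
have [pE lE] := cvxP (cpos_le u) (clev_le u).
exact: comb_inj.
Qed.

Lemma cadjE (u v : comb) : adj u v =
  cstep (cpos u) (clev u) (cpos v) (clev v) || cstep (cpos v) (clev v) (cpos u) (clev u).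
Proof. by []. Qed.

Lemma card_comb : #|comb| = D.+1 + \sum_(p < D.+1) dep p.
Proof.
rewrite card_sig -sum1_card (eq_bigl (fun v : 'I_D.+1 * 'I_3 => xpredT v.1 && (v.2 <= dep v.1))) //.
rewrite -(pair_big_dep xpredT (fun (p : 'I_D.+1) (l : 'I_3) => l <= dep p) (fun _ _ => 1)) /=.
rewrite -[X in X + _](card_ord D.+1) -sum1_card -big_split /=; apply: eq_bigr => p _.
have := dep_le (ltn_ord p : p <= D).
by rewrite big_mkcond !big_ord_recl big_ord0 /=; case: (dep p) => [|[|[|?]]].
Qed.

Lemma comb_walk_level p l : p <= D -> l <= dep p -> has_walk l (cvx p l) (cvx p 0).
Proof.
move=> pD; elim: l => [_|l IH ld]; first exact: has_walk0.
rewrite -add1n; apply: has_walk_cat (IH (ltnW ld)); apply: has_walk1.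
rewrite cadjE; have [-> ->] := cvxP pD ld; have [-> ->] := cvxP pD (ltnW ld).
by rewrite /cstep !eqxx /= !orbT.
Qed.

Lemma comb_walk_path p p' : p <= p' <= D -> has_walk (p' - p) (cvx p 0) (cvx p' 0).
Proof.
case/andP; elim: p' => [|q IH]; first by rewrite leqn0 => /eqP -> _; apply: has_walk0.
rewrite leq_eqVlt => /orP[/eqP -> _|pq qD]; first by rewrite subnn; apply: has_walk0.
rewrite subSn // -addn1; apply: has_walk_cat (IH pq (ltnW qD)) _; apply: has_walk1.
rewrite cadjE; have [-> ->] := cvxP (ltnW qD) (leq0n _); have [-> ->] := cvxP qD (leq0n _).
by rewrite /cstep !eqxx.
Qed.

Lemma comb_walk (u v : comb) : cpos u <= cpos v ->
  has_walk (clev u + (cpos v - cpos u) + clev v) u v.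
Proof.
move=> uv; rewrite -{3}(cvxK u) -{3}(cvxK v).
apply: has_walk_cat; last first.
  by apply: has_walk_sym; apply: comb_walk_level; [apply: cpos_le|apply: clev_le].
apply: has_walk_cat (comb_walk_level (cpos_le u) (clev_le u)) _.
by apply: comb_walk_path; rewrite uv cpos_le.
Qed.

Lemma comb_connected : connected_graph comb.
Proof.
have C (u v : comb) : exists d, has_walk d u v.
  have [/comb_walk h|/ltnW /comb_walk h] := leqP (cpos u) (cpos v); first by eexists; exact: h.
  by eexists; exact: has_walk_sym h.
move=> u v; have [d /has_walkP[p [_ pp pv]]] := C u v.
by apply/connectP; exists p.
Qed.

Hypothesis dep_left : forall p, p <= D -> dep p <= p.
Hypothesis dep_right : forall p, p <= D -> dep p <= D - p.

(** [dep_left] and [dep_right] make each pendant path no longer than the stretch of main path beyond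
    it, so no walk between two tips has to exceed [D]. *)
Lemma comb_diameter : diameter comb = D.
Proof.
have Gc := comb_connected.
apply/eqP; rewrite eqn_leq; apply/andP; split.
  apply/bigmax_leqP => u _; apply/bigmax_leqP => v _.
  wlog uv : u v / cpos u <= cpos v.
    move=> H; have [/H//|/ltnW /H] := leqP (cpos u) (cpos v).
    by rewrite dist_sym.
  apply: leq_trans (dist_le (comb_walk uv)) _.
  have := leq_trans (clev_le u) (dep_left (cpos_le u)).
  have := leq_trans (clev_le v) (dep_right (cpos_le v)).
  by have := cpos_le v; move: uv; clear; lia.
apply: leq_trans (dist_le_diameter (cvx 0 0) (cvx D 0)).
have [p0 _] := cvxP (leq0n D) (leq0n _); have [pD _] := cvxP (leqnn D) (leq0n _).
(* The position changes by at most 1 along an edge, so the two ends of the main path are at distance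
   at least [D]. *)
have lip d (u v : comb) : has_walk d u v -> cpos v <= cpos u + d.
  elim: d u => [|d IH] u.
    by move=> /has_walkP[[|a p] [//= _ _ <-]]; rewrite addn0.
  move=> /has_walkS[z uz /IH h]; apply: leq_trans h _.
  by move: uz; rewrite cadjE /cstep; clear; lia.
by have := lip _ _ _ (walk_dist Gc (cvx 0 0) (cvx D 0)); rewrite p0 pD add0n.
Qed.

Lemma comb_conn_order_diam :
  conn_order_diam (D.+1 + \sum_(p < D.+1) dep p) D comb.
Proof. by split; [apply: comb_connected|apply: card_comb|apply: comb_diameter]. Qed.

End Comb.

(** The two graphs are convertible, so the identity is an isomorphism. *)
Lemma comb_T (k : seq nat) : isomorphic (comb (size k + 4 + sumn k) (depth k)) (T k).
Proof. by exists id; split=> //; exists id. Qed.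

Lemma comb_eq_dep D dep dep' : (forall p, p <= D -> dep p = dep' p) ->
  isomorphic (comb D dep) (comb D dep').
Proof.
move=> dd; have h (v : 'I_D.+1 * 'I_3) : (v.2 <= dep v.1) = (v.2 <= dep' v.1).
  by rewrite dd // -ltnS.
pose f (u : comb D dep) : comb D dep' := Sub (val u) (etrans (esym (h _)) (valP u)).
pose g (u : comb D dep') : comb D dep := Sub (val u) (etrans (h _) (valP u)).
by exists f; split=> //; exists g => u; apply: val_inj; rewrite !SubK.
Qed.

(** * Eigenvalue equations along a comb *)

Section CombChain.
Import Order.TTheory GRing.Theory Num.Theory.
Local Open Scope ring_scope.

Lemma sum_nbrs (R : nmodType) (G : sgraph) (y : G -> R) (x : G) (s : seq G) :
  uniq s -> (forall u, adj x u = (u \in s)) ->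
  \sum_(u | adj x u) y u = \sum_(u <- s) y u.
Proof. by move=> us h; rewrite big_uniq //; apply: eq_bigl => u; rewrite h. Qed.

Variables (R : realFieldType) (D : nat) (dep : nat -> nat).
Hypothesis dep_le : forall p, (p <= D)%N -> (dep p <= 2)%N.

Lemma cvx_eq p l (u : comb D dep) : (p <= D)%N -> (l <= dep p)%N ->
  (u == cvx D dep p l) = (cpos u == p) && (clev u == l).
Proof.
move=> pD ld; have [pE lE] := cvxP dep_le pD ld.
apply/eqP/andP => [->|[/eqP up /eqP ul]]; first by rewrite pE lE !eqxx.
by apply: comb_inj; rewrite ?pE ?lE.
Qed.

Variables (y : comb D dep -> R) (lam : R).
Hypothesis y0 : forall u, 0 < y u.
Hypothesis yE : forall u, \sum_(v | adj u v) y v = lam * y u.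
Let Y p := y (cvx D dep p 0).

Let dep_u (u : comb D dep) p n : dep p = n -> cpos u = p -> (clev u <= n)%N.
Proof. by move=> <- <-; apply: clev_le. Qed.

Lemma comb_eq_plain p : (0 < p < D)%N -> dep p = 0%N -> Y p.-1 + Y p.+1 = lam * Y p.
Proof.
move=> /andP[p0 pD] d0; have pD' := ltnW pD.
have pm : (p.-1 <= D)%N by apply: leq_trans (leq_pred p) pD'.
rewrite -yE (@sum_nbrs _ _ _ _ [:: cvx D dep p.-1 0; cvx D dep p.+1 0]).
- by rewrite !big_cons big_nil addr0.
- rewrite /= inE cvx_eq // andbT; have [-> _] := cvxP dep_le pm (leq0n _).
  by clear -p0; lia.
move=> u; rewrite !inE !cvx_eq // cadjE /cstep.
have [-> ->] := cvxP dep_le pD' (leq0n _).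
by have := dep_u (u := u) d0; clear -p0; lia.
Qed.

Lemma comb_eq_pendant p : (0 < p < D)%N -> (0 < dep p)%N ->
  Y p.-1 + Y p.+1 + y (cvx D dep p 1) = lam * Y p.
Proof.
move=> /andP[p0 pD] d0; have pD' := ltnW pD.
have pm : (p.-1 <= D)%N by apply: leq_trans (leq_pred p) pD'.
rewrite -yE (@sum_nbrs _ _ _ _ [:: cvx D dep p.-1 0; cvx D dep p.+1 0; cvx D dep p 1]).
- by rewrite !big_cons big_nil addr0 addrA.
- rewrite /= !inE !cvx_eq // andbT; have [-> ->] := cvxP dep_le pm (leq0n _).
  by have [-> ->] := cvxP dep_le pD (leq0n _); clear -p0; lia.
move=> u; rewrite !inE !cvx_eq // cadjE /cstep.
have [-> ->] := cvxP dep_le pD' (leq0n _).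
by clear -p0; lia.
Qed.

Lemma comb_eq_first : (0 < D)%N -> dep 0 = 0%N -> Y 1 = lam * Y 0.
Proof.
move=> D0 d0; rewrite -yE (@sum_nbrs _ _ _ _ [:: cvx D dep 1 0]) //.
- by rewrite big_cons big_nil addr0.
move=> u; rewrite !inE !cvx_eq // cadjE /cstep.
have [-> ->] := cvxP dep_le (leq0n D) (leq0n _).
by have := dep_u (u := u) d0; clear; lia.
Qed.

Lemma comb_eq_last : (0 < D)%N -> dep D = 0%N -> Y D.-1 = lam * Y D.
Proof.
move=> D0 d0; rewrite -yE (@sum_nbrs _ _ _ _ [:: cvx D dep D.-1 0]) //.
- by rewrite big_cons big_nil addr0.
move=> u; rewrite !inE !cvx_eq ?leq_pred // cadjE /cstep.
have [-> ->] := cvxP dep_le (leqnn D) (leq0n _).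
by have := dep_u (u := u) d0; have := cpos_le u; clear -D0; lia.
Qed.

Lemma comb_eq_leaf p : (p <= D)%N -> (0 < dep p)%N ->
  y (cvx D dep p (dep p).-1) = lam * y (cvx D dep p (dep p)).
Proof.
move=> pD d0; have dm : ((dep p).-1 <= dep p)%N by apply: leq_pred.
rewrite -yE (@sum_nbrs _ _ _ _ [:: cvx D dep p (dep p).-1]) //.
- by rewrite big_cons big_nil addr0.
move=> u; rewrite !inE !cvx_eq // cadjE /cstep.
have [-> ->] := cvxP dep_le pD (leqnn _).
by have := dep_u (u := u) (erefl (dep p)); clear -d0; lia.
Qed.

Lemma comb_eq_middle p : (p <= D)%N -> dep p = 2%N ->
  Y p + y (cvx D dep p 2) = lam * y (cvx D dep p 1).
Proof.
move=> pD d2; have [l0 l1 l2] : [/\ 0 <= dep p, 1 <= dep p & 2 <= dep p]%N by rewrite d2.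
rewrite -yE (@sum_nbrs _ _ _ _ [:: cvx D dep p 0; cvx D dep p 2]).
- by rewrite !big_cons big_nil addr0.
- rewrite /= inE cvx_eq // andbT; have [-> ->] := cvxP dep_le pD (leq0n _).
  by rewrite andbF.
move=> u; rewrite !inE !cvx_eq // cadjE /cstep.
have [-> ->] := cvxP dep_le pD l1.
by have := dep_u (u := u) d2; clear; lia.
Qed.

Lemma comb_lam_gt0 : (0 < D)%N -> dep 0 = 0%N -> 0 < lam.
Proof.
by move=> D0 d0; rewrite -(pmulr_lgt0 _ (y0 (cvx D dep 0 0))) -comb_eq_first // y0.
Qed.

Lemma comb_eq_site p : (0 < p < D)%N -> dep p = 1%N -> lam != 0 ->
  Y p.-1 + Y p.+1 + lam^-1 * Y p = lam * Y p.
Proof.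
move=> pD d1 l0; rewrite -(comb_eq_pendant pD) ?d1 //; congr (_ + _).
have /andP[_ /ltnW pD'] := pD.
by have := comb_eq_leaf pD'; rewrite d1 /= => /(_ isT) e; rewrite /Y e mulKf.
Qed.

Lemma comb_eq_end p : (0 < p < D)%N -> dep p = 2%N ->
  Y p.-1 + Y p.+1 + lam / (lam ^+ 2 - 1) * Y p = lam * Y p.
Proof.
move=> pD d2; rewrite -(comb_eq_pendant pD) ?d2 //; congr (_ + _).
have /andP[_ /ltnW pD'] := pD.
have := comb_eq_leaf pD'; have := comb_eq_middle pD' d2; rewrite d2 /= => h1 /(_ isT) h2.
have h : Y p = (lam ^+ 2 - 1) * y (cvx D dep p 2).
  by move: h1; rewrite h2 expr2; lra.
have l1 : lam ^+ 2 - 1 != 0.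
  by apply/eqP => l; have := y0 (cvx D dep p 0); rewrite -/(Y p) h l mul0r ltxx.
by rewrite h mulrA divfK // h2.
Qed.

End CombChain.

(** * Local structure *)

(* Every spectral radius involved is below 103/50 = 2.06; a path of [n] further vertices hanging
   at [x] then forces the ratio of the neighbour to [x] to be at least [b n], where
   [b (n + 1) = 1 / (2.06 - b n)]. The constants below are these numbers rounded down. *)
Section Arms.
Import Order.TTheory GRing.Theory Num.Theory.
Local Open Scope ring_scope.
Variables (R : realFieldType) (D : nat) (Z : nat -> R).
Hypothesis Z0 : forall i, (i <= D)%N -> 0 < Z i.
Hypothesis Zl : Z 1 <= 103 / 50 * Z 0.
Hypothesis Zsup : forall i, (i.+2 <= D)%N -> Z i + Z i.+2 <= 103 / 50 * Z i.+1.

Let arm_step a b n : 0 < b -> b * (103 / 50 - a) <= 1 ->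
  (forall i, (n < i <= D)%N -> a * Z i <= Z i.-1) ->
  forall i, (n.+1 < i <= D)%N -> b * Z i <= Z i.-1.
Proof.
move=> b0 ab h [|[|i]] // /andP[ni iD].
have := h i.+1; rewrite -ltnS ni ltnW // => /(_ isT) /= hi.
have zi := Z0 (ltnW iD); have := Zsup iD => hs.
apply: le_trans (_ : b * ((103 / 50 - a) * Z i.+1) <= _).
  by rewrite ler_pM2l //; lra.
by rewrite mulrA ler_piMl // ltW.
Qed.

Lemma arm1 i : (0 < i <= D)%N -> 97 / 200 * Z i <= Z i.-1.
Proof.
case: i => [|[|i]] // /andP[_ iD] /=.
  by have := Z0 (leq0n D); have := Zl; lra.
by have := Zsup iD; have := Z0 (ltnW iD); have := Z0 (ltnW (ltnW iD)); lra.
Qed.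

Lemma arm2 i : (1 < i <= D)%N -> 634 / 1000 * Z i <= Z i.-1.
Proof. by apply: (@arm_step (97 / 200) _ 0 _ _ arm1); lra. Qed.

Lemma arm3 i : (2 < i <= D)%N -> 701 / 1000 * Z i <= Z i.-1.
Proof. by apply: (@arm_step (634 / 1000) _ 1 _ _ arm2); lra. Qed.

Lemma arm7 i : (6 < i <= D)%N -> 77 / 100 * Z i <= Z i.-1.
Proof.
have arm4 : forall i, (3 < i <= D)%N -> 735 / 1000 * Z i <= Z i.-1.
  by apply: (@arm_step (701 / 1000) _ 2 _ _ arm3); lra.
have arm5 : forall i, (4 < i <= D)%N -> 754 / 1000 * Z i <= Z i.-1.
  by apply: (@arm_step (735 / 1000) _ 3 _ _ arm4); lra.
have arm6 : forall i, (5 < i <= D)%N -> 765 / 1000 * Z i <= Z i.-1.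
  by apply: (@arm_step (754 / 1000) _ 4 _ _ arm5); lra.
by apply: (@arm_step (765 / 1000) _ 5 _ _ arm6); lra.
Qed.
End Arms.

Lemma sum_nbrs_le (R : realFieldType) (G : sgraph) (y : G -> R) (x : G) (s : seq G) :
  (forall u, 0 < y u)%R -> uniq s -> all (adj x) s ->
  (\sum_(u <- s) y u <= \sum_(u | adj x u) y u)%R.
Proof.
move=> y0 us /allP sx; rewrite big_uniq //.
rewrite [leRHS](bigID (mem s)) /= [X in (X + _)%R](eq_bigl (mem s)) => [|u].
  by rewrite Num.Theory.lerDl; apply: Num.Theory.sumr_ge0 => u _; apply: Order.POrderTheory.ltW.
by rewrite andb_idl //; apply: sx.
Qed.

(** * Neighbour inequalities for a superharmonic vector *)

Section Superharmonic.
Import Order.TTheory GRing.Theory Num.Theory.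
Local Open Scope ring_scope.
Variables (R : realFieldType) (G : sgraph) (y : G -> R) (c : R).
Hypothesis y0 : forall x, 0 < y x.
Hypothesis ysup : forall x, \sum_(u | adj x u) y u <= c * y x.

Let nbrs_le (x : G) (s : seq G) : uniq s -> all (adj x) s -> \sum_(u <- s) y u <= c * y x.
Proof. by move=> us xs; apply: le_trans (ysup x); apply: sum_nbrs_le. Qed.

Lemma nbr1 x a : adj x a -> y a <= c * y x.
Proof. by move=> xa; have := @nbrs_le x [:: a]; rewrite /= big_seq1 xa; apply. Qed.

Lemma nbr2 x a b : a != b -> adj x a -> adj x b -> y a + y b <= c * y x.
Proof.
move=> ab xa xb; have := @nbrs_le x [:: a; b].
by rewrite /= big_cons big_seq1 xa xb !inE ab; apply.
Qed.

Lemma nbr3 x a b d : uniq [:: a; b; d] -> adj x a -> adj x b -> adj x d ->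
  y a + y b + y d <= c * y x.
Proof.
move=> u xa xb xd; have := @nbrs_le x [:: a; b; d] u.
by rewrite /= !big_cons big_nil addr0 xa xb xd addrA; apply.
Qed.

Lemma nbr4 x a b d f : uniq [:: a; b; d; f] ->
  adj x a -> adj x b -> adj x d -> adj x f -> y a + y b + y d + y f <= c * y x.
Proof.
move=> u xa xb xd xf; have := @nbrs_le x [:: a; b; d; f] u.
by rewrite /= !big_cons big_nil addr0 xa xb xd xf !addrA; apply.
Qed.

End Superharmonic.

(** * Numerical restrictions on what hangs at a geodesic *)

Section Local.
Import Order.TTheory GRing.Theory Num.Theory.
Variables (R : realFieldType) (G : sgraph) (y : G -> R) (D : nat).
Hypothesis y0 : forall x, (0 < y x)%R.
Hypothesis ysup : forall x, (\sum_(u | adj x u) y u <= 103 / 50 * y x)%R.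
Hypothesis D20 : 20 <= D.
Hypothesis Gc : connected_graph G.

Let nb1 := nbr1 y0 ysup.
Let nb2 := nbr2 y0 ysup.
Let nb3 := nbr3 y0 ysup.
Let nb4 := nbr4 y0 ysup.

Definition ext (v : nat -> G) (x : G) : bool := x \notin [seq v i | i <- iota 0 D.+1].

Lemma extP v x : reflect (forall i, i <= D -> x <> v i) (ext v x).
Proof.
apply: (iffP idP) => [/mapP h i iD xi|h].
  by apply: h; exists i; rewrite // mem_iota add0n ltnS.
by apply/mapP => -[i]; rewrite mem_iota add0n ltnS => iD /(h i iD).
Qed.

Lemma extPn v x : ~~ ext v x -> exists2 i, i <= D & x = v i.
Proof.
by rewrite negbK => /mapP[i]; rewrite mem_iota add0n ltnS => iD ->; exists i.
Qed.

(* The vertices hanging at positions 2, ..., D - 2; the positions next to the ends need the diameter. *)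
Definition good (v : nat -> G) (x : G) : Prop := ext v x /\
  exists i, 2 <= i <= D - 2 /\
    (adj (v i) x \/ exists u, [/\ ext v u, adj (v i) u & adj u x]).

Section Path.
Variable v : nat -> G.
Hypothesis gv : geodesic D v.

Let vadj i : i < D -> adj (v i) (v i.+1) := @proj1 _ _ gv i.
Let vadj' i : 0 < i <= D -> adj (v i) (v i.-1) := @geodesic_adj_pred _ _ _ i gv.
Let vneq i : 0 < i < D -> v i.-1 != v i.+1 := @geodesic_neq _ _ _ i gv.

Lemma path_sup : [/\ (forall i, (i <= D)%N -> 0 < y (v i))%R,
  (y (v 1) <= 103 / 50 * y (v 0))%R &
  (forall i, (i.+2 <= D)%N -> y (v i) + y (v i.+2) <= 103 / 50 * y (v i.+1))%R].
Proof.
split=> [i _||i iD]; first exact: y0.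
  by apply: nb1; apply: vadj; apply: leq_trans D20.
apply: nb2; first by apply: (@vneq i.+1).
  by apply: (@vadj' i.+1); rewrite /= ltnW.
exact: vadj.
Qed.

Lemma left_arm : [/\ forall i, 0 < i <= D -> (97 / 200 * y (v i) <= y (v i.-1))%R,
  forall i, 1 < i <= D -> (634 / 1000 * y (v i) <= y (v i.-1))%R,
  forall i, 2 < i <= D -> (701 / 1000 * y (v i) <= y (v i.-1))%R &
  forall i, 6 < i <= D -> (77 / 100 * y (v i) <= y (v i.-1))%R].
Proof.
have [h0 h1 h2] := path_sup; split=> i.
- exact: (@arm1 R D (y \o v)).
- exact: (@arm2 R D (y \o v)).
- exact: (@arm3 R D (y \o v)).
- exact: (@arm7 R D (y \o v)).
Qed.

End Path.

Section Rules.
Variable v : nat -> G.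
Hypothesis gv : geodesic D v.

Let vr i := v (D - i).
Let gr : geodesic D vr. Proof. exact: geodesic_rev. Qed.

Lemma right_arm : [/\ forall i, i < D -> (97 / 200 * y (v i) <= y (v i.+1))%R,
  forall i, i < D - 1 -> (634 / 1000 * y (v i) <= y (v i.+1))%R,
  forall i, i < D - 2 -> (701 / 1000 * y (v i) <= y (v i.+1))%R &
  forall i, i < D - 6 -> (77 / 100 * y (v i) <= y (v i.+1))%R].
Proof.
have [a1 a2 a3 a7] := left_arm gr.
have e n i : i < D - n -> [/\ n < D - i <= D, vr (D - i) = v i & vr (D - i).-1 = v i.+1].
  rewrite /vr; clear => h; have -> : D - (D - i) = i by lia.
  have -> : D - (D - i).-1 = i.+1 by lia.
  by split=> //; lia.
split=> i.
- by rewrite -{1}(subn0 D) => /e[h <- <-]; apply: a1.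
- by move=> /e[h <- <-]; apply: a2.
- by move=> /e[h <- <-]; apply: a3.
- by move=> /e[h <- <-]; apply: a7.
Qed.

(** As [D >= 20], at least one side of each position is long enough for the ratio 77/100. The other
    side contributes 97/200 here, and 634/1000 or 701/1000 further in ([beta2], [beta3]). *)
Lemma beta1 i : 0 < i < D -> (1255 / 1000 * y (v i) <= y (v i.-1) + y (v i.+1))%R.
Proof.
have [l1 _ _ l7] := left_arm gv; have [r1 _ _ r7] := right_arm.
move=> /andP[i0 iD]; have [i7|i7] := ltnP 6 i.
  have := l7 i; rewrite i7 ltnW // => /(_ isT); have := r1 i iD; lra.
have := l1 i; rewrite i0 ltnW // => /(_ isT).
have : i < D - 6 by clear -i7 D20; lia.
move=> /r7; lra.
Qed.

Lemma beta2 i : 2 <= i <= D - 2 -> (1404 / 1000 * y (v i) <= y (v i.-1) + y (v i.+1))%R.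
Proof.
have [_ l2 _ l7] := left_arm gv; have [_ r2 _ r7] := right_arm.
move=> /andP[i0 iD]; have iD' : i <= D by apply: leq_trans iD (leq_subr _ _).
have iD2 : i < D - 1 by clear -D20 iD; lia.
have [i7|i7] := ltnP 6 i.
  have := l7 i; rewrite i7 iD' => /(_ isT); have := r2 i iD2; lra.
have := l2 i; rewrite i0 iD' => /(_ isT).
have : i < D - 6 by clear -i7 D20; lia.
move=> /r7; lra.
Qed.

Lemma beta3 i : 3 <= i <= D - 3 -> (1471 / 1000 * y (v i) <= y (v i.-1) + y (v i.+1))%R.
Proof.
have [_ _ l3 l7] := left_arm gv; have [_ _ r3 r7] := right_arm.
move=> /andP[i0 iD]; have iD' : i <= D by apply: leq_trans iD (leq_subr _ _).
have iD2 : i < D - 2 by clear -D20 iD; lia.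
have [i7|i7] := ltnP 6 i.
  have := l7 i; rewrite i7 iD' => /(_ isT); have := r3 i iD2; lra.
have := l3 i; rewrite i0 iD' => /(_ isT).
have : i < D - 6 by clear -i7 D20; lia.
move=> /r7; lra.
Qed.

Let vinj i k : i <= D -> k <= D -> v i = v k -> i = k := @geodesic_inj G D v i k gv.
Let vadj i : i < D -> adj (v i) (v i.+1) := @proj1 _ _ gv i.
Let vadj' i : 0 < i <= D -> adj (v i) (v i.-1) := @geodesic_adj_pred _ _ _ i gv.
Let vneq i : 0 < i < D -> v i.-1 != v i.+1 := @geodesic_neq _ _ _ i gv.

Let leaf_le x a : adj x a -> (97 / 200 * y a <= y x)%R.
Proof. by move=> /nb1; have := y0 x; lra. Qed.

Let ext_neq i x : i <= D -> ext v x -> v i != x.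
Proof. by move=> iD /extP/(_ i iD)/eqP; rewrite eq_sym. Qed.

Let slack i x : 0 < i < D -> ext v x -> adj (v i) x ->
  (y (v i.-1) + y (v i.+1) + y x <= 103 / 50 * y (v i))%R.
Proof.
move=> /andP[i0 iD] ex vx; apply: nb3 => //; last 2 first.
- by apply: vadj'; rewrite i0 ltnW.
- exact: vadj.
rewrite /= !inE negb_or vneq ?i0 // !ext_neq //.
exact: leq_trans (leq_pred _) (ltnW iD).
Qed.

(** Two external neighbours would bring the sum at [v i] to 1.255 + 2 * 0.485, above 2.06. *)
Lemma ext_unique i x x' : 0 < i < D -> ext v x -> ext v x' ->
  adj (v i) x -> adj (v i) x' -> x = x'.
Proof.
move=> iD ex ex' vx vx'; apply/eqP; apply/idPn => ne; have /andP[i0 iD'] := iD.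
have : (y (v i.-1) + y (v i.+1) + y x + y x' <= 103 / 50 * y (v i))%R.
  apply: nb4 => //; last 2 first.
  - by apply: vadj'; rewrite i0 ltnW.
  - exact: vadj.
  have im : i.-1 <= D := leq_trans (leq_pred _) (ltnW iD').
  by rewrite /= !inE !negb_or vneq ?i0 // !ext_neq // ne.
have := beta1 iD; have := leaf_le (etrans (adj_sym _ _) vx).
by have := leaf_le (etrans (adj_sym _ _) vx'); have := y0 (v i); lra.
Qed.

(** By [beta2] the value at [x] is at most 0.656 times that at [v i]; two further neighbours of [x]
    would force more than 0.9. *)
Lemma second_unique i x z z' : 2 <= i <= D - 2 -> ext v x -> adj (v i) x ->
  adj x z -> adj x z' -> z != v i -> z' != v i -> z = z'.
Proof.
move=> iD ex vx xz xz' zi zi'; apply/eqP; apply/idPn => ne.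
have iD' : 0 < i < D by clear -iD D20; lia.
have : (y (v i) + y z + y z' <= 103 / 50 * y x)%R.
  by apply: nb3; rewrite /= ?inE ?negb_or ?ne // 1?eq_sym ?zi 1?eq_sym ?zi' // adj_sym.
have := slack iD' ex vx; have := beta2 iD; have := leaf_le (etrans (adj_sym _ _) xz).
by have := leaf_le (etrans (adj_sym _ _) xz'); have := y0 (v i); lra.
Qed.

(** A further neighbour would make the ratio of [x] to [v i] about 0.70, above 0.656. As [z'] ranges
    over all vertices, this excludes cycles through [z] as well as longer paths. *)
Lemma second_leaf i x z z' : 2 <= i <= D - 2 -> ext v x -> adj (v i) x ->
  adj x z -> z != v i -> adj z z' -> z' = x.
Proof.
move=> iD ex vx xz zi zz'; apply/eqP; apply/idPn => ne.
have iD' : 0 < i < D by clear -iD D20; lia.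
have : (y (v i) + y z <= 103 / 50 * y x)%R.
  by apply: nb2 => //; rewrite 1?eq_sym // adj_sym.
have : (y x + y z' <= 103 / 50 * y z)%R.
  by apply: nb2 => //; rewrite 1?eq_sym // adj_sym.
have := slack iD' ex vx; have := beta2 iD; have := leaf_le (etrans (adj_sym _ _) zz').
by have := y0 (v i); lra.
Qed.

(** If [z] were on the geodesic, a geodesic neighbour of it would have to equal the external vertex
    [x] by [second_leaf]. *)
Lemma second_ext i x z : 2 <= i <= D - 2 -> ext v x -> adj (v i) x ->
  adj x z -> z != v i -> ext v z.
Proof.
move=> iD ex vx xz zi; case: (boolP (ext v z)) => // /extPn[k kD zk]; exfalso.
have h m : m <= D -> adj z (v m) -> False.
  move=> mD zm; have := second_leaf iD ex vx xz zi zm => /eqP.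
  by apply/negP; apply: ext_neq.
have [k0|k0] := posnP k.
  apply: (h 1); first by apply: leq_trans D20.
  by rewrite zk k0 vadj //; apply: leq_trans D20.
by apply: (h k.-1); [apply: leq_trans (leq_pred _) kD|rewrite zk vadj' // k0].
Qed.

(** At the inner positions [beta3] leaves [x] a ratio of at most 0.589, while a second vertex forces
    about 0.634. *)
Lemma second_end i x z : 2 <= i <= D - 2 -> ext v x -> adj (v i) x ->
  adj x z -> z != v i -> i = 2 \/ i = D - 2.
Proof.
move=> iD ex vx xz zi; case: (boolP (3 <= i <= D - 3)) => i3; last first.
  by clear -iD i3 D20; lia.
exfalso; have iD' : 0 < i < D by clear -iD D20; lia.
have : (y (v i) + y z <= 103 / 50 * y x)%R.
  by apply: nb2 => //; rewrite 1?eq_sym // adj_sym.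
have := slack iD' ex vx; have := beta3 i3; have := leaf_le (etrans (adj_sym _ _) xz).
by have := y0 (v i); lra.
Qed.

(** Adding the inequalities at [v 0] and [x], their values total more than 1.88 times that at [v 1],
    which exceeds 2.06 once [v 2] contributes 0.77. *)
Lemma no_triangle x : ext v x -> adj (v 1) x -> adj (v 0) x -> False.
Proof.
move=> ex v1x v0x; have D1 : 0 < 1 < D by apply: leq_trans D20.
have [_ _ _ r7] := right_arm.
have := slack D1 ex v1x.
have : 1 < D - 6 by clear -D20; lia.
move=> /r7 /=; have v01 : adj (v 0) (v 1) by apply: vadj; apply: leq_trans D20.
have := nb2 (ext_neq (ltnW (leq_trans (isT : 2 <= 20) D20)) ex) v01 v0x.
have v10 : adj x (v 1) by rewrite adj_sym.
have x0 : adj x (v 0) by rewrite adj_sym.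
have n10 : v 1 != v 0 by apply/eqP => /vinj; clear -D20; lia.
by have := nb2 n10 v10 x0; have := y0 (v 1); lra.
Qed.

Lemma good_adj x z : good v x -> adj x z -> ext v z -> good v z.
Proof.
move=> [ex [i [iD H]]] xz ez; case: H => [vx|[u [eu vu ux]]].
  by split=> //; exists i; split=> //; right; exists x.
suff -> : z = u by split=> //; exists i; split=> //; left.
apply: (second_leaf iD eu vu ux _ xz).
by rewrite eq_sym ext_neq //; case/andP: iD => _ /leq_trans; apply; apply: leq_subr.
Qed.

Lemma good_path x j : good v x -> j <= D -> adj x (v j) -> 2 <= j <= D - 2.
Proof.
move=> [ex [i [iD H]]] jD xj.
have iD' : i <= D by case/andP: iD => _ /leq_trans; apply; apply: leq_subr.
case: H => [vx|[u [eu vu ux]]].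
  have [/vinj -> //|ne] := eqVneq (v j) (v i).
  by have := second_ext iD ex vx xj ne => /extP /(_ j jD).
have xi : x != v i by rewrite eq_sym ext_neq.
have := second_leaf iD eu vu ux xi xj => /eqP; rewrite (negbTE (ext_neq jD eu)) //.
Qed.

End Rules.
End Local.

(** * Vertices off the geodesic, through distances and the diameter *)

Section Structure.
Import Order.TTheory GRing.Theory Num.Theory.
Variables (R : realFieldType) (G : sgraph) (y : G -> R) (D : nat).
Hypothesis y0 : forall x, (0 < y x)%R.
Hypothesis ysup : forall x, (\sum_(u | adj x u) y u <= 103 / 50 * y x)%R.
Hypothesis D20 : 20 <= D.
Hypothesis Gc : connected_graph G.
Hypothesis GD : diameter G = D.
Hypothesis Gn : #|G| = D + 7.

Local Notation ext := (ext D).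
Local Notation good := (good D).

Lemma good_rev (v : nat -> G) x : good (fun i => v (D - i)) x -> good v x.
Proof.
have er u : ext (fun i => v (D - i)) u -> ext v u.
  move=> /extP h; apply/extP => i iD; have := h (D - i) (leq_subr _ _).
  by rewrite subKn.
move=> [ex [i [iD H]]]; split; first exact: er.
exists (D - i); split; first by clear -iD; lia.
case: H => [|[u [eu vu ux]]]; [by left|right].
by exists u; split=> //; apply: er.
Qed.

(** Follow a shortest path towards [v D]: it leaves [W] only by entering the geodesic. Entering at
    position 0 would exceed the diameter and entering at position 1 attains it, whence the second
    alternative; later entries make all earlier vertices good. *)
Lemma entry (v : nat -> G) (W : pred G) : geodesic D v ->
  (forall x, W x -> ext v x /\ exists z, [/\ adj x z, (dist z (v D)).+1 = dist x (v D) &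
     W z \/ exists2 i, i <= D - 2 & z = v i]) ->
  forall x, W x -> good v x \/ (adj (v 1) x /\ dist x (v D) = D).
Proof.
move=> gv hW x; have [n] := ubnP (dist x (v D)); elim: n x => // n IH x xn Wx.
have [ex [z [xz zd H]]] := hW x Wx.
have xD : dist x (v D) <= D by rewrite -GD dist_le_diameter.
case: H => [Wz|[i iD zi]].
  have [gz|[_ zD]] := IH z (leq_trans (eq_leq zd) xn) Wz; last by rewrite -zd zD ltnn in xD.
  by left; apply: (good_adj y0 ysup D20 Gc gv gz) ex; rewrite adj_sym.
have iD' : i <= D := leq_trans iD (leq_subr _ _).
have zx : adj (v i) x by rewrite adj_sym -zi.
rewrite zi gv.2 // in zd.
have [i2|i2] := leqP 2 i; first by left; split=> //; exists i; split; [rewrite i2|left].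
have i1 : i = 1 by clear -zd xD i2 iD'; lia.
by right; rewrite i1 in zx zd; split=> //; rewrite -zd; clear -D20; lia.
Qed.

Section Classify.
Variable v : nat -> G.
Hypothesis gv : geodesic D v.

Let vinj i k : i <= D -> k <= D -> v i = v k -> i = k := @geodesic_inj G D v i k gv.

(* Only six vertices lie off the geodesic, so one of seven consecutive distance levels from its end
   contains no other vertex: every shortest path across it enters the geodesic there. *)
Lemma clean_level : exists2 c, 2 <= c <= 8 & forall x, ext v x -> dist x (v D) <> D - c.
Proof.
set Pv := [seq v i | i <- iota 0 D.+1].
have uP : uniq Pv.
  rewrite map_inj_in_uniq ?iota_uniq // => i k.
  by rewrite !mem_iota !add0n !ltnS => iD kD; apply: vinj.
pose E := enum [pred x | ext v x].
have sE : size E = 6.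
  rewrite -cardE; have := cardC (mem Pv); rewrite Gn.
  have /card_uniqP -> := uP; rewrite size_map size_iota.
  rewrite (_ : #|[predC mem Pv]| = #|[pred x | ext v x]|); last by apply: eq_card.
  by move: #|_|; clear; lia.
pose L := [seq dist x (v D) | x <- E].
pose C := [seq D - c | c <- iota 2 7].
have uC : uniq C.
  rewrite map_inj_in_uniq ?iota_uniq // => i k.
  by rewrite !mem_iota; clear -D20; lia.
have : ~~ all (mem L) C.
  apply/negP => /allP /(uniq_leq_size uC).
  by rewrite !size_map size_iota sE.
move=> /allPn[_ /mapP[c + ->] cL]; rewrite mem_iota => c28.
exists c; first by clear -c28; lia.
move=> x ex xc; case/negP: cL; rewrite /= -xc; apply: map_f.
by rewrite mem_enum.
Qed.

(** Vertices beyond the clean level are traced towards [v D], those before it towards [v 0]. An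
    external vertex cannot step over the level, so each trace enters the geodesic at distance at
    least 2 from the end it aims at, as [entry] requires. *)
Lemma classify x : ext v x -> good v x \/
  (adj (v 1) x /\ dist x (v D) = D) \/ (adj (v D.-1) x /\ dist x (v 0) = D).
Proof.
have [c c28 clean] := clean_level.
move=> ex; have [lt|gt|E] := ltngtP (dist x (v D)) (D - c); last by have := clean x ex.
  pose w i := v (D - i); have gw : geodesic D w by apply: geodesic_rev.
  have w0 : w D = v 0 by rewrite /w subnn.
  pose W z := ext v z && (dist z (v D) < D - c).
  suff st z : W z -> ext w z /\ exists u, [/\ adj z u, (dist u (w D)).+1 = dist z (w D) &
      W u \/ exists2 i, i <= D - 2 & u = w i].
    have Wx : W x by rewrite /W ex.
    have [/good_rev|h] := entry gw st Wx; first by left.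
    by right; right; move: h; rewrite w0 /w subn1.
  move=> /andP[ez ltz]; split.
    apply/extP => i iD; rewrite /w; move/extP: ez; apply; exact: leq_subr.
  case zE : (dist z (w D)) => [|m].
    move/(dist_eq0 Gc): zE; rewrite w0 => zE.
    by move/extP: ez => /(_ 0 (leq0n D)).
  have [u zu um] := dist_pred Gc zE; exists u; split=> //; first by rewrite um.
  have := dist_adj Gc (v D) (etrans (adj_sym _ _) zu) => du.
  case: (boolP (ext v u)) => [eu|/extPn[j jD uj]].
    left; rewrite /W eu /=; have := clean u eu; move: ltz du; clear; lia.
  right; exists (D - j); last by rewrite /w subKn.
  rewrite uj gv.2 // in du; clear -du ltz c28 D20 jD; lia.
pose W z := ext v z && (dist z (v D) > D - c).
suff st z : W z -> ext v z /\ exists u, [/\ adj z u, (dist u (v D)).+1 = dist z (v D) &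
    W u \/ exists2 i, i <= D - 2 & u = v i].
  have Wx : W x by rewrite /W ex.
  by have [h|h] := entry gv st Wx; [left|right; left].
move=> /andP[ez ltz]; split=> //.
case zE : (dist z (v D)) => [|m]; first by rewrite zE in ltz.
have [u zu um] := dist_pred Gc zE; exists u; split=> //; first by rewrite um.
rewrite zE in ltz.
case: (boolP (ext v u)) => [eu|/extPn[j jD uj]].
  by left; rewrite /W eu /=; have := clean u eu; rewrite um; move: ltz; clear; lia.
right; exists j => //; rewrite uj gv.2 // in um.
clear -um ltz c28 D20 jD; lia.
Qed.

Let far x z : adj (v 1) x -> adj x z -> adj z (v D.-1) -> False.
Proof.
move=> vx xz zv; have D1 : 1 <= D.-1 <= D by clear -D20; lia.
have := geodesic_dist Gc gv D1.
have := dist_adj Gc (v D.-1) vx; have := dist_adj Gc (v D.-1) xz.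
have := dist_adj Gc (v D.-1) zv; rewrite distxx; clear -D20; lia.
Qed.

Let far' x : adj (v 1) x -> adj x (v D.-1) -> False.
Proof.
move=> vx xv; have D1 : 1 <= D.-1 <= D by clear -D20; lia.
have := geodesic_dist Gc gv D1.
have := dist_adj Gc (v D.-1) vx; have := dist_adj Gc (v D.-1) xv.
rewrite distxx; clear -D20; lia.
Qed.

Let D1 : 0 < 1 < D. Proof. exact: leq_trans D20. Qed.

Lemma no_ext_at_0 x : ext v x -> adj (v 0) x -> False.
Proof.
move=> ex v0x; have x0 : adj x (v 0) by rewrite adj_sym.
case: (classify ex) => [gx|[[v1x _]|[xv _]]].
- by have := good_path y0 ysup D20 Gc gv gx (leq0n D) x0.
- exact: (no_triangle y0 ysup D20 Gc gv ex v1x v0x).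
have v10 : adj (v 1) (v 0) by rewrite adj_sym gv.1 //; apply: leq_trans D20.
by apply: (far v10 v0x); rewrite adj_sym.
Qed.

(** Here [x] is at distance [D] from [v D], so a neighbour on the geodesic is [v 0] or [v 1], and
    [no_ext_at_0] excludes the former. An external neighbour would make [x] good, be a second
    pendant at [v 1], or connect the two ends by a shortcut. *)
Lemma leaf_at_1 x z : ext v x -> adj (v 1) x -> adj x z -> z = v 1.
Proof.
move=> ex v1x xz; have x1 : adj x (v 1) by rewrite adj_sym.
have notgood : good v x -> False.
  by move=> gx; have := good_path y0 ysup D20 Gc gv gx (ltnW (andP D1).2) x1.
case: (classify ex) => [/notgood //|[[_ xD]|[xv _]]]; last first.
  by case: (far' v1x); rewrite adj_sym.
case: (boolP (ext v z)) => [ez|/extPn[j jD zj]].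
  exfalso; case: (classify ez) => [gz|[[v1z _]|[zv _]]].
  - by apply: notgood; apply: (good_adj y0 ysup D20 Gc gv gz) ex; rewrite adj_sym.
  - have E := ext_unique y0 ysup D20 Gc gv D1 ex ez v1x v1z.
    by rewrite E adj_irr in xz.
  - by apply: (far v1x xz); rewrite adj_sym.
have := dist_adj Gc (v D) xz; rewrite xD zj gv.2 // => h.
have [j0|j0] := posnP j; last by congr v; clear -h j0 jD; lia.
by case: (no_ext_at_0 ex); rewrite adj_sym -j0 -zj.
Qed.

End Classify.

Section Levels.
Variable v : nat -> G.
Hypothesis gv : geodesic D v.

Let vinj i k : i <= D -> k <= D -> v i = v k -> i = k := @geodesic_inj G D v i k gv.
Let vr i := v (D - i).
Let gr : geodesic D vr. Proof. exact: geodesic_rev. Qed.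
Let ext_vr u : ext v u -> ext vr u.
Proof. by move=> /extP h; apply/extP => i iD; apply: h; apply: leq_subr. Qed.
Let D1 : 0 < 1 < D. Proof. exact: leq_trans D20. Qed.

Definition level1 p x := ext v x && adj (v p) x.
Definition level2 p x := ext v x && [exists u, level1 p u && adj u x].

Lemma level1_bounds p x : p <= D -> level1 p x -> 0 < p < D.
Proof.
move=> pD /andP[ex px]; apply/andP; split.
  by rewrite lt0n; apply/eqP => p0; rewrite p0 in px; apply: (no_ext_at_0 gv ex px).
rewrite ltn_neqAle pD andbT; apply/eqP => pE; rewrite pE in px.
by apply: (no_ext_at_0 gr (ext_vr ex)); rewrite /vr subn0.
Qed.

Lemma level1_second p x z : p <= D -> level1 p x -> adj x z -> z != v p ->
  (p = 2 \/ p = D - 2) /\ ext v z.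
Proof.
move=> pD /[dup] lx /andP[ex px] xz zp; have pb := level1_bounds pD lx.
case: (boolP (2 <= p <= D - 2)) => p2.
  split; first exact: (second_end y0 ysup D20 Gc gv p2 ex px xz zp).
  exact: (second_ext y0 ysup D20 Gc gv p2 ex px xz zp).
have [p1|p1] : p = 1 \/ p = D.-1 by clear -p2 pb; lia.
  by rewrite p1 in px zp; rewrite (leaf_at_1 gv ex px xz) eqxx in zp.
have := leaf_at_1 gr (ext_vr ex); rewrite /vr subn1 -p1 => /(_ z px xz) E.
by rewrite E eqxx in zp.
Qed.

Lemma level1_path p q x : p <= D -> q <= D -> level1 p x -> adj x (v q) -> q = p.
Proof.
move=> pD qD lx xq; have [/vinj -> //|ne] := eqVneq (v q) (v p).
by have [_ /extP/(_ q qD)] := level1_second pD lx xq ne.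
Qed.

Lemma level1_unique p x x' : p <= D -> level1 p x -> level1 p x' -> x = x'.
Proof.
move=> pD lx; have pb := level1_bounds pD lx; case/andP: lx => ex px /andP[ex' px'].
exact: (ext_unique y0 ysup D20 Gc gv pb ex ex' px px').
Qed.

Lemma level2P p x : p <= D -> level2 p x -> [/\ ext v x, p = 2 \/ p = D - 2 &
  exists u, [/\ level1 p u, adj u x, x != v p & forall z, adj x z -> z = u]].
Proof.
move=> pD /andP[ex /existsP[u /andP[lu ux]]].
have xp : x != v p by apply/eqP; move/extP: ex; apply.
have [p2 _] := level1_second pD lu ux xp; split=> //.
exists u; split=> // z xz; case/andP: lu => eu pu.
have p22 : 2 <= p <= D - 2 by case: p2 => ->; clear -D20; lia.
exact: (second_leaf y0 ysup D20 Gc gv p22 eu pu ux xp xz).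
Qed.

Lemma level2_unique p x x' : p <= D -> level2 p x -> level2 p x' -> x = x'.
Proof.
move=> pD /(level2P pD)[_ p2 [u [lu ux xp _]]] /(level2P pD)[_ _ [u' [lu' ux' xp' _]]].
rewrite -(level1_unique pD lu lu') in ux'; case/andP: lu => eu pu.
have p22 : 2 <= p <= D - 2 by case: p2 => ->; clear -D20; lia.
exact: (second_unique y0 ysup D20 Gc gv p22 eu pu ux ux' xp xp').
Qed.

Lemma levels x : ext v x -> exists2 p, p <= D & level1 p x || level2 p x.
Proof.
move=> ex; case: (classify gv ex) => [[_ [i [iD H]]]|[[v1x _]|[vx _]]].
- have iD' : i <= D by case/andP: iD => _ /leq_trans; apply; apply: leq_subr.
  exists i => //; case: H => [vx|[u [eu vu ux]]]; first by rewrite /level1 ex vx.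
  by apply/orP; right; rewrite /level2 ex; apply/existsP; exists u; rewrite /level1 eu vu.
- by exists 1; [case/andP: D1 => _ /ltnW|rewrite /level1 ex v1x].
- by exists D.-1; [apply: leq_pred|rewrite /level1 ex vx].
Qed.

End Levels.
End Structure.

(** * Identification of a competitor with a comb *)

Section Embed.
Import Order.TTheory GRing.Theory Num.Theory.
Variables (R : realFieldType) (G : sgraph) (y : G -> R) (D : nat).
Hypothesis y0 : forall x, (0 < y x)%R.
Hypothesis ysup : forall x, (\sum_(u | adj x u) y u <= 103 / 50 * y x)%R.
Hypothesis D20 : 20 <= D.
Hypothesis Gc : connected_graph G.
Hypothesis GD : diameter G = D.
Hypothesis Gn : #|G| = D + 7.
Variable v : nat -> G.
Hypothesis gv : geodesic D v.

Local Notation L1 := (@level1 G D v).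
Local Notation L2 := (@level2 G D v).

(** Counting nonempty levels gives the depth, since each level holds at most one vertex per position
    ([level1_unique], [level2_unique]). *)
Definition hang p : nat := [exists x, L1 p x] + [exists x, L2 p x].

Lemma hang_le p : hang p <= 2.
Proof. by rewrite /hang; case: [exists x, L1 p x]; case: [exists x, L2 p x]. Qed.

Let L2_L1 p x : L2 p x -> exists u, L1 p u.
Proof. by move=> /andP[_ /existsP[u /andP[lu _]]]; exists u. Qed.

Lemma hang_gt0 p : 0 < hang p -> exists x, L1 p x.
Proof.
rewrite /hang; case: existsP => [//|_]; case: existsP => [[x /L2_L1]|] //.
Qed.

Lemma hang_eq2 p : hang p = 2 -> exists x, L2 p x.
Proof. by rewrite /hang; case: existsP => _; case: existsP. Qed.

(** The relational form of [place]: injectivity and adjacency are then checked by cases on two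
    levels, without unfolding the choices in [place]. *)
Definition at_level l p x : Prop :=
  match l with 0 => x = v p | 1 => L1 p x | _ => L2 p x end.

Definition place (u : comb D hang) : G :=
  let p := cpos u in
  match clev u with
  | 0 => v p
  | 1 => odflt (v p) [pick x | L1 p x]
  | _ => odflt (v p) [pick x | L2 p x]
  end.

Lemma clev_le2 (u : comb D hang) : clev u <= 2.
Proof. exact: leq_trans (clev_le u) (hang_le _). Qed.

Lemma placeP u : at_level (clev u) (cpos u) (place u).
Proof.
rewrite /place; have := clev_le u; have := clev_le2 u.
case: (clev u) => [|[|[|//]]] //= _ h.
  by case: pickP => // none; have [x] := hang_gt0 h; rewrite none.
case: pickP => // none; have [|x] := @hang_eq2 (cpos u); last by rewrite none.
by apply/eqP; rewrite eqn_leq h hang_le.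
Qed.

Let L1b p x := level1_bounds y0 ysup D20 Gc GD Gn gv (p := p) (x := x).
Let L1u p x x' := level1_unique y0 ysup D20 Gc GD Gn gv (p := p) (x := x) (x' := x').
Let L1p p q x := level1_path y0 ysup D20 Gc GD Gn gv (p := p) (q := q) (x := x).
Let L2p p x := level2P y0 ysup D20 Gc GD Gn gv (p := p) (x := x).
Let L2u p x x' := level2_unique y0 ysup D20 Gc GD Gn gv (p := p) (x := x) (x' := x').

Let L1e p x : L1 p x -> ext D v x /\ adj x (v p).
Proof. by move=> /andP[ex px]; rewrite adj_sym. Qed.

Let L12 p q x : p <= D -> q <= D -> L1 p x -> L2 q x -> False.
Proof.
move=> pD qD /L1e[_ xp] /(L2p qD)[_ _ [u [lu _ _ xu]]].
have [/extP eu _] := L1e lu.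
by apply: (eu p pD); rewrite (xu _ xp).
Qed.

Lemma at_level_inj l p l' p' x : p <= D -> p' <= D -> l <= l' <= 2 ->
  at_level l p x -> at_level l' p' x -> p = p' /\ l = l'.
Proof.
move=> pD p'D /andP[]; case: l' => [|[|[|l']]]; case: l => [|[|[|l]]] //= _ _.
- by move=> -> /(geodesic_inj gv pD p'D) ->.
- by move=> -> lx; have [/extP/(_ p pD)] := L1e lx.
- by move=> lx lx'; have [_ xp] := L1e lx'; rewrite (L1p pD p'D lx xp).
- by move=> -> lx; have [/extP/(_ p pD)] := L2p p'D lx.
- by move=> lx lx'; case: (L12 pD p'D lx lx').
move=> /(L2p pD)[_ _ [u [lu _ _ xu]]] /(L2p p'D)[_ _ [u' [lu' ux' _ xu']]].
have E := xu u' (etrans (adj_sym _ _) ux'); rewrite E in lu'.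
by have [_ uq] := L1e lu'; rewrite (L1p pD p'D lu uq).
Qed.

Lemma adj_at_level l p l' p' x x' : p <= D -> p' <= D -> l <= l' <= 2 ->
  at_level l p x -> at_level l' p' x' ->
  adj x x' = cstep p l p' l' || cstep p' l' p l.
Proof.
move=> pD p'D /andP[]; rewrite /cstep; case: l' => [|[|[|l']]]; case: l => [|[|[|l]]] //= _ _.
- move=> -> ->; rewrite !andbT !andbF !orbF; apply/idP/idP.
    by move=> /(geodesic_adj Gc gv pD p'D)[->|->]; rewrite eqxx ?orbT.
  move=> /orP[]/eqP E; subst.
    by apply: gv.1.
  by rewrite adj_sym; apply: gv.1.
- move=> -> lx; rewrite !andbF !andbT /= !orbF; apply/idP/eqP => [|->]; last first.
    by have [_] := L1e lx; rewrite adj_sym.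
  by rewrite adj_sym => /(L1p p'D pD lx).
- move=> lx lx'; rewrite !andbF /=; apply/negP => xx'.
  have [ex' x'p] := L1e lx'.
  have l2 : L2 p x' by rewrite /level2 ex'; apply/existsP; exists x; rewrite lx.
  exact: L12 lx' l2.
- move=> -> /(L2p p'D)[_ _ [u [lu _ _ xu]]]; rewrite !andbF /=; apply/negP.
  rewrite adj_sym => /xu E; have [/extP /(_ p pD) eu _] := L1e lu.
  by apply: eu.
- move=> lx /[dup] lx' /(L2p p'D)[_ _ [u [lu ux' _ xu]]]; rewrite !andbF !andbT /= orbF.
  apply/idP/eqP => [|E].
    rewrite adj_sym => /xu E; rewrite -E in lu; have [_ xp] := L1e lx.
    by rewrite (L1p p'D pD lu xp).
  by subst p'; rewrite (L1u pD lx lu).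
move=> lx /(L2p p'D)[_ _ [u [lu ux' _ xu]]]; rewrite !andbF /=; apply/negP.
rewrite adj_sym => /xu E; rewrite -E in lu; exact: L12 lu lx.
Qed.

Lemma isomorphic_comb : isomorphic G (comb D hang).
Proof.
apply: isomorphic_sym; exists place.
have hl p : p <= D -> hang p <= 2 by rewrite hang_le.
have inj : injective place.
  move=> a b ab; have pa := placeP a; have pb := placeP b; rewrite -ab in pb.
  have [le|/ltnW le] := leqP (clev a) (clev b).
    have [|E1 E2] := at_level_inj (cpos_le a) (cpos_le b) _ pa pb.
      by rewrite le clev_le2.
    exact: comb_inj.
  have [|E1 E2] := at_level_inj (cpos_le b) (cpos_le a) _ pb pa.
    by rewrite le clev_le2.
  exact: comb_inj.
have surj x : x \in codom place.
  case: (boolP (ext D v x)) => [ex|/extPn[i iD ->]]; last first.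
    apply/codomP; exists (cvx D hang i 0); have := placeP (cvx D hang i 0).
    by have [-> ->] := cvxP hl iD (leq0n _).
  have [p pD] := levels y0 ysup D20 Gc GD Gn gv ex.
  case: (boolP (L2 p x)) => [lx _|_].
    have [u lu] := L2_L1 lx.
    have h2 : 2 <= hang p.
      have e1 : [exists z, L1 p z] by apply/existsP; exists u.
      have e2 : [exists z, L2 p z] by apply/existsP; exists x.
      by rewrite /hang e1 e2.
    apply/codomP; exists (cvx D hang p 2); have := placeP (cvx D hang p 2).
    by have [-> ->] := cvxP hl pD h2; apply: L2u.
  rewrite orbF => lx.
  have h1 : 1 <= hang p.
    have e1 : [exists z, L1 p z] by apply/existsP; exists x.
    by rewrite /hang e1.
  apply/codomP; exists (cvx D hang p 1); have := placeP (cvx D hang p 1).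
  by have [-> ->] := cvxP hl pD h1; apply: L1u.
split.
  apply: inj_card_bij => //; rewrite -(card_codom inj).
  by apply: subset_leq_card; apply/fintype.subsetP => x _; apply: surj.
move=> a b; rewrite cadjE.
have [le|/ltnW le] := leqP (clev a) (clev b).
  by apply: (adj_at_level (cpos_le a) (cpos_le b) _ (placeP a) (placeP b)); rewrite le clev_le2.
rewrite adj_sym orbC.
by apply: (adj_at_level (cpos_le b) (cpos_le a) _ (placeP b) (placeP a)); rewrite le clev_le2.
Qed.

Lemma hang_sum : \sum_(p < D.+1) hang p = 6.
Proof.
have [f [fb _]] := isomorphic_comb; have := bij_eq_card fb.
by rewrite card_comb => [|p _]; rewrite ?hang_le // Gn; clear; lia.
Qed.

Section Superharmonic.
Local Open Scope ring_scope.
Variables (t : R).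
Hypothesis t1 : 1 < t.
Local Notation lam := (t + t^-1).
Hypothesis yl : forall x, \sum_(u | adj x u) y u <= lam * y x.
Let Y i := y (v i).

Let t0 : 0 < t. Proof. exact: lt_trans t1. Qed.
Let lam0 : 0 < lam. Proof. by rewrite addr_gt0 ?invr_gt0. Qed.
Let l21 : 0 < lam ^+ 2 - 1.
Proof.
rewrite subr_gt0 exprn_egt1 //; first by rewrite ltr_wpDr // invr_ge0 ltW.
Qed.

Let nb1 := nbr1 y0 yl.
Let nb2 := nbr2 y0 yl.
Let nb3 := nbr3 y0 yl.

Let vinj i k : (i <= D)%N -> (k <= D)%N -> v i = v k -> i = k := @geodesic_inj G D v i k gv.
Let vadj i : (i < D)%N -> adj (v i) (v i.+1) := @proj1 _ _ gv i.
Let vadj' i : (0 < i <= D)%N -> adj (v i) (v i.-1) := @geodesic_adj_pred _ _ _ i gv.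
Let vneq i : (0 < i < D)%N -> v i.-1 != v i.+1 := @geodesic_neq _ _ _ i gv.

Lemma chain_sup i : (i.+2 <= D)%N -> Y i + Y i.+2 <= lam * Y i.+1.
Proof.
move=> iD; apply: nb2; first by apply: (@vneq i.+1).
  by apply: (@vadj' i.+1); rewrite /= ltnW.
exact: vadj.
Qed.

Lemma chain_first : Y 1 <= lam * Y 0.
Proof. by apply: nb1; apply: vadj; apply: leq_trans D20. Qed.

Lemma chain_last : Y D.-1 <= lam * Y D.
Proof. by apply: nb1; apply: vadj'; rewrite leqnn andbT; apply: leq_trans D20. Qed.

Let pendant_slack p u : (p <= D)%N -> L1 p u -> Y p.-1 + Y p.+1 + y u <= lam * Y p.
Proof.
move=> pD lu; have /andP[p0 pD'] := L1b pD lu; have [/extP eu up] := L1e lu.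
apply: nb3; last by rewrite adj_sym.
- rewrite /= !inE negb_or vneq ?p0 //=.
  have pm : (p.-1 <= D)%N := leq_trans (leq_pred _) pD.
  by rewrite andbT; apply/andP; split; apply/eqP => /esym; apply: eu.
- by apply: vadj'; rewrite p0.
- exact: vadj.
Qed.

Lemma chain_site p : (p <= D)%N -> (0 < hang p)%N ->
  (0 < p < D)%N /\ Y p.-1 + Y p.+1 + lam^-1 * Y p <= lam * Y p.
Proof.
move=> pD /hang_gt0[u lu]; split; first exact: L1b lu.
apply: le_trans (pendant_slack pD lu); rewrite lerD2l mulrC ler_pdivrMr // mulrC.
by apply: nb1; case: (L1e lu).
Qed.

(** Eliminate [y c] between the inequalities at [b] and [c]. Applied to the pendant path and to the
    end of the geodesic, this gives the two terms subtracted in [end_ratio]. *)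
Let two_step a b c : a != c -> adj b a -> adj b c -> adj c b ->
  lam / (lam ^+ 2 - 1) * y a <= y b.
Proof.
move=> ac ba bc cb; rewrite mulrAC ler_pdivrMr //.
have h1 := nb2 ac ba bc; have h2 := nb1 cb.
have := ler_wpM2l (ltW lam0) h1; rewrite expr2; lra.
Qed.

Lemma chain_end p : (p <= D)%N -> hang p = 2%N ->
  (p = 2%N /\ Y 3 <= end_ratio t * Y 2) \/
  (p = (D - 2)%N /\ Y (D - 2).-1 <= end_ratio t * Y (D - 2)).
Proof.
move=> pD /hang_eq2[x /(L2p pD)[_ p2 [u [lu ux xp xu]]]].
have xu' : adj x u by rewrite adj_sym.
have [_ up] := L1e lu; have px : v p != x by rewrite eq_sym.
have h := two_step px up ux xu'.
have hs := pendant_slack pD lu.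
case: p2 => E; [left|right]; subst p; split=> //.
  have n20 : v 2 != v 0 by apply/eqP => /vinj; clear -D20; lia.
  have b12 : adj (v 1) (v 2) by apply: vadj; apply: leq_trans D20.
  have b10 : adj (v 1) (v 0) by apply: (@vadj' 1); apply: leq_trans D20.
  have b01 : adj (v 0) (v 1) by apply: vadj; apply: leq_trans D20.
  have := two_step n20 b12 b10 b01; move: hs h; rewrite /Y /end_ratio /=; lra.
have [e1 e2 e3] : [/\ (D - 2).+1 = D.-1, D.-1.-1 = D - 2 & D.-1.+1 = D]%N.
  by clear -D20; split; lia.
have n20 : v (D - 2) != v D by apply/eqP => /vinj; clear -D20; lia.
have b10 : adj (v D.-1) (v D) by rewrite -{2}e3; apply: vadj; rewrite e3.
have b12 : adj (v D.-1) (v (D - 2)).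
  by rewrite -e2; apply: vadj'; rewrite leq_pred -ltnS e3; clear -D20; lia.
have b01 : adj (v D) (v D.-1) by rewrite adj_sym.
have := two_step n20 b12 b10 b01; move: hs h; rewrite e1 /Y /end_ratio; lra.
Qed.

End Superharmonic.
End Embed.

(** * The extremal trees *)

Section Star.
Variables (k j : nat).
Local Notation ks := [:: k; k + j; k].
Local Notation D := (3 * k + 7 + j).

Lemma depth_starE p : depth ks p =
  if (p == 2) || (p == 3 * k + j + 5) then 2
  else if (p == k + 3) || (p == 2 * k + j + 4) then 1 else 0.
Proof.
rewrite /depth /= !inE.
have -> : 2 + k + 1 + (k + j) + 1 + k + 1 = 3 * k + j + 5 by lia.
have -> : 2 + k + 1 = k + 3 by lia.
by have -> : k + 3 + (k + j) + 1 = 2 * k + j + 4 by lia.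
Qed.

Lemma depth_star_le p : depth ks p <= 2.
Proof. by rewrite depth_starE; case: ifP => // _; case: ifP. Qed.

Lemma depth_star_left p : depth ks p <= p.
Proof. by rewrite depth_starE; case: ifP => ?; [|case: ifP => ?]; lia. Qed.

Lemma depth_star_right p : p <= D -> depth ks p <= D - p.
Proof. by rewrite depth_starE; case: ifP => ?; [|case: ifP => ?]; lia. Qed.

Lemma depth_star0 p : p != 2 -> p != k + 3 -> p != 2 * k + j + 4 -> p != D - 2 ->
  depth ks p = 0.
Proof. by rewrite depth_starE => ????; case: ifP => ?; [|case: ifP => ?]; lia. Qed.

Lemma depth_star1 p : p = k + 3 \/ p = 2 * k + j + 4 -> depth ks p = 1.
Proof. by rewrite depth_starE => ?; case: ifP => ?; [|case: ifP => ?]; lia. Qed.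

Lemma depth_star2 p : p = 2 \/ p = D - 2 -> depth ks p = 2.
Proof. by rewrite depth_starE => ?; case: ifP => ?; [|case: ifP => ?]; lia. Qed.

Lemma sum_indicator n a : \sum_(p < n) (nat_of_ord p == a) = (a < n).
Proof.
elim: n => [|n IH]; first by rewrite big_ord0.
by rewrite big_ord_recr /= IH; lia.
Qed.

Lemma depth_star_sum : \sum_(p < D.+1) depth ks p = 6.
Proof.
have E (p : 'I_D.+1) : depth ks p = (p == 2 :> nat) + (p == 2 :> nat) + (p == k + 3 :> nat)
    + (p == 2 * k + j + 4 :> nat) + (p == 3 * k + j + 5 :> nat) + (p == 3 * k + j + 5 :> nat).
  by rewrite depth_starE; case: ifP => ?; [|case: ifP => ?]; lia.
rewrite (eq_bigr _ (fun p _ => E p)) !big_split /= !sum_indicator; lia.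
Qed.

Lemma star_order_diam : conn_order_diam (D + 7) D (T ks).
Proof.
have h := @comb_conn_order_diam D (depth ks) (fun p _ => depth_star_le p)
  (fun p _ => depth_star_left p) depth_star_right.
rewrite depth_star_sum in h; have -> : D + 7 = D.+1 + 6 by lia.
apply: isomorphic_conn_order_diam h.
have DE : D = size ks + 4 + sumn ks by rewrite /=; lia.
rewrite DE; exact: comb_T.
Qed.

End Star.

(** * Competitors against the candidate tree *)

Section Main.
Import Order.TTheory GRing.Theory Num.Theory.
Local Open Scope ring_scope.
Variable R : realType.

Lemma spectral_radius_iso (G H : sgraph) : connected_graph G -> connected_graph H ->
  (0 < #|G|)%N -> isomorphic G H -> spectral_radius R G = spectral_radius R H.
Proof.
move=> Gc Hc G0 [f [[g fg gf] fa]].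
have H0 : (0 < #|H|)%N by rewrite -(bij_eq_card (Bijective fg gf)).
have [y [y0 yE]] := perron R Gc G0; have [z [z0 zE]] := perron R Hc H0.
apply: (positive_eigen_unique (z := z \o f) G0 y0 _ yE) => v; first exact: z0.
rewrite /= -zE (reindex f) /=; last by exists g => u _.
by apply: eq_bigl => u; rewrite fa.
Qed.

(** The exponent is at least 142 = 2 * 71, and the square of 5/8 is below 1/2. Of the 71 halvings,
    64 = 8 * 8 give the eighth power of 1/200 and the other 7 give 1/100. *)
Lemma small_power k : (141 <= k)%N ->
  (5 / 8 : R) ^+ k.+1 <= ((1 / 200) ^+ 4) ^+ 2 / 100.
Proof.
move=> k141; apply: le_trans (_ : (1 / 2) ^+ 71 <= _).
  apply: le_trans (_ : (5 / 8) ^+ (2 * 71) <= _).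
    by apply: ler_wiXn2l => //; lra.
  by rewrite exprM ler_pXn2r ?nnegrE ?exprn_ge0 //; rewrite ?expr2; lra.
have h8 : (1 / 2 : R) ^+ 8 <= 1 / 200 by rewrite !exprS expr0; lra.
have h7 : (1 / 2 : R) ^+ 7 <= 100^-1 by rewrite !exprS expr0; lra.
have p8 n : 0 <= (1 / 2 : R) ^+ n by rewrite exprn_ge0 //; lra.
have q : 0 <= 1 / 200 :> R by lra.
rewrite (exprD _ 64 7) (exprM _ 8 8) -(exprM _ 4 2); apply: ler_pM => //.
  by rewrite exprn_ge0.
by rewrite ler_pXn2r ?nnegrE.
Qed.

(** Assuming only a weak inequality of radii lets this give both the minimality of the tree and its
    uniqueness. *)
Lemma star_minimizes k j (H : sgraph) : (141 <= k)%N -> (j <= 2)%N ->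
  conn_order_diam (3 * k + 7 + j + 7) (3 * k + 7 + j) H ->
  spectral_radius R H <= spectral_radius R (T [:: k; (k + j)%N; k]) ->
  isomorphic H (T [:: k; (k + j)%N; k]).
Proof.
move=> k141 j2 [Hc Hn HD] le.
set ks := [:: k; (k + j)%N; k] in le *; set D := (3 * k + 7 + j)%N in Hn HD.
have DE : (size ks + 4 + sumn ks = D)%N by rewrite /D /=; clear; lia.
have := comb_T ks; rewrite DE => TC.
have [Tc Tn TD] := star_order_diam k j; rewrite -/ks -/D in Tc Tn TD.
have dep_le p : (p <= D)%N -> (depth ks p <= 2)%N by move=> _; apply: depth_star_le.
have Cc : connected_graph (comb D (depth ks)) by apply: comb_connected.
have C0 : (0 < #|comb D (depth ks)|)%N by rewrite card_comb.
have rE := spectral_radius_iso Cc Tc C0 TC; rewrite -rE in le.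
set lam := spectral_radius R (comb D (depth ks)) in le.
have [y [y0 yE]] := perron R Cc C0; rewrite -/lam in yE.
have D0 : (0 < D)%N by rewrite /D addnAC ltn_addl.
have d0 : depth ks 0 = 0%N.
  by apply: depth_star0; rewrite ?addnS // -/D eq_sym -lt0n subn_gt0 /D addnAC ltn_addl.
have dD : depth ks D = 0%N by apply: depth_star0; rewrite /D; clear; lia.
have lam0 : 0 < lam := comb_lam_gt0 dep_le y0 yE D0 d0.
pose Y p := y (cvx D (depth ks) p 0).
have k2 : (2 <= k)%N by apply: leq_trans k141.
have [||||||t [[t1 lE e0 n0 res] small]] := @star_resonance R lam Y D k j k2 erefl lam0.
- by move=> i _; apply: y0.
- exact: comb_eq_first.
- exact: comb_eq_last.
- move=> i iD i2 ik ij iD2; apply: comb_eq_plain => //.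
  exact: depth_star0.
- move=> i ii; apply: comb_eq_site => //; last by rewrite gt_eqF.
    by case: ii => ->; rewrite /D; clear; lia.
  exact: depth_star1.
- move=> i ii; apply: comb_eq_end => //.
    by case: ii => ->; rewrite /D; clear; lia.
  exact: depth_star2.
have e_small : eps (t ^+ 2) <= (1 / 200) ^+ 4.
  apply: small; last exact: small_power.
  by apply/andP; split; rewrite !exprS expr0; lra.
have t0 : 0 < t by apply: lt_trans t1.
(* [lam ^+ 2] is [2 * s + 1] up to the negative term [- eps s / s], and [s <= 81 / 50] gives 4.24,
   below the square 4.2436 of 103/50. *)
have lam_le : lam <= 103 / 50.
  have l2 : lam ^+ 2 = 2 * t ^+ 2 + 1 - eps (t ^+ 2) / t ^+ 2.
    by rewrite lE /eps; field; rewrite gt_eqF.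
  have s0 : 0 < t ^+ 2 by rewrite exprn_gt0.
  have es : 0 <= eps (t ^+ 2) / t ^+ 2 by rewrite divr_ge0 ?ltW.
  have e40 : eps (t ^+ 2) <= 1 / 1000.
    by apply: le_trans e_small _; rewrite !exprS expr0; lra.
  have s162 : t ^+ 2 <= 81 / 50.
    by rewrite leNgt; apply/negP => h; move: e40; rewrite /eps; nra.
  rewrite -(@ler_pXn2r _ 2) ?nnegrE ?(ltW lam0) //; last by rewrite divr_ge0.
  by rewrite l2 expr2; lra.
have H0 : (0 < #|H|)%N by rewrite Hn addn_gt0 orbT.
have [z [z0 zE]] := perron R Hc H0.
have zl x : \sum_(u | adj x u) z u <= (t + t^-1) * z x.
  by rewrite zE -lE ler_pM2r.
have zs x : \sum_(u | adj x u) z u <= 103 / 50 * z x.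
  by apply: le_trans (zl x) _; rewrite -lE ler_pM2r.
have [a [b ab]] := diameter_attained H0; rewrite HD in ab.
have [v [gv _ _]] := geodesic_exists Hc a b; rewrite ab in gv.
have D20 : (20 <= D)%N by rewrite /D; clear -k141; lia.
have hangE : forall p, (p <= D)%N -> hang D v p = depth ks p.
  apply: (@dep_optimal R t t1 (fun i => z (v i)) D (hang D v) k j) => //.
  - by move=> i; apply: (chain_sup z0 gv zl).
  - exact: (chain_first z0 D20 gv zl).
  - exact: (chain_last z0 D20 gv zl).
  - by move=> p _; apply: hang_le.
  - by move=> p; apply: (chain_site z0 zs D20 Hc HD Hn gv t1 zl).
  - by move=> p; apply: (chain_end z0 zs D20 Hc HD Hn gv t1 zl).
  - exact: (hang_sum z0 zs D20 Hc HD Hn gv).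
apply: isomorphic_trans TC.
apply: isomorphic_trans (comb_eq_dep hangE).
exact: (isomorphic_comb z0 zs D20 Hc HD Hn gv).
Qed.

(** A graph of strictly smaller radius would be isomorphic to the tree by [star_minimizes], hence
    have the same radius; so the tree attains the minimum. *)
Lemma star_Gmin k j (G : sgraph) : (141 <= k)%N -> (j <= 2)%N ->
  is_Gmin R (3 * k + 7 + j + 7) (3 * k + 7 + j) G <-> isomorphic G (T [:: k; (k + j)%N; k]).
Proof.
move=> k141 j2; set Ts := T _; set n := (_ + 7)%N; set D := (_ + j)%N.
have TD : conn_order_diam n D Ts := star_order_diam k j.
have [Tc Tn _] := TD.
have n0 : (0 < n)%N by rewrite /n addn_gt0 orbT.
have min H : conn_order_diam n D H -> spectral_radius R Ts <= spectral_radius R H.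
  move=> HD; rewrite leNgt; apply/negP => lt; have [Hc Hn _] := HD.
  have iso := star_minimizes k141 j2 HD (ltW lt).
  by rewrite (spectral_radius_iso Hc Tc _ iso) ?ltxx // Hn in lt.
split=> [[GD Gm]|iso].
  exact: star_minimizes k141 j2 GD (Gm _ TD).
have GD : conn_order_diam n D G.
  exact: isomorphic_conn_order_diam (isomorphic_sym iso) TD.
split=> // H HD; have [Gc Gn _] := GD.
by rewrite (spectral_radius_iso Gc Tc _ iso) ?Gn //; apply: min.
Qed.

End Main.

Theorem theorem1p3 (R : realType) :
  exists N : nat, forall n : nat, N <= n ->
    [/\ exists G : sgraph, is_Gmin R n (n - 7) G /\
          forall H : sgraph, is_Gmin R n (n - 7) H -> isomorphic H G,
        forall k : nat, n = 3 * k + 14 ->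
          forall G : sgraph,
            is_Gmin R n (n - 7) G <-> isomorphic G (T [:: k; k; k]),
        forall k : nat, n = 3 * k + 15 ->
          forall G : sgraph,
            is_Gmin R n (n - 7) G <-> isomorphic G (T [:: k; k + 1; k])
      & forall k : nat, n = 3 * k + 16 ->
          forall G : sgraph,
            is_Gmin R n (n - 7) G <-> isomorphic G (T [:: k; k + 2; k])].
Proof.
(* Writing [n = 3 * k + 14 + j] with [j <= 2], this threshold yields [k >= 141]. *)
exists (3 * 141 + 16) => n nN.
have key k j : j <= 2 -> n = 3 * k + 14 + j -> forall G : sgraph,
    is_Gmin R n (n - 7) G <-> isomorphic G (T [:: k; k + j; k]).
  move=> j2 nE G; have k141 : 141 <= k by clear -nN nE j2; lia.
  have := star_Gmin R G k141 j2.
  have -> : 3 * k + 7 + j + 7 = n by rewrite nE; clear; lia.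
  by have -> : 3 * k + 7 + j = n - 7 by rewrite nE; clear; lia.
split.
- have [k [j [j2 nE]]] : exists k j, j <= 2 /\ n = 3 * k + 14 + j.
    by exists ((n - 14) %/ 3), ((n - 14) %% 3); split; clear -nN; lia.
  exists (T [:: k; k + j; k]); split=> [|H]; last by move/(key k j j2 nE).
  by apply/(key k j j2 nE); apply: isomorphic_refl.
- by move=> k nE G; have := key k 0 isT; rewrite !addn0; apply.
- by move=> k nE G; apply: key => //; rewrite nE -addnA.
- by move=> k nE G; apply: key => //; rewrite nE -addnA.
Qed.
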